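(* Let $\mathcal{G}_1$ be the set of germs $(M,p)\in\mathcal{G}$ such that $p$ is in the Lorentzian region of $M$, $p$ is a regular point of the $LPL$, and $m(LPL,PC:p)>2$. For generic $(M,p)\in\mathcal{G}_1$ the following hold. (1) $m(LPL,PC:p)=4$ and $m(LPL,MCNC:p)=2$. There are two possible configurations of the three curves near $p$: away from $p$, either the $PC$ and the $MCNC$ lie on opposite sides of the $LPL$, or they lie on the same side of the $LPL$ (with the $PC$ between the $LPL$ and the $MCNC$). (2) For a generic 1-parameter family of surfaces $M_t$ with $M_0=M$, the configuration of the three curves deforms near $p$, for $t\ne0$ small, as follows: for one sign of $t$, $LPL_t$ and $MCNC_t$ intersect transversally at exactly two points, $PC_t$ passes through these two points and has an ordinary tangency with $LPL_t$ at each of them, and there are no other intersections between the three curves; for the other sign of $t$, the curves $LPL_t$, $PC_t$, $MCNC_t$ are pairwise disjoint.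
   Context: Minkowski space $\mathbb{R}^3_1$ is $\mathbb{R}^3$ with $\langle \mathbf{u},\mathbf{v}\rangle=u_0v_0+u_1v_1-u_2v_2$. The vector product is defined by $\langle \mathbf a\times \mathbf b,\mathbf c\rangle=\det(\mathbf a,\mathbf b,\mathbf c)$. For a smooth regular surface $M\subset\mathbb{R}^3_1$ with local parametrization $\mathbf{x}(u,v)$, put $E=\langle \mathbf{x}_u,\mathbf{x}_u\rangle$, $F=\langle \mathbf{x}_u,\mathbf{x}_v\rangle$, $G=\langle \mathbf{x}_v,\mathbf{x}_v\rangle$, $\bar l=\langle \mathbf{x}_u\times\mathbf{x}_v,\mathbf{x}_{uu}\rangle$, $\bar m=\langle \mathbf{x}_u\times\mathbf{x}_v,\mathbf{x}_{uv}\rangle$, $\bar n=\langle \mathbf{x}_u\times\mathbf{x}_v,\mathbf{x}_{vv}\rangle$, and $$\delta=F^2-EG,\quad \tilde\delta=(E\bar n-G\bar l)^2-4(F\bar n-G\bar m)(E\bar m-F\bar l),\quad \bar K=\bar l\bar n-\bar m^2,\quad \bar H=\bar lG-2\bar mF+\bar nE.$$ The Lorentzian region is $\{\delta>0\}$. The curves $LPL$ (lightlike principal locus), $PC$ (parabolic curve), $MCNC$ (mean curvature null curve) are the zero sets of $\tilde\delta,\bar K,\bar H$. A point of one of these curves is regular if the differential of its defining function is nonzero there. If $\gamma$ is a regular parametrization of one of these curves $\gamma_1$ near a regular point $p=\gamma(0)$ and $g$ is the defining function of another one $\gamma_2$, then $m(\gamma_1,\gamma_2:p)$ is the order of contact,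 i.e. the order of vanishing of $g\circ\gamma$ at $0$ (ordinary tangency: order $2$). Genericity: $\mathcal{G}$ is the set of germs $(M,p)$ of smooth surfaces $M\subset\mathbb{R}^3_1$ at $p\in M$, identified with the set of germs of local parametrizations $(\mathbb{R}^2,0)\to(\mathbb{R}^3_1,p)$, $p\in \mathbb{R}^3_1$, with the Whitney topology, modulo diffeomorphism germs of the source $(\mathbb{R}^2,0)$ (quotient topology). A property holds for generic $(M,p)$ in a subset $\tilde{\mathcal{G}}\subset\mathcal{G}$ if the set of $(M,p)\in\tilde{\mathcal{G}}$ satisfying it is open and dense in $\tilde{\mathcal{G}}$ (induced topology). Families: a 1-parameter family $M_t$, $t\in(\mathbb{R},0)$, with $M_0=M$ is a family of surfaces given, when $M$ is the graph of $f$ over a coordinate plane (Monge form), by the graphs of $f+h(\cdot,\cdot,t)$ with $h$ smooth and $h(\cdot,\cdot,0)=0$; it is generic if $h$ satisfies suitable open and dense conditions. $LPL_t$, $PC_t$, $MCNC_t$ denote the corresponding curves of $M_t$; all assertions are local, in a neighbourhood of $p$. *)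

(* Defs.v *)
From HB Require Import structures.
From Stdlib Require Import Relations.
From mathcomp Require Import all_boot all_order all_algebra.
From mathcomp Require Import all_classical all_reals all_analysis.
From mathcomp Require Import ring.

Set Implicit Arguments.
Unset Strict Implicit.
Unset Printing Implicit Defensive.

Import Order.TTheory GRing.Theory Num.Theory.
Import numFieldNormedType.Exports.
Local Open Scope classical_set_scope.
Local Open Scope ring_scope.

Section Smooth.
Context {R : realType}.

Section Maps.
Context {n : nat} {W : normedModType R}.
Implicit Types (f : 'rV[R]_n -> W) (p : 'rV[R]_n).

Definition pd (i : 'I_n) f : 'rV[R]_n -> W := 'D_(delta_mx 0 i) f.

Definition pds (s : seq 'I_n) f : 'rV[R]_n -> W := foldr pd f s.

(* C^infinity on one neighbourhood of p, the same for all orders *)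
Definition smooth_at p f := \forall q \near p, forall s : seq 'I_n,
  {for q, continuous (pds s f)} /\
  (forall i, derivable (pds s f) q (delta_mx 0 i)).

Definition jet f : {ptws seq 'I_n -> W} := fun s => pds s f 0.

End Maps.

Definition smooth_curve_at {W : normedModType R} (t0 : R) (c : R -> W) :=
  \forall t \near t0, forall k : nat, derivable (derive1n k c) t 1.

End Smooth.

(* A subset A of S that is open and dense in S for the induced topology *)
Definition open_dense_in {T : topologicalType} (S A : set T) :=
  [/\ A `<=` S, (exists2 O, open O & A = S `&` O) & S `<=` closure A].

Section Germs.
Context {R : realType}.

Definition diffeo_germ (phi : 'rV[R]_2 -> 'rV[R]_2) :=
  [/\ smooth_at 0 phi, phi 0 = 0 &
   exists psi : 'rV[R]_2 -> 'rV[R]_2,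
     [/\ smooth_at 0 psi, psi 0 = 0,
         (\forall u \near (0 : 'rV[R]_2), psi (phi u) = u) &
         (\forall u \near (0 : 'rV[R]_2), phi (psi u) = u)]].

Definition immersion_germ (x : 'rV[R]_2 -> 'rV[R]_3) :=
  smooth_at 0 x /\ row_free (\matrix_(i < 2, j < 3) pd i x 0 0 j).

End Germs.

(* Germs at 0 are handled through representatives.  The Whitney topology on
   germs is the coarsest one for which all the jets at 0 are continuous; it is
   also the quotient of the Whitney topology on globally defined maps by
   equality of germs.  Two representatives of one germ are indistinguishable
   for it, and are identified in [surface_germ] below (take phi = id). *)
Definition local_param (R : realType) :=
  initial_topology (fun x : set_type (@immersion_germ R) => jet (set_val x)).

HB.instance Definition _ (R : realType) := Topological.on (local_param R).

Definition param_fun {R : realType} (x : local_param R) :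
  'rV[R]_2 -> 'rV[R]_3 := set_val (x : set_type (@immersion_germ R)).

Definition reparam {R : realType} (x y : local_param R) :=
  exists2 phi, diffeo_germ phi &
    \forall u \near (0 : 'rV[R]_2), param_fun x u = param_fun y (phi u).

(* [reparam] is an equivalence relation, diffeomorphism germs being a group;
   taking the generated equivalence spares the proof of this fact. *)
Definition same_surface {R : realType} : rel (local_param R) :=
  fun x y => `[< clos_refl_sym_trans _ reparam x y >].

Lemma same_surface_refl (R : realType) : reflexive (@same_surface R).
Proof. by move=> x; apply/asboolP/rst_refl. Qed.

Lemma same_surface_sym (R : realType) : symmetric (@same_surface R).
Proof.
by move=> x y; apply/asboolP/asboolP => h; apply: rst_sym.
Qed.

Lemma same_surface_trans (R : realType) : transitive (@same_surface R).
Proof.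
move=> y x z /asboolP xy /asboolP yz; apply/asboolP; exact: rst_trans xy yz.
Qed.

Canonical same_surface_equiv (R : realType) :=
  EquivRel (@same_surface R) (@same_surface_refl R) (@same_surface_sym R)
    (@same_surface_trans R).

Definition surface_germ (R : realType) :=
  quotient_topology {eq_quot (@same_surface_equiv R)}%qT.

HB.instance Definition _ (R : realType) := Topological.on (surface_germ R).

Definition surface_of {R : realType} (x : local_param R) : surface_germ R :=
  (\pi_(surface_germ R) x)%qT.

Section MinkowskiGeometry.
Context {R : realType}.

Definition mink (a b : 'rV[R]_3) : R :=
  a 0 0 * b 0 0 + a 0 1 * b 0 1 - a 0 2 * b 0 2.

Definition mcross (a b : 'rV[R]_3) : 'rV[R]_3 :=
  \row_(k < 3) [:: a 0 1 * b 0 2 - a 0 2 * b 0 1;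
                   a 0 2 * b 0 0 - a 0 0 * b 0 2;
                   - (a 0 0 * b 0 1 - a 0 1 * b 0 0)]`_k.

Lemma mcrossP (a b c : 'rV[R]_3) :
  mink (mcross a b) c = \det (\matrix_(i < 3, j < 3) [:: a; b; c]`_i 0 j).
Proof.
rewrite (expand_det_row _ 0) !big_ord_recl big_ord0 /cofactor.
rewrite !(expand_det_row _ 0) !big_ord_recl !big_ord0 /cofactor !det_mx11.
rewrite /mink !mxE /=.
have entries (v : 'rV[R]_3) : {f : nat -> R | forall i, v 0 i = f i}.
  by exists (fun k => v 0 (inord k)) => i; rewrite inord_val.
have [f fE] := entries a; have [g gE] := entries b; have [h hE] := entries c.
by rewrite !fE !gE !hE /= /bump /=; ring.
Qed.

Implicit Types (x : 'rV[R]_2 -> 'rV[R]_3).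

Definition coefE x : 'rV[R]_2 -> R := fun u => mink (pd 0 x u) (pd 0 x u).
Definition coefF x : 'rV[R]_2 -> R := fun u => mink (pd 0 x u) (pd 1 x u).
Definition coefG x : 'rV[R]_2 -> R := fun u => mink (pd 1 x u) (pd 1 x u).

Definition nvec x (u : 'rV[R]_2) := mcross (pd 0 x u) (pd 1 x u).

Definition lbar x : 'rV[R]_2 -> R := fun u => mink (nvec x u) (pd 0 (pd 0 x) u).
Definition mbar x : 'rV[R]_2 -> R := fun u => mink (nvec x u) (pd 1 (pd 0 x) u).
Definition nbar x : 'rV[R]_2 -> R := fun u => mink (nvec x u) (pd 1 (pd 1 x) u).

Definition delta x : 'rV[R]_2 -> R := fun u =>
  coefF x u ^+ 2 - coefE x u * coefG x u.

(* The defining functions of the LPL, the PC and the MCNC *)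
Definition LPL x : 'rV[R]_2 -> R := fun u =>
  (coefE x u * nbar x u - coefG x u * lbar x u) ^+ 2
  - 4 * (coefF x u * nbar x u - coefG x u * mbar x u)
      * (coefE x u * mbar x u - coefF x u * lbar x u).

Definition PC x : 'rV[R]_2 -> R := fun u =>
  lbar x u * nbar x u - mbar x u ^+ 2.

Definition MCNC x : 'rV[R]_2 -> R := fun u =>
  lbar x u * coefG x u - 2 * mbar x u * coefF x u + nbar x u * coefE x u.

End MinkowskiGeometry.

Section PlaneCurves.
Context {R : realType}.
Implicit Types (f g : 'rV[R]_2 -> R) (p : 'rV[R]_2).

(* Curves are given by their defining functions on the parameter plane. *)
Definition zeros f : set 'rV[R]_2 := [set u | f u = 0].

Definition regular_point f p := zeros f p /\ exists i, pd i f p != 0.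

Definition regular_param f p (c : R -> 'rV[R]_2) :=
  [/\ smooth_curve_at 0 c, c 0 = p, derive1 c 0 != 0 &
      \forall s \near (0 : R), zeros f (c s)].

(* m(f, g : p) = k.  Two regular parametrizations of f = 0 near a regular point
   differ by a diffeomorphism germ of the line, so the order of vanishing does
   not depend on c. *)
Definition contact_eq f g p (k : nat) :=
  regular_point f p /\
  exists2 c, regular_param f p c &
    (forall j, (j < k)%N -> derive1n j (g \o c) 0 = 0) /\
    derive1n k (g \o c) 0 != 0.

(* m(f, g : p) > k, infinite contact included *)
Definition contact_gt f g p (k : nat) :=
  regular_point f p /\
  exists2 c, regular_param f p c &
    forall j, (j <= k)%N -> derive1n j (g \o c) 0 = 0.

Definition ordinary_tangency f g p :=
  regular_point g p /\ contact_eq f g p 2.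

Definition transversal_at f g p :=
  [/\ zeros f p, zeros g p &
      pd 0 f p * pd 1 g p - pd 1 f p * pd 0 g p != 0].

(* At a regular point p of f, the two local sides of the curve f = 0 are
   f > 0 and f < 0; they correspond to the two values of the sign b. *)
Definition on_side (b : bool) f g p :=
  \forall u \near p, u != p -> zeros g u -> 0 < (-1) ^+ b * f u.

Definition opposite_sides f g1 g2 p :=
  exists b : bool, on_side b f g1 p /\ on_side (~~ b) f g2 p.

Definition same_side f g1 g2 p :=
  exists b : bool, on_side b f g1 p /\ on_side b f g2 p.

(* Meant for f1, f2 on the two sides of g = 0; when g and f2 are on one side
   of f1, this says that g separates f1 from f2 within that side. *)
Definition between g f1 f2 p := opposite_sides g f1 f2 p.

End PlaneCurves.

Section Genericity.
Context {R : realType}.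

Definition G1_param (x : 'rV[R]_2 -> 'rV[R]_3) :=
  [/\ 0 < delta x 0, regular_point (LPL x) 0 & contact_gt (LPL x) (PC x) 0 2].

Definition G1 : set (surface_germ R) :=
  [set surface_of x | x in [set x | G1_param (param_fun x)]].

Definition contact_orders (x : 'rV[R]_2 -> 'rV[R]_3) :=
  contact_eq (LPL x) (PC x) 0 4 /\ contact_eq (LPL x) (MCNC x) 0 2.

(* The MCNC is asked to be a regular curve: where it is singular, it need not
   have two branches at p, nor does a relative position persist nearby. *)
Definition configuration (x : 'rV[R]_2 -> 'rV[R]_3) :=
  [/\ regular_point (PC x) 0, regular_point (MCNC x) 0 &
      opposite_sides (LPL x) (PC x) (MCNC x) 0 \/
      same_side (LPL x) (PC x) (MCNC x) 0 /\
      between (PC x) (LPL x) (MCNC x) 0].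

(* The graph over the plane of the coordinates other than i, parametrized from
   its point above q; [f u] is the height above q + u. *)
Definition graph (i : 'I_3) (q : 'rV[R]_2) (f : 'rV[R]_2 -> R) :
  'rV[R]_2 -> 'rV[R]_3 := fun u =>
  \row_(k < 3) (if unlift i k is Some j then (q + u) 0 j else f u).

Definition at_time (h : 'rV[R]_(2 + 1) -> R) (t : R) : 'rV[R]_2 -> R :=
  fun u => h (row_mx u (const_mx t)).

Definition deformation_germ (h : 'rV[R]_(2 + 1) -> R) :=
  smooth_at 0 h /\ \forall u \near (0 : 'rV[R]_2), at_time h 0 u = 0.

(* Germs at (0, 0), with the Whitney topology as for [local_param] *)
Definition deformation :=
  initial_topology (fun h : set_type deformation_germ => jet (set_val h)).

HB.instance Definition _ := Topological.on deformation.

Definition deformation_fun (h : deformation) : 'rV[R]_(2 + 1) -> R :=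
  set_val (h : set_type deformation_germ).

Definition two_tangencies (U : set 'rV[R]_2) (x : 'rV[R]_2 -> 'rV[R]_3) :=
  exists p1 p2, [/\ p1 != p2,
    U `&` zeros (LPL x) `&` zeros (MCNC x) = [set p1; p2],
    U `&` zeros (LPL x) `&` zeros (PC x) = [set p1; p2],
    U `&` zeros (PC x) `&` zeros (MCNC x) = [set p1; p2] &
    forall p, [set p1; p2] p ->
      transversal_at (LPL x) (MCNC x) p /\
      ordinary_tangency (LPL x) (PC x) p].

Definition pairwise_disjoint (U : set 'rV[R]_2) (x : 'rV[R]_2 -> 'rV[R]_3) :=
  [/\ U `&` zeros (LPL x) `&` zeros (MCNC x) = set0,
      U `&` zeros (LPL x) `&` zeros (PC x) = set0 &
      U `&` zeros (PC x) `&` zeros (MCNC x) = set0].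

(* For every sufficiently small neighbourhood U of p, the stated configurations
   occur in U for all sufficiently small t of the respective signs. *)
Definition deforms_as_stated (X : R -> 'rV[R]_2 -> 'rV[R]_3) :=
  exists b : bool, exists2 U0 : set 'rV[R]_2, nbhs (0 : 'rV[R]_2) U0 &
    forall U : set 'rV[R]_2, nbhs (0 : 'rV[R]_2) U -> U `<=` U0 ->
    \forall t \near (0 : R)^'+, two_tangencies U (X ((-1) ^+ b * t)) /\
                          pairwise_disjoint U (X (- ((-1) ^+ b * t))).

Definition monge_form (M : surface_germ R) i q f :=
  exists2 y, surface_of y = M & param_fun y = graph i q f.

(* In every Monge form of M, an open dense set of h deforms M as stated. *)
Definition generic_deformations (M : surface_germ R) :=
  forall i q f, monge_form M i q f ->
    exists2 O : set deformation, open_dense_in [set: deformation] O &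
      forall h, O h -> deforms_as_stated
        (fun t => graph i q (fun u => f u + at_time (deformation_fun h) t u)).

End Genericity.

(* Main.v *)
(** Write L, K, H for the defining functions of the LPL, the PC and the MCNC, and
    {f, g} for the Jacobian of f and g.  The identity L = H^2 + 4 delta K shows that
    along the LPL the function K vanishes to twice the order of H.  Hence, at a regular
    point p of the LPL with delta > 0, m(LPL, PC : p) > 2 means that H and {L, H}
    vanish at p, and the further condition W = {{L, H}, H} <> 0 at p is equivalent to
    m(LPL, MCNC : p) = 2 together with the regularity of the MCNC; it implies
    m(LPL, PC : p) = 4.

    A reparametrization multiplies delta, H, L by powers of its Jacobian, so the
    vanishing of L, H, {L, H}, W at p is a closed condition on germs of surfaces.  Its
    complement is dense: moving the surface along a fixed transversal vector by a
    suitable cubic makes dH nonzero, and then by a quartic makes W nonzero, while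
    L, H and {L, H} still vanish at p.

    If W <> 0, the restriction of L to the curve H = 0 has a nondegenerate extremum at
    p, whose sign decides the configuration.  In a family such that the extremal value
    changes with t at first order, L has two zeros on H = 0 for one sign of t and none
    for the other; at these zeros the two curves are transversal, and by the identity
    K = 0 has an ordinary tangency with L = 0 there. *)

From HB Require Import structures.
From mathcomp Require Import all_boot all_order all_algebra.
From mathcomp Require Import all_classical all_reals all_analysis.
From mathcomp Require Import ring lra.
Require Import Defs.

Set Implicit Arguments.
Unset Strict Implicit.
Unset Printing Implicit Defensive.

Import Order.TTheory GRing.Theory Num.Theory.
Import numFieldNormedType.Exports.
Local Open Scope classical_set_scope.
Local Open Scope ring_scope.

(** * Mean value theorem and chain rule *)

(** Every term of [W] contains a first derivative of H, so at a point with dH = 0 no quartic can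
    make [W] nonzero; this is why a cubic comes first. The identity ties the invariants together: a
    cubic that changes dH also moves dL, and the two must stay proportional for {L, H} to remain 0.
    This dictates the cubic. At a tangency the second fundamental form has rank one, since K = 0,
    and because H = 0 the associated direction is isotropic for the metric; in a frame adapted to it
    the proportionality can be solved. A quartic leaves dL and dH alone. Perturbations are sums of
    powers of linear forms: such a power has a rank-one Hessian, so its effect on H and K is the
    value of two binary quadratic forms, and polarization gives the other monomials. The contact
    orders look at H along L = 0, the configuration looks at L along H = 0; at a tangency dL and dH
    are proportional, so the same number governs both. A deformation is treated as one map on space
    and time, with time as a third coordinate; hence the calculus of jets, projections and
    perturbations is done in any dimension. *)

Lemma cvg_sumr {R : realType} (T I : Type) (F : set_system T) (FF : Filter F)
    (r : seq I) (f : I -> T -> R) (l : I -> R) :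
  (forall i, f i t @[t --> F] --> l i) ->
  (\sum_(i <- r) f i t) @[t --> F] --> \sum_(i <- r) l i.
Proof.
move=> fl; elim: r => [|i r IH].
  rewrite big_nil; under eq_fun do rewrite big_nil; exact: cvg_cst.
by rewrite big_cons; under eq_fun do rewrite big_cons; exact: cvgD.
Qed.

Section RowNorm.
Context {R : realType} {n : nat}.
Implicit Types v : 'rV[R]_n.

Lemma row_norm_le v (e : R) :
  0 <= e -> (forall j, `|v 0 j| <= e) -> `|v| <= e.
Proof.
move=> e0 ve; rewrite /Num.Def.normr/= mx_normrE (bigmax_le _ e0)//= => i _.
by rewrite (ord1 i.1).
Qed.

Lemma le_row_norm v j : `|v 0 j| <= `|v|.
Proof.
rewrite [leRHS]/Num.Def.normr/= mx_normrE.
exact: (le_bigmax _ (fun i => `|v i.1 i.2|) (0, j)).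
Qed.

Lemma norm_scale_delta (s : R) (k : 'I_n) : `|s *: (delta_mx 0 k : 'rV_n)| <= `|s|.
Proof.
apply: row_norm_le => // j; rewrite !mxE eqxx /=.
by case: (j == k); rewrite ?mulr1// mulr0 normr0.
Qed.

Lemma cvg_row (T : Type) (F : set_system T) (FF : Filter F) (f : T -> 'rV[R]_n)
    (l : 'rV[R]_n) :
  (forall j, f t 0 j @[t --> F] --> l 0 j) -> f t @[t --> F] --> l.
Proof.
move=> fl; apply/cvgrPdist_lt => e e0.
have e20 : 0 < e / 2 by rewrite divr_gt0.
have : \forall t \near F, forall j, `|l 0 j - f t 0 j| < e / 2.
  by apply: filter_forall => j; have /cvgrPdist_lt/(_ _ e20) := fl j.
apply: filterS => t tj; apply: (@le_lt_trans _ _ (e / 2)); last by lra.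
by apply: row_norm_le; [exact: ltW|move=> j; rewrite !mxE ltW].
Qed.

End RowNorm.

Section Lines.
Context {R : realType} {V : normedModType R}.
Implicit Types (f : V -> R) (a v : V).

Lemma is_derive_line f a v (t : R) : derivable f (a + t *: v) v ->
  is_derive t 1 (fun s : R => f (a + s *: v)) ('D_v f (a + t *: v)).
Proof.
move=> df; have E : (fun h : R => h^-1 *: (((fun s : R => f (a + s *: v)) \o shift t) (h *: 1) -
    f (a + t *: v))) =
   (fun h => h^-1 *: ((f \o shift (a + t *: v)) (h *: v) - f (a + t *: v))).
  apply/funext => h /=; congr (_ *: (f _ - _)).
  by rewrite [_ *: 1]mulr1 scalerDl addrCA.
split; first by rewrite /derivable E.
by rewrite /derive E.
Qed.

(** Measuring the intermediate point as a fraction [th] of [s] gives one formula for both signs of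
    [s], and for [s = 0], where any [th] in ]0, 1[ serves. *)
Lemma line_mvt f a v (s : R) :
  (forall t, `|t| <= `|s| -> derivable f (a + t *: v) v) ->
  exists2 th, 0 < th < 1 &
    f (a + s *: v) - f a = s * 'D_v f (a + (th * s) *: v).
Proof.
move=> df; have [->|s_neq0] := eqVneq s 0.
  exists (1 / 2); first by apply/andP; split; lra.
  by rewrite scale0r addr0 subrr mul0r.
pose g (t : R) := f (a + t *: v).
have dg (t : R) : `|t| <= `|s| -> is_derive t 1 g ('D_v f (a + t *: v)).
  by move=> ts; apply: is_derive_line; exact: df.
have cg (i : interval R) : (forall t, t \in i -> `|t| <= `|s|) ->
    {within [set` i], continuous (g : R -> R)}.
  move=> H; apply: derivable_within_continuous => t /H /dg dt.
  exact: ex_derive.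
have fE : f (a + s *: v) - f a = g s - g 0 by rewrite /g scale0r addr0.
have [s0|] := ltP 0 s.
  have I t : t \in `[0, s] -> `|t| <= `|s|.
    by rewrite in_itv/= => /andP[t0 ts]; rewrite !ger0_norm// ltW.
  have Io t : t \in `]0, s[ -> `|t| <= `|s|.
    by move=> /subset_itv_oo_cc; exact: I.
  have [t + E] := MVT s0 (fun t tI => dg t (Io t tI)) (cg _ I).
  rewrite in_itv /= => /andP[t0 ts]; exists (t / s).
    by rewrite divr_gt0//= ltr_pdivrMr// mul1r.
  by rewrite divfK// fE E subr0 mulrC.
rewrite le_eqVlt (negPf s_neq0) /= => s0.
have I t : t \in `[s, 0] -> `|t| <= `|s|.
  by rewrite in_itv/= => /andP[t0 ts]; rewrite !ler0_norm ?(ltW s0)// lerN2.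
have Io t : t \in `]s, 0[ -> `|t| <= `|s|.
  by move=> /subset_itv_oo_cc; exact: I.
have [t + E] := MVT s0 (fun t tI => dg t (Io t tI)) (cg _ I).
rewrite in_itv /= => /andP[ts t0]; exists (t / s).
  by rewrite ltr_ndivrMr// mul1r ts ltr_ndivlMr// mul0r t0.
by rewrite divfK// fE -opprB E sub0r mulrN opprK mulrC.
Qed.

Lemma norm_frac_le (th : R) : 0 < th < 1 -> forall s : R, `|th * s| <= `|s|.
Proof.
move=> /andP[t0 t1] s; rewrite normrM gtr0_norm// -[leRHS]mul1r ler_wpM2r//.
exact: ltW.
Qed.

End Lines.

Section MeanValue.
Context {R : realType} {n : nat}.
Implicit Types (f : 'rV[R]_n -> R) (x y : 'rV[R]_n).

(* Telescopes along the coordinates, one mean value theorem for each. *)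
Lemma row_mvt f x y :
  (forall z, `|z - x| <= `|y - x| -> forall i, derivable f z (delta_mx 0 i)) ->
  exists2 xi : 'I_n -> 'rV[R]_n, (forall k, `|xi k - x| <= `|y - x|) &
    f y - f x = \sum_k (y 0 k - x 0 k) * pd k f (xi k).
Proof.
move=> df.
(* [z k] takes its first [k] coordinates from [y] and the others from [x]. In the max norm the
   segments joining consecutive points stay in the ball of radius [|y - x|] around [x]. *)
pose z (k : nat) : 'rV[R]_n := \row_j (if (j < k)%N then y 0 j else x 0 j).
have zS (k : 'I_n) : z k.+1 = z k + (y 0 k - x 0 k) *: delta_mx 0 k.
  apply/rowP => j; rewrite !mxE eqxx /= ltnS leq_eqVlt.
  have [->|/negPf jk] := eqVneq j k; first by rewrite eqxx ltnn /= mulr1 addrC subrK.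
  by rewrite -[(_ == _ :> nat)]/(j == k) jk /= mulr0 addr0.
have zn : z n = y by apply/rowP => j; rewrite !mxE ltn_ord.
have z0 : z 0%N = x by apply/rowP => j; rewrite !mxE.
have zt (k : 'I_n) (t : R) : `|t| <= `|y 0 k - x 0 k| ->
    `|z k + t *: delta_mx 0 k - x| <= `|y - x|.
  move=> ht; apply: row_norm_le => // j; rewrite !mxE eqxx /=.
  have [->|jk] := eqVneq j k.
    rewrite ltnn mulr1 addrAC subrr add0r (le_trans ht)//.
    by have := le_row_norm (y - x) k; rewrite !mxE.
  rewrite mulr0 addr0; case: ifP => _; last by rewrite subrr normr0.
  by have := le_row_norm (y - x) j; rewrite !mxE.
have step (k : 'I_n) : exists w, `|w - x| <= `|y - x| /\
    f (z k.+1) - f (z k) = (y 0 k - x 0 k) * pd k f w.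
  have [|t /norm_frac_le ht E] := @line_mvt _ _ f (z k) (delta_mx 0 k) (y 0 k - x 0 k).
    by move=> t ht; apply: df; exact: zt.
  exists (z k + (t * (y 0 k - x 0 k)) *: delta_mx 0 k).
  by split; [exact: zt|rewrite zS E].
have [xi xiP] := choice step; exists xi; first by move=> k; case: (xiP k).
rewrite -zn -[in f x]z0 -(telescope_sumr (fun k => f (z k)) (leq0n n)) big_mkord.
by apply: eq_bigr => k _; rewrite (xiP k).2 zn.
Qed.

Definition C1_at (q : 'rV[R]_n) f :=
  (\forall z \near q, forall i, derivable f z (delta_mx 0 i)) /\
  forall i, {for q, continuous (pd i f)}.

(** By [row_mvt] the increment of [f] is a sum of coordinate increments of [phi] times partial
    derivatives of [f] at points [xi] that tend to [phi x]; continuity of the partial derivatives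
    gives the limit. *)
Lemma C1_chain (X : normedModType R) (phi : X -> 'rV[R]_n) f (x v : X) :
  C1_at (phi x) f -> (forall k, derivable (fun u => phi u 0 k) x v) ->
  is_derive x v (fun u => f (phi u))
    (\sum_k 'D_v (fun u => phi u 0 k) x * pd k f (phi x)).
Proof.
move=> [df cf] dphi.
have dphi' : derivable phi x v.
  by apply/derivable_mxP => i j; rewrite (ord1 i).
have cphi : (phi (h *: v + x)) @[h --> (0:R)^'] --> phi x.
  have : {for 0, continuous (fun h : R => phi (h *: v + x))}.
    apply: differentiable_continuous; apply/derivable1_diffP.
    exact: (derivable1P phi x v).1 dphi'.
  move=> c0; have : (phi (h *: v + x)) @[h --> (0:R)] --> phi (0 *: v + x) := c0.
  rewrite scale0r add0r; apply: cvg_trans; exact/cvg_app/cvg_within.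
have [e e0 He] := (@nbhs_ballP _ _ _ _).1 df.
have near_e : \forall h \near (0:R)^', `|phi (h *: v + x) - phi x| < e.
  move/cvgr_dist_lt : cphi => /(_ _ e0); apply: filterS => h.
  by rewrite distrC.
(* The intermediate points exist only when [phi (h *: v + x)] is within [e] of [phi x]; the
   implication and the default value 0 let them be chosen for all [h] at once. *)
have ex h : exists xi : 'I_n -> 'rV[R]_n, `|phi (h *: v + x) - phi x| < e ->
  (forall k, `|xi k - phi x| <= `|phi (h *: v + x) - phi x|) /\
   f (phi (h *: v + x)) - f (phi x) =
   \sum_k (phi (h *: v + x) 0 k - phi x 0 k) * pd k f (xi k).
  have [he|he] := ltP `|phi (h *: v + x) - phi x| e; last by exists (fun=> 0).
  have [|xi h1 h2] := @row_mvt f (phi x) (phi (h *: v + x)).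
    move=> z hz i; apply: He; rewrite -ball_normE /= distrC.
    exact: le_lt_trans hz he.
  by exists xi.
have [xi xiP] := choice ex.
have cxi k : xi h k @[h --> (0:R)^'] --> phi x.
  apply/cvgrPdist_lt => eps eps0.
  have /cvgrPdist_lt/(_ _ eps0) := cphi.
  apply: filterS2 near_e => h he; rewrite distrC => heps; rewrite distrC.
  by apply: le_lt_trans heps; have [] := xiP h he.
suff L : (h^-1 *: (((fun u => f (phi u)) \o shift x) (h *: v) - f (phi x)))
   @[h --> (0:R)^'] --> \sum_k 'D_v (fun u => phi u 0 k) x * pd k f (phi x).
  split; last exact: cvg_lim.
  by apply/cvg_ex; eexists; exact: L.
have : (\sum_k (h^-1 *: (phi (h *: v + x) 0 k - phi x 0 k)) * pd k f (xi h k))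
   @[h --> (0:R)^'] --> \sum_k 'D_v (fun u => phi u 0 k) x * pd k f (phi x).
  apply: cvg_sumr => k; apply: cvgM; first exact: (dphi k).
  apply: cvg_comp (cxi k) _; exact: cf.
apply: cvg_trans; apply: near_eq_cvg.
apply: filterS near_e => h he /=; rewrite (xiP h he).2 scaler_sumr.
by apply: eq_bigr => k _; rewrite scalerAl.
Qed.

End MeanValue.

(** * Functions of class C^k *)

Section Ck.
Context {R : realType}.

Section Fixed_dimension.
Context {n : nat}.
Implicit Types (f g : 'rV[R]_n -> R) (U V : set 'rV[R]_n).

(** The recursion on the order is what makes products, inverses and compositions tractable: a
    partial derivative of the result is built from functions already known to be of class C^k, as in
    (1/f)' = - (1/f)^2 f'. *)
Fixpoint Ck k U f : Prop :=
  (forall q, U q -> {for q, continuous f}) /\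
  if k is k'.+1 then
    (forall q, U q -> forall i, derivable f q 'e_i) /\
    (forall i, Ck k' U (pd i f))
  else True.

Definition smooth_on U f := forall k, Ck k U f.

Lemma Ck_continuous k U f q : Ck k U f -> U q -> {for q, continuous f}.
Proof. by case: k => [|k] /= [cf _]; exact: cf. Qed.

Lemma CkW k U f : Ck k.+1 U f -> Ck k U f.
Proof.
elim: k f => [|k IH] f; first by move=> [cf _]; split.
by move=> [cf [df pf]]; split=> //; split=> // i; apply: IH; exact: pf.
Qed.

Lemma Ck_sub k U V f : V `<=` U -> Ck k U f -> Ck k V f.
Proof.
move=> VU; elim: k f => [|k IH] f /= [cf H]; split => //.
- by move=> q /VU; exact: cf.
- by move=> q /VU; exact: cf.
- case: H => df pf; split; first by move=> q /VU; exact: df.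
  by move=> i; exact: IH.
Qed.

Lemma near_eq_pd f g q i : {near q, f =1 g} -> pd i f q = pd i g q.
Proof. by move=> fg; apply: near_eq_derive. Qed.

Lemma Ck_ext k U f g : open U -> (forall q, U q -> f q = g q) ->
  Ck k U f -> Ck k U g.
Proof.
move=> oU; elim: k f g => [|k IH] f g fg.
  move=> [cf _]; split=> // q Uq.
  have nfg : {near q, f =1 g}.
    by apply: filterS fg _; exact: open_nbhs_nbhs.
  suff : g h @[h --> q] --> g q by [].
  by rewrite -fg//; apply: cvg_trans (cf q Uq); exact: (near_eq_cvg nfg).
move=> [cf [df pf]].
have nfg q : U q -> {near q, f =1 g}.
  by move=> Uq; apply: filterS fg _; exact: open_nbhs_nbhs.
split; last split.
- move=> q Uq; suff : g h @[h --> q] --> g q by [].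
  rewrite -fg//; apply: cvg_trans (cf q Uq).
  exact: (near_eq_cvg (nfg q Uq)).
- by move=> q Uq i; apply: near_eq_derivable (df q Uq i); exact: nfg.
- by move=> i; apply: IH (pf i) => q Uq; apply: near_eq_pd; exact: nfg.
Qed.

Lemma pd_cst i (a : R) : pd i (fun=> a : R) = (fun=> 0) :> ('rV[R]_n -> R).
Proof. by apply/funext => q; exact: derive_cst. Qed.

Lemma Ck_cst k U (a : R) : Ck k U (fun=> a).
Proof.
elim: k a => [|k IH] a; split.
- by move=> q _; exact: cst_continuous.
- by [].
- by move=> q _; exact: cst_continuous.
- split; first by move=> q _ i; exact: derivable_cst.
  by move=> i; rewrite pd_cst; exact: IH.
Qed.

Lemma is_derive_coord (j : 'I_n) (q v : 'rV[R]_n) :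
  is_derive q v (fun u : 'rV[R]_n => u 0 j) (v 0 j).
Proof.
have E : (fun h : R => h^-1 *: (((fun u : 'rV[R]_n => u 0 j) \o shift q) (h *: v) - q 0 j))
   @ 0^' --> v 0 j.
  apply: (@cvg_trans _ (cst (v 0 j) @ (0:R)^')); last exact: cvg_cst.
  apply: near_eq_cvg; near=> h.
  rewrite /= !mxE addrK [_ *: _]mulrA mulVf ?mul1r//.
  by near: h; exact: nbhs_dnbhs_neq.
split; last exact: cvg_lim.
by apply/cvg_ex; exists (v 0 j).
Unshelve. all: by end_near. Qed.

Lemma pd_coord i j : pd i (fun u : 'rV[R]_n => u 0 j) = (fun=> (i == j)%:R).
Proof.
apply/funext => q; rewrite /pd (derive_val (is_derive := is_derive_coord j q 'e_i)).
by rewrite mxE eqxx eq_sym.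
Qed.

Lemma Ck_coord k U j : Ck k U (fun u : 'rV[R]_n => u 0 j).
Proof.
case: k => [|k]; split.
- by move=> q _; exact: coord_continuous.
- by [].
- by move=> q _; exact: coord_continuous.
- split; first by move=> q _ i; exact: (ex_derive (is_derive := is_derive_coord j q 'e_i)).
  by move=> i; rewrite pd_coord; exact: Ck_cst.
Qed.

Lemma CkD k U f g : open U -> Ck k U f -> Ck k U g ->
  Ck k U (fun q => f q + g q).
Proof.
move=> oU; elim: k f g => [|k IH] f g /=.
  by move=> [cf _] [cg _]; split=> // q Uq; apply: continuousD; [exact: cf|exact: cg].
move=> [cf [df pf]] [cg [dg pg]]; split; last split.
- by move=> q Uq; apply: continuousD; [exact: cf|exact: cg].
- by move=> q Uq i; apply: derivableD; [exact: df|exact: dg].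
- move=> i; apply: Ck_ext (IH _ _ (pf i) (pg i)) => // q Uq.
  by rewrite /pd deriveD; [|exact: df|exact: dg].
Qed.

Lemma CkM k U f g : open U -> Ck k U f -> Ck k U g ->
  Ck k U (fun q => f q * g q).
Proof.
move=> oU; elim: k f g => [|k IH] f g.
  by move=> [cf _] [cg _]; split=> // q Uq; apply: continuousM; [exact: cf|exact: cg].
move=> kf kg; have [cf [df pf]] := kf; have [cg [dg pg]] := kg.
split; last split.
- by move=> q Uq; apply: continuousM; [exact: cf|exact: cg].
- by move=> q Uq i; apply: derivableM; [exact: df|exact: dg].
- move=> i; have H := CkD oU (IH _ _ (CkW kf) (pg i)) (IH _ _ (CkW kg) (pf i)).
  apply: Ck_ext H => // q Uq.
  by rewrite /pd deriveM; [|exact: df|exact: dg].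
Qed.

Lemma CkZ k U a f : open U -> Ck k U f -> Ck k U (fun q => a * f q).
Proof. by move=> oU; apply: CkM => //; exact: Ck_cst. Qed.

Lemma CkN k U f : open U -> Ck k U f -> Ck k U (fun q => - f q).
Proof.
move=> oU /(CkZ (-1) oU); apply: Ck_ext => // q _; by rewrite mulN1r.
Qed.

Lemma Ck_sum (I : Type) (r : seq I) (P : pred I) (F : I -> 'rV[R]_n -> R) k U :
  open U -> (forall i, P i -> Ck k U (F i)) ->
  Ck k U (fun q => \sum_(i <- r | P i) F i q).
Proof.
move=> oU H; elim: r => [|i r IH].
  by apply: Ck_ext (Ck_cst k U 0) => // q _; rewrite big_nil.
case Pi : (P i).
  by apply: Ck_ext (CkD oU (H _ Pi) IH) => // q _; rewrite big_cons Pi.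
by apply: Ck_ext IH => // q _; rewrite big_cons Pi.
Qed.

Lemma CkV k U f : open U -> (forall q, U q -> f q != 0) -> Ck k U f ->
  Ck k U (fun q => (f q)^-1).
Proof.
move=> oU f0; elim: k => [|k IH].
  by move=> [cf _]; split=> // q Uq; apply: continuousV; [exact: f0|exact: cf].
move=> kf; have [cf [df pf]] := kf; have kV := IH (CkW kf).
split; last split.
- by move=> q Uq; apply: continuousV; [exact: f0|exact: cf].
- by move=> q Uq i; apply: derivableV; [exact: f0|exact: df].
- move=> i; have H := CkN oU (CkM oU (CkM oU kV kV) (pf i)).
  apply: Ck_ext H => // q Uq; rewrite /pd deriveV; [|exact: f0|exact: df].
  by rewrite scaleNr; congr (- (_ * _)); rewrite -exprVn expr2.
Qed.

Lemma Ck_C1_at k U f q : open U -> Ck k.+1 U f -> U q -> C1_at q f.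
Proof.
move=> oU [_ [df pf]] Uq; split.
  by apply: filterS df _; exact: open_nbhs_nbhs.
by move=> i; exact: Ck_continuous (pf i) Uq.
Qed.

End Fixed_dimension.

Lemma Ck_comp m n k (U : set 'rV[R]_m) (V : set 'rV[R]_n)
    (phi : 'rV[R]_m -> 'rV[R]_n) f :
  open U -> open V -> (forall q, U q -> V (phi q)) ->
  (forall j, Ck k U (fun q => phi q 0 j)) -> Ck k V f ->
  Ck k U (fun q => f (phi q)).
Proof.
move=> oU oV UV; elim: k f => [|k IH] f kphi kf.
  split=> // q Uq; apply: continuous_comp; last exact: Ck_continuous kf (UV _ Uq).
  by apply: (@cvg_row R n _ (nbhs q) (nbhs_filter q)) => j; exact: Ck_continuous (kphi j) Uq.
have ch q (i : 'I_m) : U q -> is_derive q 'e_i (fun u => f (phi u))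
    (\sum_j pd i (fun u => phi u 0 j) q * pd j f (phi q)).
  move=> Uq; apply: C1_chain; first exact: Ck_C1_at kf (UV _ Uq).
  by move=> j; have [_ [d _]] := kphi j; exact: d.
have kp' j : Ck k U (fun q => phi q 0 j) by exact: CkW.
split; last split.
- by move=> q Uq; apply: Ck_continuous (IH _ kp' (CkW kf)) Uq.
- by move=> q Uq i; exact: (ex_derive (is_derive := ch q i Uq)).
- move=> i; have H : Ck k U (fun q => \sum_j pd i (fun u => phi u 0 j) q * pd j f (phi q)).
    apply: Ck_sum => // j _; apply: CkM => //; first by have [_ [_ d]] := kphi j; exact: d.
    by apply: IH => //; have [_ [_ d]] := kf; exact: d.
  apply: Ck_ext H => // q Uq; rewrite /pd (derive_val (is_derive := ch q i Uq)).
  by [].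
Qed.

End Ck.

(** * Symmetry of second derivatives *)

Section Schwarz.
Context {R : realType} {n : nat}.
Implicit Types (f : 'rV[R]_n -> R).

(** The second difference on the left is symmetric in [i] and [j], the derivative on the right is
    not a priori: reading it in both orders compares the two mixed derivatives. *)
Lemma second_difference f (U : set 'rV[R]_n) q (i j : 'I_n) (s : R) :
  Ck 2 U f -> (forall z, `|z - q| <= `|s| + `|s| -> U z) ->
  exists2 xi, `|xi - q| <= `|s| + `|s| &
    f (q + s *: 'e_i + s *: 'e_j) - f (q + s *: 'e_i) - f (q + s *: 'e_j) + f q =
    s * (s * pd j (pd i f) xi).
Proof.
move=> [_ [df pf]] HU.
(* The mean value theorem is applied to [g] along [i], then to [pd i f] along [j]. *)
pose g z := f (z + s *: 'e_j) - f z.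
have sU t t' : `|t| <= `|s| -> `|t'| <= `|s| -> U (q + t *: 'e_i + t' *: 'e_j).
  move=> ht ht'; apply: HU.
  rewrite addrAC [q + _]addrC addrK (le_trans (ler_normD _ _))// lerD//.
    by rewrite (le_trans (norm_scale_delta _ _)).
  by rewrite (le_trans (norm_scale_delta _ _)).
have sU0 t : `|t| <= `|s| -> U (q + t *: 'e_i).
  by move=> ht; have := sU t 0 ht; rewrite scale0r addr0 normr0; apply.
have dg t : `|t| <= `|s| -> is_derive (q + t *: 'e_i) 'e_i g
    (pd i f (q + t *: 'e_i + s *: 'e_j) - pd i f (q + t *: 'e_i)).
  move=> ht; apply: is_deriveB; last by apply/derivableP/df/sU0.
  have d := df _ (sU _ _ ht (lexx _)) i.
  have E : (fun h : R => h^-1 *: (((fun z => f (z + s *: 'e_j)) \o shift (q + t *: 'e_i)) (h *: 'e_i) -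
       f (q + t *: 'e_i + s *: 'e_j))) =
      (fun h => h^-1 *: ((f \o shift (q + t *: 'e_i + s *: 'e_j)) (h *: 'e_i) -
       f (q + t *: 'e_i + s *: 'e_j))).
    by apply/funext => h /=; rewrite -!addrA.
  split; first by rewrite /derivable E.
  by rewrite /pd /derive E.
have [|th /norm_frac_le/(_ s) ht E] := @line_mvt _ _ g q 'e_i s.
  by move=> t ht; exact: (ex_derive (is_derive := dg t ht)).
set t := th * s in ht E.
have [|th' /norm_frac_le/(_ s) ht' E'] := @line_mvt _ _ (pd i f) (q + t *: 'e_i) 'e_j s.
  move=> t' ht'; have [_ [d _]] := pf i; exact: d (sU _ _ ht ht') j.
set t' := th' * s in ht' E'; exists (q + t *: 'e_i + t' *: 'e_j).
  rewrite addrAC [q + _]addrC addrK (le_trans (ler_normD _ _))// lerD//.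
    by rewrite (le_trans (norm_scale_delta _ _)).
  by rewrite (le_trans (norm_scale_delta _ _)).
rewrite -[X in s * X]E'; move: E; rewrite (derive_val (is_derive := dg t ht)) => <-.
by rewrite /g; ring.
Qed.

Lemma dist_lt_split (a b c e : R) :
  `|a - c| < e / 2 -> `|b - c| < e / 2 -> `|a - b| < e.
Proof. by rewrite !ltr_norml; lra. Qed.

Lemma Ck_pdC f (U : set 'rV[R]_n) q (i j : 'I_n) : open U -> Ck 2 U f -> U q ->
  pd j (pd i f) q = pd i (pd j f) q.
Proof.
move=> oU kf Uq; apply/eqP; rewrite -subr_eq0; apply/negP => /negP d0.
set d := _ - _ in d0; have e0 : 0 < `|d| / 2 by rewrite divr_gt0// normr_gt0.
have c a b : {for q, continuous (pd a (pd b f))}.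
  by have [_ [_ /(_ b) [_ [_ /(_ a) [H _]]]]] := kf; exact: H.
have cji : \forall z \near q, `|pd j (pd i f) q - pd j (pd i f) z| < `|d| / 2.
  by have /cvgrPdist_lt := c j i; apply.
have cij : \forall z \near q, `|pd i (pd j f) q - pd i (pd j f) z| < `|d| / 2.
  by have /cvgrPdist_lt := c i j; apply.
have /nbhs_ballP[r r0 Hr] : \forall z \near q, [/\ U z,
   `|pd j (pd i f) q - pd j (pd i f) z| < `|d| / 2 &
   `|pd i (pd j f) q - pd i (pd j f) z| < `|d| / 2].
  have nU : \forall z \near q, U z by exact: open_nbhs_nbhs.
  by apply: filterS3 nU cji cij.
(* The intermediate points are within [2 s] of [q], hence in the ball of radius [r], where each
   mixed derivative is within [|d| / 2] of its value at [q]. *)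
pose s := r / 3; have s0 : 0 < s by rewrite divr_gt0.
have B z : `|z - q| <= `|s| + `|s| -> ball q r z.
  rewrite -ball_normE /= distrC => /le_lt_trans; apply.
  by have r0' : 0 < r := r0; rewrite gtr0_norm// /s; lra.
have BU z : `|z - q| <= `|s| + `|s| -> U z by move=> /B/Hr[].
have [x1 /B/Hr[_ h1 _] E1] := second_difference i j kf BU.
have [x2 /B/Hr[_ _ h2] E2] := second_difference j i kf BU.
have E : pd j (pd i f) x1 = pd i (pd j f) x2.
  apply: (mulfI (lt0r_neq0 s0)); apply: (mulfI (lt0r_neq0 s0)).
  apply: etrans (esym E1) _; apply: etrans _ E2.
  by rewrite (addrAC q (s *: 'e_j) (s *: 'e_i)) (addrAC (f _) (- f (q + s *: 'e_j))).
by rewrite E in h1; have := dist_lt_split h1 h2; rewrite ltxx.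
Qed.

End Schwarz.

(** * Smooth germs *)

(* Sealed, so that unification never unfolds the limit behind [pd]. *)
HB.lock Definition der {R : realType} {n : nat} (i : 'I_n) (f : 'rV[R]_n -> R) :
  'rV[R]_n -> R := pd i f.

Definition ders {R : realType} {n : nat} (s : seq 'I_n) (f : 'rV[R]_n -> R) :=
  foldr der f s.

(* An inductive wrapper of [smooth_at], for the same reason. *)
Inductive smooth {R : realType} {n : nat} (p : 'rV[R]_n) (f : 'rV[R]_n -> R) :
  Prop := Smooth of smooth_at p f.

Section Smooth.
Context {R : realType} {n : nat}.
Implicit Types (f g : 'rV[R]_n -> R) (U : set 'rV[R]_n) (p q : 'rV[R]_n).

Lemma derE i f : der i f = pd i f. Proof. by rewrite der.unlock. Qed.

Lemma dersE s f : ders s f = pds s f.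
Proof. by elim: s => //= i s ->; rewrite derE. Qed.

Lemma smoothE p f : smooth_at p f <-> smooth p f.
Proof. by split=> [|[]]. Qed.

Lemma smooth_on_pd U f i : smooth_on U f -> smooth_on U (pd i f).
Proof. by move=> sf k; have [_ [_ h]] := sf k.+1; exact: h. Qed.

Lemma smooth_on_pds U f s : smooth_on U f -> smooth_on U (pds s f).
Proof. by move=> sf; elim: s => //= i s IH; exact: smooth_on_pd. Qed.

Lemma smooth_onP U f : smooth_on U f <->
  forall q, U q -> forall s, {for q, continuous (pds s f)} /\
    (forall i, derivable (pds s f) q 'e_i).
Proof.
split=> [sf q Uq s|sf k].
  by have [c [d _]] := smooth_on_pds s sf 1%N; split; [exact: c|exact: d].
suff H s : Ck k U (pds s f) by exact: (H [::]).
elim: k s => [|k IH] s /=; split=> //; try by move=> q Uq; exact: (sf q Uq s).1.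
split; first by move=> q Uq; exact: (sf q Uq s).2.
by move=> i; exact: (IH (i :: s)).
Qed.

Lemma smoothP p f :
  smooth p f <-> exists U, [/\ open U, U p & smooth_on U f].
Proof.
split=> [[sf]|[U [oU Up /smooth_onP sf]]].
  pose U := interior [set q | forall s, {for q, continuous (pds s f)} /\
    (forall i, derivable (pds s f) q 'e_i)].
  exists U; split; [exact: open_interior|exact: sf|].
  by apply/smooth_onP => q Uq; exact: (interior_subset Uq).
by split; apply: filterS sf _; exact: open_nbhs_nbhs.
Qed.

Lemma smooth_near p f : smooth p f -> \forall q \near p, smooth q f.
Proof.
by move=> [sf]; apply: filterS (near_join sf) => q; split.
Qed.

Lemma smooth_on_ext U f g : open U -> (forall q, U q -> f q = g q) ->
  smooth_on U f -> smooth_on U g.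
Proof. by move=> oU fg sf k; exact: Ck_ext fg (sf k). Qed.

Lemma smooth_common p f g : smooth p f -> smooth p g ->
  exists U, [/\ open U, U p, smooth_on U f & smooth_on U g].
Proof.
move=> /smoothP[U [oU Up sf]] /smoothP[V [oV Vp sg]].
exists (U `&` V); split; [exact: openI|by []| |].
  by move=> k; apply: Ck_sub (sf k); exact: subIsetl.
by move=> k; apply: Ck_sub (sg k); exact: subIsetr.
Qed.

Lemma smooth_ext p f g : {near p, f =1 g} -> smooth p f -> smooth p g.
Proof.
move=> fg /smoothP[U [oU Up sf]]; apply/smoothP.
have oV : open (U `&` interior [set q | f q = g q]).
  by apply: openI oU _; exact: open_interior.
exists (U `&` interior [set q | f q = g q]); split=> //.
apply: (@smooth_on_ext _ f) => //; first by move=> q [_ /interior_subset].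
by move=> k; apply: Ck_sub (sf k) => q [].
Qed.

Lemma smooth_eq p f g : f =1 g -> smooth p f -> smooth p g.
Proof. by move=> /funext ->. Qed.

Lemma smooth_cst p (a : R) : smooth p (fun=> a).
Proof.
by apply/smoothP; exists setT; split; [exact: openT| |move=> k; exact: Ck_cst].
Qed.

Lemma smooth_coord p j : smooth p (fun u : 'rV[R]_n => u 0 j).
Proof.
by apply/smoothP; exists setT; split; [exact: openT| |move=> k; exact: Ck_coord].
Qed.

Lemma smoothD p f g : smooth p f -> smooth p g -> smooth p (fun q => f q + g q).
Proof.
move=> sf /(smooth_common sf)[U [oU Up {}sf sg]]; apply/smoothP.
by exists U; split=> // k; exact: CkD.
Qed.

Lemma smoothM p f g : smooth p f -> smooth p g -> smooth p (fun q => f q * g q).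
Proof.
move=> sf /(smooth_common sf)[U [oU Up {}sf sg]]; apply/smoothP.
by exists U; split=> // k; exact: CkM.
Qed.

Lemma smoothZ p (a : R) f : smooth p f -> smooth p (fun q => a * f q).
Proof. by apply: smoothM; exact: smooth_cst. Qed.

Lemma smoothN p f : smooth p f -> smooth p (fun q => - f q).
Proof.
move=> /smoothP[U [oU Up sf]]; apply/smoothP.
by exists U; split=> // k; exact: CkN.
Qed.

Lemma smoothB p f g : smooth p f -> smooth p g -> smooth p (fun q => f q - g q).
Proof. by move=> sf sg; apply: smoothD => //; exact: smoothN. Qed.

Lemma smoothX p f k : smooth p f -> smooth p (fun q => f q ^+ k).
Proof.
move=> sf; elim: k => [|k IH]; first exact: smooth_cst.
by apply: smooth_eq (smoothM sf IH) => q; rewrite exprS.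
Qed.

Lemma smooth_sum (I : Type) (r : seq I) (F : I -> 'rV[R]_n -> R) p :
  (forall i, smooth p (F i)) -> smooth p (fun q => \sum_(i <- r) F i q).
Proof.
move=> sF; elim: r => [|i r IH].
  by apply: smooth_eq (smooth_cst p 0) => q; rewrite big_nil.
by apply: smooth_eq (smoothD (sF i) IH) => q; rewrite big_cons.
Qed.

Lemma smooth_der p f i : smooth p f -> smooth p (der i f).
Proof.
move=> /smoothP[U [oU Up sf]]; apply/smoothP; exists U; split=> //.
by rewrite derE; exact: smooth_on_pd.
Qed.

Lemma smooth_ders p f s : smooth p f -> smooth p (ders s f).
Proof. by move=> sf; elim: s => [|i s IH]; [exact: sf|exact: smooth_der]. Qed.

Lemma smooth_continuous p f : smooth p f -> {for p, continuous f}.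
Proof. by move=> [/nbhs_singleton /(_ [::])[]]. Qed.

Lemma smooth_cvg p f : smooth p f -> f q @[q --> p] --> f p.
Proof. exact: smooth_continuous. Qed.

Lemma smooth_derivable p f i : smooth p f -> derivable f p 'e_i.
Proof. by move=> [/nbhs_singleton /(_ [::])[_]]; exact. Qed.

Lemma smooth_near_neq0 p f : smooth p f -> f p != 0 -> \forall q \near p, f q != 0.
Proof.
move=> /smooth_cvg/cvgrPdist_lt cf f0; move: f0 (cf `|f p|).
rewrite -normr_gt0 => f0 /(_ f0); apply: filterS => q.
by apply: contraTneq => ->; rewrite subr0 ltxx.
Qed.

Lemma smooth_near_gt0 p f : smooth p f -> 0 < f p -> \forall q \near p, 0 < f q.
Proof.
move=> /smooth_cvg/cvgrPdist_lt cf f0; apply: filterS (cf _ f0) => q.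
by rewrite ltr_norml => /andP[_]; rewrite ltrBlDl ltrDr.
Qed.

Lemma smoothV p f : f p != 0 -> smooth p f -> smooth p (fun q => (f q)^-1).
Proof.
move=> f0 sf; have nf := smooth_near_neq0 sf f0.
case/smoothP : sf => U [oU Up sf]; apply/smoothP.
exists (U `&` interior [set q | f q != 0]).
have oU' : open (U `&` interior [set q | f q != 0]).
  by apply: openI oU _; exact: open_interior.
split=> // k; apply: CkV => //; first by move=> q [_ /interior_subset].
by apply: Ck_sub (sf k) => q [].
Qed.

Lemma smooth_C1_at p f : smooth p f -> C1_at p f.
Proof.
move=> /smoothP[U [oU Up sf]]; exact: Ck_C1_at oU (sf 1%N) Up.
Qed.

Lemma der_cst i (a : R) : der i (fun=> a) = (fun=> 0) :> ('rV[R]_n -> R).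
Proof. by rewrite derE pd_cst. Qed.

Lemma der_coord i j : der i (fun u : 'rV[R]_n => u 0 j) = (fun=> (i == j)%:R).
Proof. by rewrite derE pd_coord. Qed.

Lemma derD p f g i : smooth p f -> smooth p g ->
  der i (fun q => f q + g q) p = der i f p + der i g p.
Proof. by move=> sf sg; rewrite !derE /pd deriveD//; exact: smooth_derivable. Qed.

Lemma derN p f i : smooth p f -> der i (fun q => - f q) p = - der i f p.
Proof. by move=> sf; rewrite !derE /pd deriveN//; exact: smooth_derivable. Qed.

Lemma derB p f g i : smooth p f -> smooth p g ->
  der i (fun q => f q - g q) p = der i f p - der i g p.
Proof. by move=> sf sg; rewrite !derE /pd deriveB//; exact: smooth_derivable. Qed.

Lemma derM p f g i : smooth p f -> smooth p g ->
  der i (fun q => f q * g q) p = der i f p * g p + f p * der i g p.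
Proof.
move=> sf sg; rewrite !derE /pd deriveM; [|exact: smooth_derivable..].
by rewrite addrC mulrC.
Qed.

Lemma derZ p (a : R) f i : smooth p f ->
  der i (fun q => a * f q) p = a * der i f p.
Proof.
move=> sf; rewrite (derM i (smooth_cst p a) sf).
by rewrite der_cst mul0r add0r.
Qed.

Lemma near_eq_der f g p i : {near p, f =1 g} -> der i f p = der i g p.
Proof. by rewrite !derE; exact: near_eq_pd. Qed.

Lemma der_sum (I : Type) (r : seq I) (F : I -> 'rV[R]_n -> R) p i :
  (forall j, smooth p (F j)) ->
  der i (fun q => \sum_(j <- r) F j q) p = \sum_(j <- r) der i (F j) p.
Proof.
move=> sF; elim: r => [|j r IH].
  rewrite big_nil (_ : (fun _ => _) = fun=> 0) ?der_cst//.
  by apply/funext => q; rewrite big_nil.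
rewrite big_cons -IH -(derD i (sF j) (smooth_sum r sF)).
by congr (der i _ p); apply/funext => q; rewrite big_cons.
Qed.

Lemma derC p f i j : smooth p f -> der j (der i f) p = der i (der j f) p.
Proof.
by rewrite !derE => /smoothP[U [oU Up sf]]; exact: Ck_pdC oU (sf 2%N) Up.
Qed.

Lemma near_eq_ders p f g s : {near p, f =1 g} -> {near p, ders s f =1 ders s g}.
Proof.
move=> fg; elim: s => [|i s IH]; first exact: fg.
by apply: filterS (near_join IH) => q; exact: near_eq_der.
Qed.

Lemma near_eq_ders_at p f g s : {near p, f =1 g} -> ders s f p = ders s g p.
Proof. by move=> /(near_eq_ders s) /nbhs_singleton. Qed.

Lemma near_smooth p f (P : 'rV[R]_n -> Prop) : smooth p f ->
  (forall q, smooth q f -> P q) -> \forall q \near p, P q.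
Proof. by move=> /smooth_near sf H; exact: filterS sf. Qed.

Lemma near_smooth2 p f g (P : 'rV[R]_n -> Prop) : smooth p f -> smooth p g ->
  (forall q, smooth q f -> smooth q g -> P q) -> \forall q \near p, P q.
Proof. by move=> /smooth_near sf /smooth_near sg H; exact: filterS2 sf sg. Qed.

Lemma ders_rcons s i f : ders (rcons s i) f = ders s (der i f).
Proof. by rewrite /ders foldr_rcons. Qed.

End Smooth.

Section Composition.
Context {R : realType} {m n : nat}.
Variables (p : 'rV[R]_m) (phi : 'rV[R]_m -> 'rV[R]_n) (f : 'rV[R]_n -> R).
Hypothesis sphi : forall j, smooth p (fun q => phi q 0 j).

Lemma cvg_smooth_row : phi q @[q --> p] --> phi p.
Proof.
apply: (@cvg_row R n _ (nbhs p) (nbhs_filter p)) => j.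
exact: (smooth_cvg (sphi j)).
Qed.

Lemma near_smooth_row : \forall q \near p, forall j, smooth q (fun q => phi q 0 j).
Proof.
apply: (@filter_forall _ _ (fun j q => smooth q (fun q => phi q 0 j)) (nbhs p)).
by move=> j; exact: (smooth_near (sphi j)).
Qed.

Lemma smooth_comp : smooth (phi p) f -> smooth p (fun q => f (phi q)).
Proof.
move=> /smoothP[V [oV Vp sf]].
have nV : \forall q \near p, V (phi q).
  by apply: cvg_smooth_row; exact: open_nbhs_nbhs.
pose U := interior [set q | V (phi q) /\ forall j, smooth q (fun q => phi q 0 j)].
have oU : open U by exact: open_interior.
apply/smoothP; exists U; split=> //; first exact: filterI nV near_smooth_row.
move=> k; apply: (Ck_comp oU oV _ _ (sf k)).
  by move=> q /interior_subset[].
move=> j; suff: smooth_on U (fun q => phi q 0 j) by exact.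
apply/smooth_onP => q /interior_subset[_ /(_ j) sq] s.
have := smooth_ders s sq; rewrite dersE => ss; split.
  exact: smooth_continuous.
by move=> i; exact: smooth_derivable.
Qed.

Lemma der_comp i : smooth (phi p) f ->
  der i (fun q => f (phi q)) p =
    \sum_j der i (fun q => phi q 0 j) p * der j f (phi p).
Proof.
move=> sf; under eq_bigr do rewrite !derE; rewrite derE.
rewrite /pd; apply: (derive_val (is_derive := _)).
apply: C1_chain; first exact: smooth_C1_at.
by move=> j; exact: smooth_derivable.
Qed.

End Composition.

Section Rows.
Context {R : realType} {n m : nat}.
Implicit Types (x : 'rV[R]_n -> 'rV[R]_m) (p : 'rV[R]_n).

Lemma derive_row x (y : 'I_m -> 'rV[R]_n -> R) p v :
  (\forall q \near p, forall j, x q 0 j = y j q) ->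
  (forall j, derivable (y j) p v) ->
  derivable x p v /\ forall j, 'D_v x p 0 j = 'D_v (y j) p.
Proof.
move=> xy dy.
have nxy j : {near p, (fun q => x q 0 j) =1 y j} by apply: filterS xy.
have dx : derivable x p v.
  apply/derivable_mxP => i j; rewrite (ord1 i); apply: near_eq_derivable (dy j).
  by apply: filterS xy => q.
split=> // j; rewrite derive_mx// mxE; exact: near_eq_derive (nxy j).
Qed.

(** Smoothness of row-valued maps is reduced to scalar calculus. The identity between iterated
    derivatives and coordinates is proved on a whole open set, since the next derivative at a point
    depends on the previous one around it. *)
Lemma smooth_rowP p x : smooth_at p x <-> forall j, smooth p (fun q => x q 0 j).
Proof.
split=> [sx j|sx].
  split; pose U := interior [set q | forall s, {for q, continuous (pds s x)} /\
    (forall i, derivable (pds s x) q 'e_i)].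
  have oU : open U by exact: open_interior.
  have H s : forall q, U q -> pds s x q 0 j = pds s (fun q => x q 0 j) q.
    elim: s => [//|i s IH] q Uq /=.
    have [_ /(_ i) dx] := interior_subset Uq s.
    rewrite /pd derive_mx// mxE; apply: near_eq_derive.
    by apply: filterS IH _; exact: open_nbhs_nbhs.
  have Up : U p by exact: sx.
  have nU : \forall q \near p, U q by exact: open_nbhs_nbhs.
  apply: filterS nU => q Uq s.
  have nH : {near q, (fun q => pds s x q 0 j) =1 pds s (fun q => x q 0 j)}.
    by apply: filterS (H s) _; exact: open_nbhs_nbhs.
  have [cx dx] := interior_subset Uq s; split.
    suff : pds s (fun q => x q 0 j) r @[r --> q] --> pds s (fun q => x q 0 j) q by [].
    rewrite -H//; apply: (cvg_trans (near_eq_cvg nH)).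
    exact: (cvg_comp _ _ cx (@coord_continuous R 1 m 0 j (pds s x q))).
  move=> i; apply: near_eq_derivable nH _.
  by have /derivable_mxP := dx i; apply.
pose U := interior [set q | forall j, smooth q (fun q => x q 0 j)].
have oU : open U by exact: open_interior.
have Up : U p by exact: near_smooth_row.
have nU : \forall q \near p, U q by exact: open_nbhs_nbhs.
have D s q i : (forall q, U q -> forall j, pds s x q 0 j = pds s (fun q => x q 0 j) q) ->
    U q -> derivable (pds s x) q 'e_i /\
    forall j, pd i (pds s x) q 0 j = pd i (pds s (fun q => x q 0 j)) q.
  move=> IH Uq; apply: derive_row.
    by apply: filterS IH _; exact: open_nbhs_nbhs.
  by move=> j; rewrite -dersE; apply/smooth_derivable/smooth_ders/(interior_subset Uq).
have H s : forall q, U q -> forall j, pds s x q 0 j = pds s (fun q => x q 0 j) q.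
  by elim: s => [//|i s IH] q Uq j /=; exact: (D s q i IH Uq).2.
apply: filterS nU => q Uq s; split; last by move=> i; exact: (D s q i (H s) Uq).1.
suff : pds s x r @[r --> q] --> pds s x q by [].
apply: (@cvg_row R m _ (nbhs q) (nbhs_filter q)) => j; rewrite H//.
have nUq : nbhs q U by exact: open_nbhs_nbhs.
have nH : {near q, pds s (fun q => x q 0 j) =1 (fun q => pds s x q 0 j)}.
  by apply: filterS nUq => r Ur; rewrite H.
apply: (cvg_trans (near_eq_cvg nH)).
by have /(smooth_ders s)/smooth_cvg := interior_subset Uq j; rewrite dersE.
Qed.

Lemma smooth_near_row p x : smooth_at p x -> \forall q \near p, smooth_at q x.
Proof. by move=> sx; exact: (near_join sx). Qed.

Lemma pds_row p x s j : smooth_at p x ->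
  pds s x p 0 j = ders s (fun q => x q 0 j) p.
Proof.
move=> sx; suff: \forall q \near p, forall j, pds s x q 0 j = ders s (fun q => x q 0 j) q.
  by move=> /nbhs_singleton.
elim: s => [|i s IH]; first by near=> q.
apply: filterS2 (smooth_near_row sx) (near_join IH) => q /smooth_rowP sq nq k /=.
have [|_ ->] := @derive_row (pds s x) (fun j => ders s (fun q => x q 0 j)) q 'e_i nq.
  by move=> l; apply/smooth_derivable/smooth_ders.
by rewrite derE.
Unshelve. all: by end_near. Qed.

Lemma pd_row p x i j : smooth_at p x ->
  pd i x p 0 j = der i (fun q => x q 0 j) p.
Proof. exact: (@pds_row p x [:: i] j). Qed.

End Rows.

(** * Implicit functions *)

Section ImplicitFunction.
Context {R : realType} {n : nat}.
Implicit Types (f g : 'rV[R]_n -> R) (p z : 'rV[R]_n).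

Section Graph_over_a_hyperplane.
Variables (f : 'rV[R]_n -> R) (p : 'rV[R]_n) (k : 'I_n) (e r : R).
Hypothesis fe : forall z, ball p e z -> smooth z f /\ 0 < der k f z.
Hypothesis r0 : 0 < r.
Hypothesis re : 8 * r <= e.

(** Origin of the constants: an increment starts at a shift of at most [r] and moves by at most
    [2 r], whence [3 r]; with [2 r] for [z], all points are within [5 r < e] of [p]. *)
Let near_ball z s : `|z - p| < 2 * r -> `|s| <= 3 * r -> ball p e (z + s *: 'e_k).
Proof.
move=> zp sr; rewrite -ball_normE /= distrC addrAC.
apply: (le_lt_trans (ler_normD _ _)).
have h := le_trans (norm_scale_delta s k) sr.
by apply: lt_le_trans (ltr_leD zp h) _; have r0' := r0; have re' := re; lra.
Qed.

Let ball_close z s : `|z - p| < 2 * r -> `|s| <= r -> ball p e (z + s *: 'e_k).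
Proof.
by move=> zp sr; apply: near_ball => //; apply: (le_trans sr); have r0' := r0; lra.
Qed.

Let increment z s1 s2 : `|z - p| < 2 * r -> `|s1| <= r -> `|s2| <= r ->
  exists2 c, 0 < c & f (z + s2 *: 'e_k) - f (z + s1 *: 'e_k) = (s2 - s1) * c.
Proof.
move=> zp h1 h2.
have B t : `|t| <= `|s2 - s1| -> ball p e (z + s1 *: 'e_k + t *: 'e_k).
  move=> ht; rewrite -addrA -scalerDl; apply: near_ball => //.
  apply: (le_trans (ler_normD _ _)); apply: (le_trans (lerD h1 ht)).
  by apply: (le_trans (lerD (lexx r) (ler_normB _ _))); lra.
have [|t /norm_frac_le ht E] := @line_mvt _ _ f (z + s1 *: 'e_k) 'e_k (s2 - s1).
  by move=> t /B /fe[sq _]; exact: smooth_derivable.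
exists (der k f (z + s1 *: 'e_k + (t * (s2 - s1)) *: 'e_k)); first by case: (fe (B _ (ht _))).
by rewrite derE -E -addrA -scalerDl [s1 + _]addrC subrK.
Qed.

Let increasing z s1 s2 : `|z - p| < 2 * r -> `|s1| <= r -> `|s2| <= r ->
  s1 < s2 -> f (z + s1 *: 'e_k) < f (z + s2 *: 'e_k).
Proof.
move=> zp h1 h2 s12; have [c c0 E] := increment zp h1 h2.
by rewrite -subr_gt0 E mulr_gt0// subr_gt0.
Qed.

(** For [z] in [N], the function of [s] given by [f (z + s *: 'e_k)] increases on [-r, r] and has
    opposite signs at the ends, so it has exactly one zero there. *)
Let N := interior [set z | [/\ `|z - p| < 2 * r,
  f (z - r *: 'e_k) < 0 & 0 < f (z + r *: 'e_k)]].

Hypothesis fp0 : f p = 0.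

Let smooth_shift z s : `|z - p| < 2 * r -> `|s| <= r ->
  smooth z (fun q => f (q + s *: 'e_k)).
Proof.
move=> zp sr; apply: smooth_comp; last by case: (fe (ball_close zp sr)).
move=> j; apply: (@smooth_eq _ _ _ (fun q => q 0 j + (s *: 'e_k : 'rV_n) 0 j)).
  by move=> q; rewrite !mxE.
by apply: smoothD; [exact: smooth_coord|exact: smooth_cst].
Qed.

Let open_N : open N. Proof. exact: open_interior. Qed.

Let p_close : `|p - p| < 2 * r.
Proof. by rewrite subrr normr0 mulr_gt0. Qed.

Let rr : `|r| <= r. Proof. by rewrite gtr0_norm. Qed.
Let rNr : `|- r| <= r. Proof. by rewrite normrN. Qed.

Let Np : N p.
Proof.
have h0 : `|0 : R| <= r by rewrite normr0 ltW.
have fpm : 0 < - f (p + (- r) *: 'e_k).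
  rewrite oppr_gt0; have := increasing p_close rNr h0.
  by rewrite oppr_lt0 scale0r addr0 fp0; apply.
have fpp : 0 < f (p + r *: 'e_k).
  by have := increasing p_close h0 rr r0; rewrite scale0r addr0 fp0.
have n1 := smooth_near_gt0 (smoothN (smooth_shift p_close rNr)) fpm.
have n2 := smooth_near_gt0 (smooth_shift p_close rr) fpp.
have n3 : \forall z \near p, `|z - p| < 2 * r.
  have : nbhs p (ball p (2 * r)) by apply: nbhsx_ballx; rewrite mulr_gt0.
  by apply: filterS => z; rewrite -ball_normE /= distrC.
apply: filterS3 n1 n2 n3 => z; rewrite oppr_gt0 scaleNr => ? ? ?; by split.
Qed.

Let ex_root z : exists s, N z -> `|s| < r /\ f (z + s *: 'e_k) = 0.
Proof.
have [Nz|] := pselect (N z); last by exists 0.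
have [zp fm fM] := interior_subset Nz.
have D (s : R) : s \in `[- r, r] ->
    is_derive s 1 (fun t : R => f (z + t *: 'e_k)) ('D_('e_k) f (z + s *: 'e_k)).
  rewrite in_itv /= -ler_norml => sr; apply: is_derive_line.
  by apply: smooth_derivable; case: (fe (ball_close zp sr)).
have C : {within `[- r, r], continuous (fun t : R => f (z + t *: 'e_k))}.
  apply: derivable_within_continuous => s sr.
  exact: (ex_derive (is_derive := D s sr)).
have rr' : - r <= r by rewrite -subr_ge0 opprK addr_ge0// ltW.
have [|s] := IVT (v := 0) rr' C.
  by rewrite /= scaleNr ge_min le_max (ltW fm) (ltW fM) orbT.
rewrite in_itv /= => /andP[s1 s2] fs; exists s => _; split=> //.
rewrite ltr_norml !lt_neqAle s1 s2 !andbT; apply/andP; split.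
  by apply: contraTneq fm => E; rewrite -scaleNr E fs ltxx.
by apply: contraTneq fM => E; rewrite -E fs ltxx.
Qed.

Let g := projT1 (choice ex_root).
Let gP z : N z -> `|g z| < r /\ f (z + g z *: 'e_k) = 0.
Proof. exact: (projT2 (choice ex_root)). Qed.

Let Nclose z : N z -> `|z - p| < 2 * r.
Proof. by move=> /interior_subset[]. Qed.

Let root_lt z s : N z -> `|s| <= r -> 0 < f (z + s *: 'e_k) -> g z < s.
Proof.
move=> Nz sr; rewrite [g z < s]ltNge; apply: contraL; rewrite le_eqVlt => /predU1P[->|sg].
  by rewrite (gP Nz).2 ltxx.
rewrite -leNgt -(gP Nz).2 ltW// increasing//; first exact: Nclose.
by rewrite ltW// (gP Nz).1.
Qed.

Let root_gt z s : N z -> `|s| <= r -> f (z + s *: 'e_k) < 0 -> s < g z.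
Proof.
move=> Nz sr; rewrite [s < g z]ltNge; apply: contraL; rewrite le_eqVlt => /predU1P[<-|sg].
  by rewrite (gP Nz).2 ltxx.
rewrite -leNgt -(gP Nz).2 ltW// increasing//; first exact: Nclose.
by rewrite ltW// (gP Nz).1.
Qed.

Let root_uniq z s : N z -> `|s| <= r -> f (z + s *: 'e_k) = 0 -> g z = s.
Proof.
move=> Nz sr fs; have [gr fg] := gP Nz; apply/eqP.
case: (ltgtP (g z) s) => // h.
  by have := increasing (Nclose Nz) (ltW gr) sr h; rewrite fs fg ltxx.
by have := increasing (Nclose Nz) sr (ltW gr) h; rewrite fs fg ltxx.
Qed.

(** [f] is positive slightly above the root over [z] and negative slightly below; both signs persist
    over nearby points and trap their roots. *)
Let g_cvg z : N z -> g y @[y --> z] --> g z.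
Proof.
move=> Nz; apply: (@cvgrPdist_lt _ _ _ (nbhs z) (nbhs_filter z) g (g z)).2 => eps eps0.
have [gr fg] := gP Nz; have zp := Nclose Nz.
(* The second bound keeps [g z + d] and [g z - d] in [-r, r], where comparing signs locates the
   root. *)
pose d := Num.min eps (r - `|g z|).
have d0 : 0 < d by rewrite lt_min eps0 subr_gt0.
have hp : `|g z + d| <= r.
  by rewrite (le_trans (ler_normD _ _))// (gtr0_norm d0) -lerBrDl ge_min lexx orbT.
have hm : `|g z - d| <= r.
  by rewrite (le_trans (ler_normB _ _))// (gtr0_norm d0) -lerBrDl ge_min lexx orbT.
have n1 : \forall y \near z, 0 < f (y + (g z + d) *: 'e_k).
  apply: (smooth_near_gt0 (smooth_shift zp hp)); rewrite -fg.
  by apply: increasing => //; [exact: ltW|rewrite ltrDl].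
have n2 : \forall y \near z, 0 < - f (y + (g z - d) *: 'e_k).
  apply: (smooth_near_gt0 (smoothN (smooth_shift zp hm))); rewrite oppr_gt0 -fg.
  by apply: increasing => //; [exact: ltW|rewrite ltrBlDr ltrDl].
have nN : \forall y \near z, N y by exact: open_nbhs_nbhs.
apply: filterS3 nN n1 n2 => y Ny h1; rewrite oppr_gt0 => h2.
have l1 := root_lt Ny hp h1; have l2 := root_gt Ny hm h2.
have de : d <= eps by rewrite ge_min lexx.
by rewrite ltr_norml; apply/andP; split; lra.
Qed.

Let P z := z + g z *: 'e_k.

Let P_ball z : N z -> ball p e (P z).
Proof. by move=> Nz; apply: ball_close; [exact: Nclose|exact/ltW/(gP Nz).1]. Qed.

(** From [P z] to [P (h *: 'e_i + z)] only the coordinates [i] and [k] vary, while [f] stays 0: the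
    mean value theorem gives [h f_i + (increment of g) f_k = 0], with partial derivatives at points
    tending to [P z] because [g] is continuous. *)
Let g_derive z i : N z -> is_derive z 'e_i g (- (der i f (P z) / der k f (P z))).
Proof.
move=> Nz; pose y (h : R) := P (h *: 'e_i + z).
have Pcvg : P w @[w --> z] --> P z.
  apply: (@cvg_row R n _ (nbhs z) (nbhs_filter z)) => j.
  rewrite /P !mxE; under eq_fun do rewrite !mxE.
  apply: cvgD; first exact: coord_continuous.
  by apply: cvgM; [exact: g_cvg|exact: cvg_cst].
have zcvg : h *: 'e_i + z @[h --> (0 : R)^'] --> (z : 'rV[R]_n).
  apply: (@cvg_row R n _ ((0:R)^') _) => j.
  pose c : R := ((0 == 0 :> 'I_1) && (j == i))%:R.
  have : h * c + z 0 j @[h --> (0:R)^'] --> 0 * c + z 0 j.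
    by apply: cvgD; [apply: cvgM; [exact: cvg_within|exact: cvg_cst]|exact: cvg_cst].
  rewrite mul0r add0r (_ : (fun h => h * c + z 0 j) = (fun h => (h *: 'e_i + z) 0 j))//.
  by apply/funext => h; rewrite !mxE.
have ycvg : y h @[h --> (0 : R)^'] --> P z by exact: (cvg_comp _ _ zcvg Pcvg).
have nN : \forall h \near (0 : R)^', N (h *: 'e_i + z).
  have nz : \forall w \near z, N w by exact: open_nbhs_nbhs.
  exact: (zcvg _ nz).
have nB : \forall h \near (0:R)^', forall w, `|w - P z| <= `|y h - P z| -> ball p e w.
  have : nbhs (P z) (ball p e).
    apply: open_nbhs_nbhs; split; [exact: ball_open|exact: P_ball].
  move=> /nbhs_ballP[d d0 Hd].
  have /cvgrPdist_lt/(_ _ d0) := ycvg; apply: filterS => h hd w hw.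
  by apply: Hd; rewrite -ball_normE /= distrC (le_lt_trans hw)// distrC.
have ex h : exists xi : 'I_n -> 'rV[R]_n,
    (forall w, `|w - P z| <= `|y h - P z| -> ball p e w) ->
    (forall j, `|xi j - P z| <= `|y h - P z|) /\
    f (y h) - f (P z) = \sum_j (y h 0 j - P z 0 j) * der j f (xi j).
  have [H|] := pselect (forall w, `|w - P z| <= `|y h - P z| -> ball p e w); last by exists (fun=> 0).
  have [|xi h1 h2] := @row_mvt _ _ f (P z) (y h).
    by move=> w /H/fe[sw _] j; exact: smooth_derivable.
  by exists xi => _; split=> //; rewrite h2; apply: eq_bigr => j _; rewrite derE.
have [xi xiP] := choice ex.
have xicvg j : xi h j @[h --> (0:R)^'] --> P z.
  apply/cvgrPdist_lt => eps eps0; have /cvgrPdist_lt/(_ _ eps0) := ycvg.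
  apply: filterS2 nB => h hB; rewrite distrC => heps; rewrite distrC.
  by apply: le_lt_trans heps; have [] := xiP h hB.
have [sP dP] := fe (P_ball Nz).
have L : (- (der i f (xi h i) / der k f (xi h k))) @[h --> (0:R)^'] -->
   - (der i f (P z) / der k f (P z)).
  apply: cvgN; apply: cvgM.
    exact: (cvg_comp _ _ (xicvg i) (smooth_cvg (smooth_der i sP))).
  apply: cvgV; first by rewrite gt_eqF.
  exact: (cvg_comp _ _ (xicvg k) (smooth_cvg (smooth_der k sP))).
have n0 : \forall h \near (0:R)^', h != 0 by exact: nbhs_dnbhs_neq.
suff L' : h^-1 *: ((g \o shift z) (h *: 'e_i) - g z) @[h --> (0:R)^'] -->
   - (der i f (P z) / der k f (P z)).
  by split; [apply/cvg_ex; eexists; exact: L'|exact: cvg_lim].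
apply: cvg_trans L; apply: near_eq_cvg.
apply: filterS3 nN nB n0 => h hN hB h0 /=.
have [hx] := xiP h hB; rewrite /y (gP hN).2 (gP Nz).2 subrr => E.
have B0 : 0 < der k f (xi h k) by case: (fe (hB _ (hx k))).
have {}E : h * der i f (xi h i) + (g (h *: 'e_i + z) - g z) * der k f (xi h k) = 0.
  apply: etrans (esym E).
  (* Kronecker symbols keep the case [i = k], where the two contributions fall on one coordinate, in
     the same formula. *)
  pose w j := (j == i)%:R * (h * der j f (xi h j)) + (j == k)%:R * ((g (h *: 'e_i + z) - g z) * der j f (xi h j)).
  have -> : \sum_j (P (h *: 'e_i + z) 0 j - P z 0 j) * der j f (xi h j) = \sum_j w j.
    by apply: eq_bigr => j _; rewrite /P /w !mxE eqxx /=; ring.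
  rewrite big_split /= (bigD1 i)//= eqxx mul1r big1 ?addr0; last first.
    by move=> j /negPf ->; rewrite mul0r.
  rewrite (bigD1 k)//= eqxx mul1r big1 ?addr0// => j /negPf ->.
  by rewrite mul0r.
have Bn0 : der k f (xi h k) != 0 by rewrite gt_eqF.
rewrite -[_ *: _]/(_ * _) /shift /=.
have -> : g (h *: 'e_i + z) - g z = - (h * der i f (xi h i)) / der k f (xi h k).
  by apply: (mulIf Bn0); rewrite divfK//; apply/eqP; rewrite -addr_eq0 addrC E.
by rewrite mulNr mulrN -mulrA mulKf.
Qed.

Let P_Ck j : Ck j N g -> forall i, Ck j N (fun z => P z 0 i).
Proof.
move=> kg i; have H := CkD open_N (Ck_coord j N i) (CkM open_N kg (Ck_cst j N (('e_k : 'rV[R]_n) 0 i))).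
by apply: Ck_ext open_N _ H => z _; rewrite /P !mxE.
Qed.

(** Bootstrapping: the derivatives of [g] are a smooth function of [P z], which is as regular as
    [g]; each pass gains one order. *)
Let g_Ck j : Ck j N g.
Proof.
elim: j => [|j IH]; first by split=> // z /g_cvg.
split; first by move=> z /g_cvg.
split; first by move=> z Nz i; exact: (ex_derive (is_derive := g_derive i Nz)).
move=> i.
have oB : open (ball p e) by exact: ball_open.
have sD l : smooth_on (ball p e) (der l f).
  by apply/smooth_onP => z /fe[sz _] s; rewrite -dersE;
    have := smooth_ders s (smooth_der l sz); split;
    [exact: smooth_continuous|move=> a; exact: smooth_derivable].
have D0 z : ball p e z -> der k f z != 0 by move=> /fe[_ ?]; rewrite gt_eqF.
have H := CkN oB (CkM oB (sD i j) (CkV oB D0 (sD k j))).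
apply: Ck_ext open_N _ (Ck_comp open_N oB P_ball (P_Ck IH) H) => z Nz /=.
by rewrite /pd (derive_val (is_derive := g_derive i Nz)).
Qed.

Lemma implicit_pos : exists g, [/\ smooth p g, g p = 0,
  \forall z \near p, [/\ f (z + g z *: 'e_k) = 0,
    smooth (z + g z *: 'e_k) f, der k f (z + g z *: 'e_k) != 0 &
    forall i, der i g z =
      - (der i f (z + g z *: 'e_k) / der k f (z + g z *: 'e_k))] &
  \forall z \near p, forall s, `|s| <= r -> f (z + s *: 'e_k) = 0 -> g z = s].
Proof.
exists g; have nN : \forall y \near p, N y by exact: open_nbhs_nbhs.
split.
- by apply/smoothP; exists N; split=> // j; exact: g_Ck.
- by apply: root_uniq => //; rewrite ?normr0 ?ltW// scale0r addr0.
- apply: filterS nN => z Nz; have [sP dP] := fe (P_ball Nz).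
  split=> //; first by case: (gP Nz).
    by rewrite gt_eqF.
  by move=> i; rewrite derE /pd (derive_val (is_derive := g_derive i Nz)).
- by apply: filterS nN => z Nz s; exact: root_uniq.
Qed.

End Graph_over_a_hyperplane.

(* The projection onto the zero set of [f] along the direction ['e_k]; compared
   with an implicit function of the other coordinates, it avoids changing the
   dimension. *)
Lemma implicit_projection f p k : smooth p f -> f p = 0 -> der k f p != 0 ->
  exists g (r : R), [/\ 0 < r, smooth p g, g p = 0,
  \forall z \near p, [/\ f (z + g z *: 'e_k) = 0,
    smooth (z + g z *: 'e_k) f, der k f (z + g z *: 'e_k) != 0 &
    forall i, der i g z =
      - (der i f (z + g z *: 'e_k) / der k f (z + g z *: 'e_k))] &
  \forall z \near p, forall s, `|s| <= r -> f (z + s *: 'e_k) = 0 -> g z = s].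
Proof.
wlog dpos : f / 0 < der k f p => [H|].
  move=> sf f0 d0; have [dpos|dneg|dz] := ltgtP 0 (der k f p).
  - exact: H.
  - have nE : \forall z \near p, forall i, der i (fun q => - f q) z = - der i f z.
      by apply: (near_smooth sf) => z sz i; rewrite derN.
    have [||||g [r [r0 sg gp h1 h2]]] := H (fun q => - f q).
    + by rewrite derN// oppr_gt0.
    + exact: smoothN.
    + by rewrite f0 oppr0.
    + by rewrite derN// oppr_eq0.
    exists g, r; split=> //.
      apply: filterS h1 => z [a1 a2 a3 a4].
      have sz : smooth (z + g z *: 'e_k) f.
        by apply: smooth_eq (smoothN a2) => q; rewrite opprK.
      split=> //; first by apply: oppr_inj; rewrite a1 oppr0.
        by move: a3; rewrite derN// oppr_eq0.
      by move=> i; rewrite a4 !derN// invrN mulrNN.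
    by apply: filterS h2 => z hz s sr fs; apply: hz => //; rewrite fs oppr0.
  - by rewrite -dz eqxx in d0.
move=> sf f0 d0.
have /nbhs_ballP[e e0 He] : \forall z \near p, smooth z f /\ 0 < der k f z.
  exact: filterI (smooth_near sf) (smooth_near_gt0 (smooth_der k sf) dpos).
have e0' : 0 < e := e0.
have r0 : 0 < e / 8%:R by rewrite divr_gt0.
have re : 8 * (e / 8%:R) <= e by rewrite mulrC divfK.
have [g [sg gp h1 h2]] := implicit_pos He r0 re f0.
by exists g, (e / 8%:R).
Qed.

End ImplicitFunction.

(** * Jacobians and orders of vanishing *)

Section Jacobian.
Context {R : realType} {n : nat}.
Implicit Types (f g h : 'rV[R]_n -> R) (p z : 'rV[R]_n).

Definition jac (i k : 'I_n) f g : 'rV[R]_n -> R :=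
  fun z => der i f z * der k g z - der k f z * der i g z.

Lemma smooth_jac p i k f g : smooth p f -> smooth p g -> smooth p (jac i k f g).
Proof. by move=> sf sg; apply: smoothB; apply: smoothM; exact: smooth_der. Qed.

Lemma jac_antisym i k f g z : jac i k f g z = - jac i k g f z.
Proof. by rewrite /jac; ring. Qed.

Lemma jac_swap i k f g z : jac k i f g z = - jac i k f g z.
Proof. by rewrite /jac opprB. Qed.

Lemma jacN i k f g z : smooth z f ->
  jac i k (fun q => - f q) g z = - jac i k f g z.
Proof. by move=> sf; rewrite /jac !derN//; ring. Qed.

Lemma near_eq_jac i k f1 f2 g p : {near p, f1 =1 f2} ->
  jac i k f1 g p = jac i k f2 g p.
Proof. by move=> E; rewrite /jac !(near_eq_der _ E). Qed.

Lemma jac_div i k f g h p : smooth p f -> smooth p h -> h p != 0 -> f p = 0 ->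
  jac i k (fun z => f z / h z) g p = jac i k f g p / h p.
Proof.
move=> sf sh h0 f0; rewrite /jac !(derM _ sf (smoothV h0 sh)) f0.
by rewrite !mul0r !addr0; ring.
Qed.

End Jacobian.

Definition displacement {R : realType} {n : nat} (f : 'rV[R]_n -> R) (p : 'rV[R]_n)
    (k : 'I_n) (g : 'rV[R]_n -> R) :=
  [/\ smooth p g, g p = 0 &
  \forall z \near p, [/\ f (z + g z *: 'e_k) = 0,
    smooth (z + g z *: 'e_k) f, der k f (z + g z *: 'e_k) != 0 &
    forall i, der i g z =
      - (der i f (z + g z *: 'e_k) / der k f (z + g z *: 'e_k))]].

Lemma implicit_displacement {R : realType} {n : nat} (f : 'rV[R]_n -> R) p k :
  smooth p f -> f p = 0 -> der k f p != 0 ->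
  exists2 g, displacement f p k g & exists2 r, 0 < r &
    \forall z \near p, forall s, `|s| <= r -> f (z + s *: 'e_k) = 0 -> g z = s.
Proof.
move=> sf f0 d0; have [g [r [r0 sg g0 h1 h2]]] := implicit_projection sf f0 d0.
by exists g; [split|exists r].
Qed.

Section Projection.
Context {R : realType} {n : nat}.
Variables (f : 'rV[R]_n -> R) (p : 'rV[R]_n) (k : 'I_n) (g : 'rV[R]_n -> R).
Hypothesis fg : displacement f p k g.
Implicit Types (h : 'rV[R]_n -> R) (z : 'rV[R]_n).

Let P z := z + g z *: 'e_k.

Lemma proj_center : P p = p.
Proof. by rewrite /P; have [_ -> _] := fg; rewrite scale0r addr0. Qed.

Lemma smooth_proj z : smooth z g -> forall j, smooth z (fun q => P q 0 j).
Proof.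
move=> sg j; apply: (@smooth_eq _ _ _ (fun q => q 0 j + g q * ('e_k : 'rV[R]_n) 0 j)).
  by move=> q; rewrite !mxE.
by apply: smoothD; [exact: smooth_coord|apply: smoothM => //; exact: smooth_cst].
Qed.

Lemma cvg_proj : P z @[z --> p] --> p.
Proof.
rewrite -[X in _ --> X]proj_center; apply: cvg_smooth_row.
by apply: smooth_proj; case: fg.
Qed.

Lemma smooth_comp_proj h : smooth p h -> smooth p (fun z => h (P z)).
Proof.
move=> sh; apply: smooth_comp; last by rewrite proj_center.
by apply: smooth_proj; case: fg.
Qed.

(** When [z] moves along ['e_i], its projection moves with velocity [e_i - (f_i / f_k) e_k], which
    is tangent to [f = 0]; derivatives along it are Jacobians divided by [f_k]. *)
Lemma der_proj h i : smooth p h ->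
  {near p, der i (fun z => h (P z)) =1 fun z => jac i k h f (P z) / der k f (P z)}.
Proof.
move=> sh; have [sg g0 Hg] := fg.
have nh : \forall z \near p, smooth (P z) h by apply: (cvg_proj (smooth_near sh)).
apply: filterS3 nh (smooth_near sg) Hg => z hz gz [_ _ d0 dg].
rewrite (der_comp (smooth_proj gz))//.
have E j : der i (fun q => P q 0 j) z = (i == j)%:R + der i g z * (k == j)%:R.
  rewrite (_ : (fun q => P q 0 j) = (fun q => q 0 j + (k == j)%:R * g q)); last first.
    by apply/funext => q; rewrite !mxE eqxx eq_sym mulrC.
  rewrite derD; [|exact: smooth_coord|exact: smoothZ].
  by rewrite derZ// der_coord mulrC.
have -> : \sum_j der i (fun q => P q 0 j) z * der j h (P z) =
    \sum_j (i == j)%:R * der j h (P z) + der i g z * \sum_j (k == j)%:R * der j h (P z).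
  by rewrite mulr_sumr -big_split; apply: eq_bigr => j _; rewrite E /=; ring.
have S l : \sum_j (l == j)%:R * der j h (P z) = der l h (P z).
  rewrite (bigD1 l)//= eqxx mul1r big1 ?addr0// => j; rewrite eq_sym => /negPf ->.
  by rewrite mul0r.
rewrite !S dg /jac -/(P z); field; exact: d0.
Qed.

(** The first derivative is again a function composed with the projection, so [der_proj] applies to
    it; the derivative of the denominator disappears because its factor, the Jacobian, is 0 at
    [p]. *)
Lemma der2_proj h i : smooth p f -> smooth p h -> jac i k h f p = 0 ->
  der i (der i (fun z => h (P z))) p =
  jac i k (jac i k h f) f p / der k f p ^+ 2.
Proof.
move=> sf sh j0; have [_ _ /nbhs_singleton[_ _]] := fg.
rewrite -/(P p) proj_center => d0 _.
rewrite (near_eq_der i (der_proj i sh)).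
have sj := smooth_jac i k sh sf; have sd := smooth_der k sf.
have sq : smooth p (fun z => jac i k h f z / der k f z).
  by apply: smoothM => //; exact: smoothV.
have := nbhs_singleton (der_proj i sq); rewrite proj_center => ->.
by rewrite (jac_div _ _ _ sj sd)// expr2 invfM mulrA.
Qed.

Lemma der_proj_center h i : smooth p h ->
  der i (fun z => h (P z)) p = jac i k h f p / der k f p.
Proof. by move=> /(der_proj i)/nbhs_singleton; rewrite proj_center. Qed.

End Projection.

Section VanishingOrder.
Context {R : realType} {n : nat}.
Variables (i : 'I_n) (p : 'rV[R]_n).
Implicit Types (f g : 'rV[R]_n -> R).

Definition vanish (a : nat) f := forall j, (j < a)%N -> iter j (der i) f p = 0.

Lemma near_eq_iter j f g : {near p, f =1 g} ->
  iter j (der i) f p = iter j (der i) g p.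
Proof.
move=> fg; have /nbhs_singleton := near_eq_ders (nseq j i) fg.
have E h : ders (nseq j i) h = iter j (der i) h by elim: j => //= j ->.
by rewrite !E.
Qed.

Lemma iterD j f g : smooth p f -> smooth p g ->
  iter j (der i) (fun q => f q + g q) p = iter j (der i) f p + iter j (der i) g p.
Proof.
elim: j f g => // j IH f g sf sg; rewrite !iterSr -IH; [|exact: smooth_der..].
apply: near_eq_iter; apply: (near_smooth2 sf sg) => q; exact: derD.
Qed.

Lemma iterM_succ j f g : smooth p f -> smooth p g ->
  iter j.+1 (der i) (fun q => f q * g q) p =
  iter j (der i) (fun q => der i f q * g q) p +
  iter j (der i) (fun q => f q * der i g q) p.
Proof.
move=> sf sg; rewrite iterSr -iterD; last first.
- by apply: smoothM => //; exact: smooth_der.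
- by apply: smoothM => //; exact: smooth_der.
apply: near_eq_iter; apply: (near_smooth2 sf sg) => q; exact: derM.
Qed.

Lemma vanish_der a f : vanish a.+1 f -> vanish a (der i f).
Proof. by move=> H j ja; rewrite -iterSr H. Qed.

Lemma vanish_leading N a b f g : (a + b = N)%N -> smooth p f -> smooth p g ->
  vanish a f -> vanish b g ->
  vanish N (fun q => f q * g q) /\
  iter N (der i) (fun q => f q * g q) p =
    'C(N, a)%:R * (iter a (der i) f p * iter b (der i) g p).
Proof.
elim: N a b f g => [|N IH] a b f g ab sf sg va vb.
  move/eqP: ab; rewrite addn_eq0 => /andP[/eqP -> /eqP ->].
  by split=> //=; rewrite bin0 mul1r.
have sf' := smooth_der i sf; have sg' := smooth_der i sg.
have H0 : f p * g p = 0.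
  case: a ab va => [|a] ab va; last by rewrite (va 0%N isT : f p = 0) mul0r.
  by case: b ab vb => // b _ vb; rewrite (vb 0%N isT : g p = 0) mulr0.
(* The two summands of Pascal's rule. When [a = 0], [g] vanishes to order [N + 1], so the first
   summand is 0, whence the coefficient 0. *)
suff [[v1 e1] [v2 e2]] :
    (vanish N (fun q => der i f q * g q) /\
     iter N (der i) (fun q => der i f q * g q) p = (if a is a'.+1 then 'C(N, a') else 0)%:R *
       (iter a (der i) f p * iter b (der i) g p)) /\
    (vanish N (fun q => f q * der i g q) /\
     iter N (der i) (fun q => f q * der i g q) p = 'C(N, a)%:R *
       (iter a (der i) f p * iter b (der i) g p)).
  split.
    case=> [|j] jN; first exact: H0.
    by rewrite iterM_succ// v1// v2// addr0.
  rewrite iterM_succ// e1 e2 -mulrDl -natrD; congr (_%:R * _).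
  by case: (a) => [|a']; rewrite ?bin0 // binS addnC.
split.
- case: a ab va => [|a] ab va.
    rewrite add0n in ab; rewrite mul0r.
    have vN : vanish N g by move=> j jN; apply: vb; rewrite ab ltnS ltnW.
    have [v ->] := IH 0%N N _ _ (erefl _) sf' sg (fun j => ltac:(by [])) vN.
    by split=> //; rewrite (vb N) ?ab// !mulr0.
  have [] := IH a b _ _ _ sf' sg (vanish_der va) vb; first by case: ab.
  by rewrite -iterSr.
- case: b ab vb => [|b] ab vb.
    rewrite addn0 in ab.
    have vN : vanish N f by move=> j jN; apply: va; rewrite ab ltnS ltnW.
    have [v ->] := IH N 0%N _ _ (addn0 _) sf sg' vN (fun j => ltac:(by [])).
    by split=> //; rewrite (va N) ?ab// mul0r mulr0 bin_small ?mul0r.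
  have [] := IH a b _ _ _ sf sg' va (vanish_der vb).
    by move: ab; rewrite addnS => -[].
  by rewrite -iterSr.
Qed.

End VanishingOrder.

Section CurvesAsMaps.
Context {R : realType} {W : normedModType R}.
Implicit Types (c : R -> W).

(* A curve is turned into a map on ['rV_1], to which the calculus applies. *)
Definition lift1 c : 'rV[R]_1 -> W := fun u => c (u 0 0).

Lemma lift1_quotient c (u : 'rV[R]_1) i :
  (fun h : R => h^-1 *: ((lift1 c \o shift u) (h *: 'e_i) - lift1 c u)) =
  (fun h : R => h^-1 *: ((c \o shift (u 0 0)) (h *: 1) - c (u 0 0))).
Proof.
apply/funext => h; rewrite /lift1 /=; congr (_ *: (c _ - _)).
by rewrite !mxE (ord1 i) eqxx.
Qed.

Lemma pd_lift1 c i : pd i (lift1 c) = lift1 (derive1 c).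
Proof.
apply/funext => u; rewrite /lift1 derive1E /pd /derive.
by have := lift1_quotient c u i; rewrite /lift1 => ->.
Qed.

Lemma pds_lift1 c s : pds s (lift1 c) = lift1 (derive1n (size s) c).
Proof. by elim: s => //= i s ->; rewrite pd_lift1. Qed.

Lemma derivable_lift1 c (u : 'rV[R]_1) i :
  derivable (lift1 c) u 'e_i <-> derivable c (u 0 0) 1.
Proof. by rewrite /derivable lift1_quotient. Qed.

Lemma cvg_coord1 (t : R) : u 0 0 @[u --> (const_mx t : 'rV[R]_1)] --> t.
Proof. by have := @coord_continuous R 1 1 0 0 (const_mx t); rewrite /continuous_at mxE. Qed.

Lemma cvg_const_mx (t : R) : (const_mx s : 'rV[R]_1) @[s --> t] --> (const_mx t : 'rV[R]_1).
Proof.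
apply: (@cvg_row R 1 _ (nbhs t) (nbhs_filter t)) => j.
by rewrite mxE; under eq_fun do rewrite mxE; exact: cvg_id.
Qed.

Lemma smooth_curve_lift1 c (t : R) :
  smooth_curve_at t c <-> smooth_at (const_mx t : 'rV[R]_1) (lift1 c).
Proof.
split=> sc.
  have nc : \forall u \near (const_mx t : 'rV[R]_1),
      forall k, derivable (derive1n k c) ((u : 'rV[R]_1) 0 0) 1.
    exact: (@cvg_coord1 t _ sc).
  apply: filterS nc => u uc s; rewrite pds_lift1.
  split=> [|i]; last by apply/derivable_lift1.
  have /derivable1_diffP/differentiable_continuous cc := uc (size s).
  exact: (cvg_comp _ _ (@coord_continuous R 1 1 0 0 u) cc).
have nc : \forall s \near t, forall l : seq 'I_1,
    {for (const_mx s : 'rV[R]_1), continuous (pds l (lift1 c))} /\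
    (forall i, derivable (pds l (lift1 c)) (const_mx s : 'rV[R]_1) 'e_i).
  exact: (@cvg_const_mx t _ sc).
apply: filterS nc => s sc' k.
have [_ /(_ ord0)] := sc' (nseq k ord0).
by rewrite pds_lift1 size_nseq => /derivable_lift1; rewrite mxE.
Qed.

End CurvesAsMaps.

Section Lift1.
Context {R : realType}.

Lemma iter_der_lift1 (c : R -> R) k : iter k (der 0) (lift1 c) = lift1 (derive1n k c).
Proof. by elim: k => //= k ->; rewrite derE pd_lift1. Qed.

Lemma derive1nE (c : R -> R) k t :
  derive1n k c t = iter k (der 0) (lift1 c) (const_mx t).
Proof. by rewrite iter_der_lift1 /lift1 mxE. Qed.

End Lift1.

(** * Plane curves *)

Lemma ord2P (j : 'I_2) : j = 0 \/ j = 1.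
Proof. by case: j => [[|[|//]]] ?; [left|right]; exact/val_inj. Qed.

Lemma sum2 {R : realType} (F : 'I_2 -> R) : \sum_j F j = F 0 + F 1.
Proof. by rewrite !big_ord_recl big_ord0 addr0; congr (_ + F _); exact/val_inj. Qed.

Lemma other2 (k : 'I_2) : exists2 i : 'I_2, i != k & forall j, j = i \/ j = k.
Proof.
case: (ord2P k) => ->; [exists 1 => // j|exists 0 => // j].
  by case: (ord2P j) => ->; [right|left].
by case: (ord2P j) => ->; [left|right].
Qed.

Lemma jac2 {R : realType} (i k : 'I_2) (f g : 'rV[R]_2 -> R) z : i != k ->
  jac i k f g z = jac 0 1 f g z \/ jac i k f g z = - jac 0 1 f g z.
Proof.
case: (ord2P i) => ->; case: (ord2P k) => -> // _; first by left.
by right; rewrite jac_swap.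
Qed.

Lemma jac_jac2 {R : realType} (i k : 'I_2) (f g : 'rV[R]_2 -> R) z : i != k ->
  smooth z f -> smooth z g ->
  jac i k (jac i k f g) g z = jac 0 1 (jac 0 1 f g) g z.
Proof.
case: (ord2P i) => ->; case: (ord2P k) => -> // _ sf sg.
rewrite jac_swap (@near_eq_jac _ _ _ _ _ (fun q => - jac 0 1 f g q)).
  by rewrite jacN ?opprK//; exact: smooth_jac.
by near=> q; rewrite jac_swap.
Unshelve. all: by end_near. Qed.

Section Line.
Context {R : realType} {n : nat}.
Variables (p : 'rV[R]_n) (i : 'I_n).

Definition line (u : 'rV[R]_1) : 'rV[R]_n := p + u 0 0 *: 'e_i.

Lemma line0 : line (const_mx 0) = p.
Proof. by rewrite /line mxE scale0r addr0. Qed.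

Lemma line_coord j : (fun u => line u 0 j) = (fun u => p 0 j + ('e_i : 'rV[R]_n) 0 j * u 0 0).
Proof. by apply/funext => u; rewrite !mxE mulrC. Qed.

Lemma smooth_line u j : smooth u (fun u => line u 0 j).
Proof.
rewrite line_coord; apply: smoothD; first exact: smooth_cst.
by apply: smoothZ; exact: smooth_coord.
Qed.

Lemma cvg_line : line u @[u --> (const_mx 0 : 'rV[R]_1)] --> p.
Proof.
rewrite -[X in _ --> X]line0; apply: cvg_smooth_row => j; exact: smooth_line.
Qed.

Lemma der_line (F : 'rV[R]_n -> R) u : smooth (line u) F ->
  der 0 (fun u => F (line u)) u = der i F (line u).
Proof.
move=> sF; rewrite (der_comp (smooth_line u))//.
have E j : der 0 (fun u => line u 0 j) u = (i == j)%:R.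
  rewrite line_coord derD; [|exact: smooth_cst|exact/smoothZ/smooth_coord].
  rewrite der_cst derZ; last exact: smooth_coord.
  by rewrite der_coord eqxx mulr1 add0r mxE eqxx eq_sym.
under eq_bigr do rewrite E.
rewrite (bigD1 i)//= eqxx mul1r big1 ?addr0// => j; rewrite eq_sym => /negPf ->.
by rewrite mul0r.
Qed.

Lemma iter_line (F : 'rV[R]_n -> R) j : smooth p F ->
  iter j (der 0) (fun u => F (line u)) (const_mx 0) = iter j (der i) F p.
Proof.
elim: j F => [|j IH] F sF; first by rewrite /= line0.
rewrite !iterSr -IH; last exact: smooth_der.
apply: near_eq_iter.
have nF : \forall u \near (const_mx 0 : 'rV[R]_1), smooth (line u) F.
  exact: (cvg_line (smooth_near sF)).
by apply: filterS nF => u; exact: der_line.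
Qed.

End Line.

Section Curves.
Context {R : realType}.
Implicit Types (f h : 'rV[R]_2 -> R) (p : 'rV[R]_2).

Lemma lift1_comp h (c : R -> 'rV[R]_2) : lift1 (h \o c) = (fun u => h (lift1 c u)).
Proof. by []. Qed.

(** The curve is the projection of the line through [p] along ['e_i]. Its [i]-th coordinate is that
    of the line, because the projection only moves coordinate [k]; so its velocity is nonzero.
    Orders of contact become iterated [der i] of a composition with the projection. *)
Lemma proj_param f p (i k : 'I_2) g : i != k -> displacement f p k g ->
  exists c, regular_param f p c /\ forall h, smooth p h -> forall j,
    derive1n j (h \o c) 0 = iter j (der i) (fun z => h (z + g z *: 'e_k)) p.
Proof.
move=> ik fg; pose P z := z + g z *: 'e_k; have [sg g0 Hg] := fg.
pose c (s : R) := P (p + s *: 'e_i).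
have sP j : smooth p (fun z => P z 0 j) by exact: smooth_proj.
have sc j : smooth (const_mx 0) (fun u => lift1 c u 0 j).
  apply: (@smooth_comp _ _ _ (const_mx 0) (line p i) (fun z => P z 0 j)).
    by move=> l; exact: smooth_line.
  by rewrite line0.
exists c; split; last first.
  move=> h sh j; rewrite derive1nE.
  exact: (iter_line i j (smooth_comp_proj fg sh)).
split.
- by apply/smooth_curve_lift1/smooth_rowP.
- by rewrite /c scale0r addr0 /P g0 scale0r addr0.
- apply: contraTneq (oner_neq0 R) => c0.
  have : derive1 c 0 0 i = 0 by rewrite c0 mxE.
  have -> : derive1 c 0 = pd 0 (lift1 c) (const_mx 0) by rewrite pd_lift1 /lift1 mxE.
  rewrite pd_row; last exact/smooth_rowP.
  have -> : der 0 (fun u => lift1 c u 0 i) (const_mx 0) = der i (fun z => P z 0 i) p.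
    exact: (iter_line i 1 (sP i)).
  have -> : (fun z => P z 0 i) = (fun z : 'rV[R]_2 => z 0 i).
    by apply/funext => z; rewrite !mxE eqxx (negPf ik) mulr0 addr0.
  by rewrite der_coord eqxx => /eqP; rewrite oner_eq0.
- have cv : line p i (const_mx s) @[s --> (0:R)] --> p.
    exact: (cvg_comp _ _ (@cvg_const_mx R 0) (@cvg_line R 2 p i)).
  have E : (fun s : R => line p i (const_mx s)) = (fun s => p + s *: 'e_i).
    by apply/funext => s; rewrite /line mxE.
  rewrite E in cv.
  have nz : \forall z \near p, f (P z) = 0 by apply: filterS Hg => z [].
  exact: (cv _ nz).
Qed.

Lemma curve_smooth f p c : regular_param f p c ->
  forall j, smooth (const_mx 0) (fun u => lift1 c u 0 j).
Proof. by move=> [/smooth_curve_lift1/smooth_rowP]. Qed.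

Lemma curve_near f p c (A : set 'rV[R]_2) : regular_param f p c ->
  (\forall z \near p, A z) -> \forall u \near (const_mx 0 : 'rV[R]_1), A (lift1 c u).
Proof.
move=> rc pA; have := cvg_smooth_row (curve_smooth rc).
by rewrite {2}/lift1 mxE; have [_ -> _ _] := rc; exact.
Qed.

Lemma curve_comp_smooth f p c h : regular_param f p c -> smooth p h ->
  smooth (const_mx 0) (fun u => h (lift1 c u)).
Proof.
move=> rc sh; apply: smooth_comp; first exact: curve_smooth rc.
by rewrite /lift1 mxE; case: rc => _ ->.
Qed.

Lemma curve_comp_der f p c h : regular_param f p c -> smooth p h ->
  \forall u \near (const_mx 0 : 'rV[R]_1),
    der 0 (fun u => h (lift1 c u)) u =
    der 0 (fun u => lift1 c u 0 0) u * der 0 h (lift1 c u) +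
    der 0 (fun u => lift1 c u 0 1) u * der 1 h (lift1 c u).
Proof.
move=> rc sh; have n1 := near_smooth_row (curve_smooth rc).
have n2 := curve_near rc (smooth_near sh).
apply: filterS2 n1 n2 => u su hu; rewrite (der_comp su)//; exact: sum2.
Qed.

Lemma curve_zero f p c : regular_param f p c ->
  \forall u \near (const_mx 0 : 'rV[R]_1), f (lift1 c u) = 0.
Proof. by move=> [_ _ _ cz]; exact: (@cvg_coord1 R 0 _ cz). Qed.

Lemma curve_velocity f p c : regular_param f p c ->
  der 0 (fun u => lift1 c u 0 0) (const_mx 0) != 0 \/
  der 0 (fun u => lift1 c u 0 1) (const_mx 0) != 0.
Proof.
move=> rc; apply/orP; rewrite -negb_and; have [_ _ + _] := rc.
apply: contra => /andP[/eqP c0 /eqP c1]; apply/eqP/rowP => j; rewrite mxE.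
have -> : derive1 c 0 = pd 0 (lift1 c) (const_mx 0) by rewrite pd_lift1 /lift1 mxE.
rewrite pd_row; last by apply/smooth_rowP; exact: curve_smooth rc.
by case: (ord2P j) => ->.
Qed.

Lemma regularE f p : regular_point f p <-> f p = 0 /\ exists i, der i f p != 0.
Proof. by split=> -[f0 [i hi]]; split=> //; exists i; rewrite ?derE// -derE. Qed.

End Curves.

(** * Contacts of the curves L = 0, H = 0, K = 0 when L = H^2 + 4 D K *)

Section PlaneFold.
Context {R : realType}.
Variables (L H K D : 'rV[R]_2 -> R) (p : 'rV[R]_2).
Hypotheses (sL : smooth p L) (sH : smooth p H) (sK : smooth p K) (sD : smooth p D).
Hypothesis D0 : 0 < D p.
Hypothesis LE : {near p, L =1 fun q => H q ^+ 2 + 4 * (D q * K q)}.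

Let DKsm : smooth p (fun q => D q * K q). Proof. exact: smoothM. Qed.

Let w q := (- 4 * D q)^-1.

Let w0 : - 4 * D p != 0. Proof. by rewrite mulf_neq0 ?oppr_eq0// gt_eqF. Qed.

Let sw : smooth p w.
Proof. by apply: smoothV w0 _; exact: smoothZ. Qed.

Lemma der_discriminant i : H p = 0 -> K p = 0 -> der i L p = 4 * D p * der i K p.
Proof.
move=> H0 K0; rewrite (near_eq_der i LE) derD; [|exact: smoothX|exact: smoothZ].
rewrite derZ// (derM i sD sK) K0 mulr0 add0r.
have -> : (fun q => H q ^+ 2) = (fun q => H q * H q).
  by apply/funext => q; rewrite expr2.
by rewrite (derM i sH sH) H0; ring.
Qed.

Let K0_of : L p = 0 -> H p = 0 -> K p = 0.
Proof.
move=> L0 H0; have := nbhs_singleton LE; rewrite L0 H0 expr0n add0r => /esym/eqP.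
by rewrite mulrA mulf_eq0 mulf_eq0 gt_eqF//= gt_eqF//= => /eqP.
Qed.

(** Along [L = 0] one has [H^2 = - 4 D K], whose derivatives of order 0, 1, 2 vanish; those of order
    0 and 2 give that [H] and its derivative along the curve are 0. Then dL and dH annihilate the
    same nonzero velocity, so they are dependent. *)
Lemma contact_gt2_tangent : contact_gt L K p 2 -> H p = 0 /\ jac 0 1 L H p = 0.
Proof.
move=> [/regularE[L0 rL] [c rc ck]].
have sc h : smooth p h -> smooth (const_mx 0) (fun u => h (lift1 c u)).
  exact: curve_comp_smooth rc.
have c0 : lift1 c (const_mx 0) = p by rewrite /lift1 mxE; case: rc.
have vk : vanish 0 (const_mx 0) 3 (fun u => K (lift1 c u)).
  by move=> j j3; have := ck j j3; rewrite derive1nE.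
have E : {near (const_mx 0 : 'rV[R]_1), (fun u => H (lift1 c u) * H (lift1 c u)) =1
    fun u => (- 4 * D (lift1 c u)) * K (lift1 c u)}.
  apply: filterS2 (curve_near rc LE) (curve_zero rc) => u /= ->.
  rewrite expr2 => /eqP; rewrite addr_eq0 => /eqP ->; ring.
have s4 : smooth p (fun q => - 4 * D q) by exact: smoothZ.
have v0 : vanish 0 (const_mx 0) 0 (fun u => - 4 * D (lift1 c u)) by [].
have [v3 _] := vanish_leading (add0n 3) (sc _ s4) (sc _ sK) v0 vk.
have vHH j : (j < 3)%N -> iter j (der 0) (fun u => H (lift1 c u) * H (lift1 c u)) (const_mx 0) = 0.
  by move=> j3; rewrite (near_eq_iter _ _ E); exact: v3.
have H0 : H p = 0.
  by have /eqP := vHH 0%N isT; rewrite /= c0 mulf_eq0 orbb => /eqP.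
have vH : vanish 0 (const_mx 0) 1 (fun u => H (lift1 c u)).
  by case=> // _ /=; rewrite c0.
have [_] := vanish_leading (erefl (1 + 1)%N) (sc _ sH) (sc _ sH) vH vH.
rewrite vHH// => /esym/eqP; rewrite mulf_eq0 pnatr_eq0 /= mulf_eq0 orbb => /eqP dH.
split=> //.
have /nbhs_singleton := curve_comp_der rc sH; rewrite c0 dH => EH.
have dL : der 0 (fun u => L (lift1 c u)) (const_mx 0) = 0.
  have nz : {near (const_mx 0 : 'rV[R]_1), (fun u => L (lift1 c u)) =1 fun=> 0}.
    exact: (curve_zero rc).
  by rewrite (near_eq_der _ nz) der_cst.
have /nbhs_singleton := curve_comp_der rc sL; rewrite c0 dL => EL.
move: (curve_velocity rc) EH EL; rewrite /jac.
move: (der 0 (fun u => lift1 c u 0 0) _) (der 0 (fun u => lift1 c u 0 1) _) => a b V EH EL.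
case: V => v0'; apply: (mulfI v0'); rewrite mulr0.
  have -> : a * (der 0 L p * der 1 H p - der 1 L p * der 0 H p) =
    (a * der 0 L p) * der 1 H p - der 1 L p * (a * der 0 H p) by ring.
  have -> : a * der 0 L p = - (b * der 1 L p) by apply/eqP; rewrite -addr_eq0 -EL.
  have -> : a * der 0 H p = - (b * der 1 H p) by apply/eqP; rewrite -addr_eq0 -EH.
  ring.
have -> : b * (der 0 L p * der 1 H p - der 1 L p * der 0 H p) =
  der 0 L p * (b * der 1 H p) - (b * der 1 L p) * der 0 H p by ring.
have -> : b * der 1 L p = - (a * der 0 L p) by apply/eqP; rewrite -addr_eq0 addrC -EL.
have -> : b * der 1 H p = - (a * der 0 H p) by apply/eqP; rewrite -addr_eq0 addrC -EH.
ring.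
Qed.

(* Along L = 0 with velocity c', one has L_1 (H o c)' = - c'_0 {L, H} and
   L_0 (H o c)' = c'_1 {L, H}; differentiate once more. *)
Lemma contact2_fold : contact_eq L H p 2 -> (exists i, der i H p != 0) ->
  jac 0 1 (jac 0 1 L H) H p != 0.
Proof.
move=> [/regularE[L0 rL] [c rc [ck ck2]]] rH; apply: contra ck2 => /eqP W0.
rewrite derive1nE lift1_comp.
have sc h : smooth p h -> smooth (const_mx 0) (fun u => h (lift1 c u)).
  exact: curve_comp_smooth rc.
have c0 : lift1 c (const_mx 0) = p by rewrite /lift1 mxE; case: rc.
pose B := jac 0 1 L H; have sB : smooth p B by exact: smooth_jac.
pose eta u := H (lift1 c u); pose lam u := L (lift1 c u).
pose x0 : 'rV[R]_1 -> R := fun u => lift1 c u 0 0.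
pose x1 : 'rV[R]_1 -> R := fun u => lift1 c u 0 1.
have sx0 := curve_smooth rc 0; have sx1 := curve_smooth rc 1.
have eta1 : der 0 eta (const_mx 0) = 0.
  by have := ck 1%N isT; rewrite derive1nE.
have lam1 : \forall u \near (const_mx 0 : 'rV[R]_1), der 0 lam u = 0.
  have := near_join (curve_zero rc); apply: filterS => u uz.
  have nz : {near u, lam =1 fun=> 0} by exact: uz.
  by rewrite (near_eq_der _ nz) der_cst.
have e0 : {near (const_mx 0 : 'rV[R]_1), (fun u => der 0 L (lift1 c u) * der 0 eta u)
    =1 fun u => der 0 x1 u * B (lift1 c u)}.
  apply: filterS3 lam1 (curve_comp_der rc sL) (curve_comp_der rc sH) => u u0.
  rewrite -/lam -/eta -/x0 -/x1 u0 => /esym/eqP.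
  rewrite addr_eq0 => /eqP E ->; rewrite mulrDr.
  rewrite (_ : der 0 L (lift1 c u) * (der 0 x0 u * der 0 H (lift1 c u)) =
    der 0 x0 u * der 0 L (lift1 c u) * der 0 H (lift1 c u)); last by ring.
  by rewrite E /B /jac; ring.
have e1 : {near (const_mx 0 : 'rV[R]_1), (fun u => der 1 L (lift1 c u) * der 0 eta u)
    =1 fun u => - der 0 x0 u * B (lift1 c u)}.
  apply: filterS3 lam1 (curve_comp_der rc sL) (curve_comp_der rc sH) => u u0.
  rewrite -/lam -/eta -/x0 -/x1 u0 => /esym/eqP.
  rewrite addrC addr_eq0 => /eqP E ->; rewrite mulrDr.
  rewrite (_ : der 1 L (lift1 c u) * (der 0 x1 u * der 1 H (lift1 c u)) =
    der 0 x1 u * der 1 L (lift1 c u) * der 1 H (lift1 c u)); last by ring.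
  by rewrite E /B /jac; ring.
have B0 : B p = 0.
  have := nbhs_singleton e0; have := nbhs_singleton e1.
  rewrite eta1 !mulr0 c0 => /esym/eqP + /esym/eqP; rewrite !mulf_eq0 oppr_eq0.
  case: (curve_velocity rc) => /negPf v0.
    by rewrite -/x0 v0 /= => /eqP.
  by rewrite -/x1 v0 /= => _ /eqP.
(* [W = 0] makes dB a multiple of dH, which is nonzero and annihilates the velocity. *)
have dB : der 0 (fun u => B (lift1 c u)) (const_mx 0) = 0.
  have /nbhs_singleton := curve_comp_der rc sB; rewrite c0 => ->.
  have /nbhs_singleton := curve_comp_der rc sH; rewrite c0 -/eta eta1.
  rewrite -/x0 -/x1; move: W0; rewrite -/B {1}/jac.
  move: (der 0 x0 _) (der 0 x1 _) (der 0 B p) (der 1 B p) => a b B0' B1 W0 EH.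
  case: rH => j; case: (ord2P j) => -> h0; apply: (mulfI h0); rewrite mulr0.
    have -> : der 0 H p * (a * B0' + b * B1) = B0' * (a * der 0 H p + b * der 1 H p)
      - b * (B0' * der 1 H p - B1 * der 0 H p) by ring.
    by rewrite W0 -EH !mulr0 subr0.
  have -> : der 1 H p * (a * B0' + b * B1) = B1 * (a * der 0 H p + b * der 1 H p)
      + a * (B0' * der 1 H p - B1 * der 0 H p) by ring.
  by rewrite W0 -EH !mulr0 addr0.
have seta := smooth_der 0 (sc _ sH).
have fin i : der i L p * der 0 (der 0 eta) (const_mx 0) = 0.
  have sLi := sc _ (smooth_der i sL).
  have := derM 0 sLi seta; rewrite -/eta eta1 mulr0 add0r c0 => <-.
  case: (ord2P i) => ->.
    rewrite (near_eq_der _ e0) (derM _ (smooth_der _ sx1) (sc _ sB)).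
    by rewrite c0 B0 dB !mulr0 addr0.
  rewrite (near_eq_der _ e1) (derM _ (smoothN (smooth_der _ sx0)) (sc _ sB)).
  by rewrite c0 B0 dB !mulr0 addr0.
by case: rL => i hi; apply/eqP; apply: (mulfI hi); rewrite mulr0; exact: fin.
Qed.

(* On L = 0 one has K = - H^2 / (4 D), so K vanishes twice as much as H. *)
Lemma vanish_K i k g m : displacement L p k g ->
  vanish i p m (fun z => H (z + g z *: 'e_k)) ->
  vanish i p (m + m) (fun z => K (z + g z *: 'e_k)) /\
  (iter m (der i) (fun z => H (z + g z *: 'e_k)) p != 0 ->
   iter (m + m) (der i) (fun z => K (z + g z *: 'e_k)) p != 0).
Proof.
move=> dg vH; have sHP := smooth_comp_proj dg sH.
have swP := smooth_comp_proj dg sw.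
have [vHH eHH] := vanish_leading (erefl (m + m)%N) sHP sHP vH vH.
have v0 : vanish i p 0 (fun z => w (z + g z *: 'e_k)) by [].
have [vK eK] := vanish_leading (addn0 (m + m)%N) (smoothM sHP sHP) swP vHH v0.
have E : {near p, (fun z => K (z + g z *: 'e_k)) =1
  fun z => H (z + g z *: 'e_k) * H (z + g z *: 'e_k) * w (z + g z *: 'e_k)}.
  have [_ _ nL] := dg.
  have nE := cvg_proj dg LE.
  have nw := cvg_proj dg (smooth_near_neq0 (smoothZ (-4) sD) w0).
  apply: filterS3 nL nE nw => z [Lz _ _ _] /= E; rewrite Lz in E.
  rewrite /w => nz; apply: (mulIf nz); rewrite divfK//.
  move/esym/eqP: E; rewrite expr2 addr_eq0 => /eqP ->; ring.
split; first by move=> j jm; rewrite (near_eq_iter _ _ E) vK.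
move=> hm; rewrite (near_eq_iter _ _ E) eK eHH binn mul1r /=.
rewrite mulf_neq0//; last by rewrite /w (proj_center dg) invr_eq0.
rewrite !mulf_neq0// pnatr_eq0 -lt0n bin_gt0; exact: leq_addr.
Qed.

Section Regular_discriminant.
Hypotheses (L0 : L p = 0) (rL : exists i, der i L p != 0) (H0 : H p = 0).

Let K0 : K p = 0. Proof. exact: K0_of. Qed.

Let regL : regular_point L p. Proof. exact/regularE. Qed.

Lemma regular_K : regular_point K p.
Proof.
apply/regularE; split; first exact: K0.
by case: rL => i; rewrite der_discriminant// mulf_eq0 negb_or => /andP[_ hi]; exists i.
Qed.

Lemma tangency_of_crossing : jac 0 1 L H p != 0 ->
  transversal_at L H p /\ ordinary_tangency L K p.
Proof.
move=> J; split; first by split=> //; move: J; rewrite /jac !derE.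
split; first exact: regular_K.
case: rL => k hk; have [i ik _] := other2 k.
have [g dg _] := implicit_displacement sL L0 hk.
have [c [rc ck]] := proj_param ik dg.
have vH : vanish i p 1 (fun z => H (z + g z *: 'e_k)).
  by case=> // _; rewrite /= -[z in H z]/(_ + _) (proj_center dg).
have [vK eK] := vanish_K dg vH.
split=> //; exists c => //; split=> [j j2|]; rewrite ck//; first exact: vK.
apply: eK; rewrite /= (der_proj_center dg)// mulf_neq0 ?invr_eq0//.
by case: (jac2 H L p ik) => ->; rewrite ?oppr_eq0 jac_antisym oppr_eq0.
Qed.

Section Tangent.
Hypothesis J0 : jac 0 1 L H p = 0.

Let J0' i k : i != k -> jac i k H L p = 0.
Proof. by move=> ik; case: (jac2 H L p ik) => ->; rewrite jac_antisym J0 !oppr0. Qed.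

Lemma contact_gt2_of_tangent : contact_gt L K p 2.
Proof.
case: rL => k hk; have [i ik _] := other2 k.
have [g dg _] := implicit_displacement sL L0 hk.
have [c [rc ck]] := proj_param ik dg.
have vH : vanish i p 2 (fun z => H (z + g z *: 'e_k)).
  case=> [_|[_|//]] /=; first by rewrite (proj_center dg).
  by rewrite (der_proj_center dg)// J0'// mul0r.
have [vK _] := vanish_K dg vH.
by split=> //; exists c => // j j2; rewrite ck// vK// ltnS (leq_trans j2).
Qed.

Hypothesis W0 : jac 0 1 (jac 0 1 L H) H p != 0.

Lemma regular_H_of_fold : exists i, der i H p != 0.
Proof.
case: (eqVneq (der 0 H p) 0) => [h0|]; last by exists 0.
case: (eqVneq (der 1 H p) 0) => [h1|]; last by exists 1.
by move: W0; rewrite /jac h0 h1 !mulr0 subrr eqxx.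
Qed.

(** With [J0], dL and dH are proportional at [p], so {L, H} has nonzero derivative along one curve
    exactly when it has along the other. This turns the nondegenerate extremum of [L] on [H = 0]
    into a contact of order two of [H] along [L = 0]. *)
Lemma fold_exchange : jac 0 1 (jac 0 1 H L) L p != 0.
Proof.
have -> : jac 0 1 (jac 0 1 H L) L p = - jac 0 1 (jac 0 1 L H) L p.
  rewrite -(jacN 0 1 L (smooth_jac 0 1 sL sH)); apply: near_eq_jac.
  by near=> z; rewrite jac_antisym.
rewrite oppr_eq0; apply: contra W0 => /eqP.
have jE f g : jac 0 1 f g p = der 0 f p * der 1 g p - der 1 f p * der 0 g p by [].
move: J0; rewrite (jE L H) (jE (jac 0 1 L H) L) (jE (jac 0 1 L H) H) => J.
move: (der 0 (jac 0 1 L H) p) (der 1 (jac 0 1 L H) p) => b0 b1 E; apply/eqP.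
case: rL => j; case: (ord2P j) => -> h0; apply: (mulfI h0); rewrite mulr0.
  have -> : der 0 L p * (b0 * der 1 H p - b1 * der 0 H p) =
    b0 * (der 0 L p * der 1 H p - der 1 L p * der 0 H p) +
    (b0 * der 1 L p - b1 * der 0 L p) * der 0 H p by ring.
  by rewrite J E mulr0 mul0r addr0.
have -> : der 1 L p * (b0 * der 1 H p - b1 * der 0 H p) =
    b1 * (der 0 L p * der 1 H p - der 1 L p * der 0 H p) +
    (b0 * der 1 L p - b1 * der 0 L p) * der 1 H p by ring.
by rewrite J E mulr0 mul0r addr0.
Unshelve. all: by end_near. Qed.

Lemma contacts_of_fold : contact_eq L K p 4 /\ contact_eq L H p 2.
Proof.
case: rL => k hk; have [i ik _] := other2 k.
have [g dg _] := implicit_displacement sL L0 hk.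
have [c [rc ck]] := proj_param ik dg.
have vH : vanish i p 2 (fun z => H (z + g z *: 'e_k)).
  case=> [_|[_|//]] /=; first by rewrite (proj_center dg).
  by rewrite (der_proj_center dg)// J0'// mul0r.
have H2 : iter 2 (der i) (fun z => H (z + g z *: 'e_k)) p != 0.
  rewrite /= (der2_proj dg)// ?J0'// mulf_neq0 ?invr_eq0 ?expf_neq0//.
  by rewrite jac_jac2// fold_exchange.
have [vK eK] := vanish_K dg vH.
split; split=> //; exists c => //; split=> [j jm|]; rewrite ck//.
- exact: vK.
- exact: eK.
- exact: vH.
Qed.

End Tangent.
End Regular_discriminant.

End PlaneFold.

(** * Relative positions *)

Lemma second_derivative_pos {R : realType} {n : nat} (F : 'rV[R]_n -> R) p i :
  smooth p F -> F p = 0 -> der i F p = 0 -> 0 < der i (der i F) p ->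
  exists2 r, 0 < r & forall s, s != 0 -> `|s| < r -> 0 < F (p + s *: 'e_i).
Proof.
move=> sF F0 dF0 ddF.
have /nbhs_ballP[r r0 Hr] : \forall z \near p, smooth z F /\ 0 < der i (der i F) z.
  apply: filterI (smooth_near sF) _.
  exact: smooth_near_gt0 (smooth_der i (smooth_der i sF)) ddF.
exists r => // s s0 sr.
have B t : `|t| <= `|s| -> ball p r (p + t *: 'e_i).
  move=> ts; rewrite -ball_normE /= opprD addrA subrr add0r normrN.
  by rewrite (le_lt_trans (norm_scale_delta _ _))// (le_lt_trans ts).
have [|th th01 E] := @line_mvt _ _ F p 'e_i s.
  by move=> t /B/Hr[sFt _]; exact: smooth_derivable.
have hth := norm_frac_le th01 s.
have [|th' th'01 E'] := @line_mvt _ _ (der i F) p 'e_i (th * s).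
  move=> t ht; have [sFt _] := Hr _ (B _ (le_trans ht hth)).
  exact: smooth_derivable (smooth_der i sFt).
have hth' := norm_frac_le th'01 (th * s).
have [_ pos] := Hr _ (B _ (le_trans hth' hth)).
move: E E'; rewrite F0 dF0 !subr0 -/(pd i F _) -/(pd i (der i F) _) -!derE => -> ->.
rewrite (_ : s * (th * s * _) = th * (s ^+ 2 * der i (der i F) (p + (th' * (th * s)) *: 'e_i))); last by ring.
rewrite mulr_gt0//; first by case/andP: th01.
by rewrite mulr_gt0// lt_neqAle sqr_ge0 andbT eq_sym sqrf_eq0.
Qed.

(** Near [p], the points of [H = 0] are the projections of the points of the line through [p] along
    ['e_i]. On that line [F], which is [L] after projection with the sign of [W], has value and
    derivative 0 and positive second derivative at [p]. *)
Lemma fold_side {R : realType} (L H : 'rV[R]_2 -> R) p :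
  smooth p L -> smooth p H -> L p = 0 -> H p = 0 -> jac 0 1 L H p = 0 ->
  jac 0 1 (jac 0 1 L H) H p != 0 -> exists b, on_side b L H p.
Proof.
move=> sL sH L0 H0 J0 W0.
have [k hk] := regular_H_of_fold W0; have [i ik ikP] := other2 k.
have [g dg [r r0 gu]] := implicit_displacement sH H0 hk.
set W := jac 0 1 _ H p in W0; exists (W < 0); set b := (W < 0).
have Wpos : 0 < (-1) ^+ b * W.
  rewrite /b; case: (ltP W 0) => [Wn|]; first by rewrite expr1 mulN1r oppr_gt0.
  by rewrite le_eqVlt eq_sym (negPf W0) /= expr0 mul1r.
pose F z := (-1) ^+ b * L (z + g z *: 'e_k).
have sLP := smooth_comp_proj dg sL.
have J0' : jac i k L H p = 0 by case: (jac2 L H p ik) => ->; rewrite J0 ?oppr0.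
have [| | | |rho rho0 Fpos] := @second_derivative_pos _ _ F p i.
- exact: smoothZ.
- by rewrite /F (proj_center dg) L0 mulr0.
- by rewrite derZ// (der_proj_center dg)// J0' mul0r mulr0.
- rewrite (@near_eq_der _ _ _ (fun z => (-1) ^+ b * der i (fun z => L (z + g z *: 'e_k)) z)).
    rewrite derZ; last exact: smooth_der.
    rewrite (der2_proj dg)// jac_jac2// mulrA divr_gt0//.
    by rewrite lt_neqAle sqr_ge0 andbT eq_sym sqrf_eq0.
  by apply: (near_smooth sLP) => z sz; rewrite derZ.
(* [u0 u] is [u] with coordinate [k] reset to that of [p]. If [H u = 0], uniqueness of the implicit
   function recovers [u] as the projection of [u0 u]. *)
pose u0 (u : 'rV[R]_2) := u - (u 0 k - p 0 k) *: 'e_k.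
have u0p : u0 p = p by rewrite /u0 subrr scale0r subr0.
have su0 j : smooth p (fun u => u0 u 0 j).
  apply: (@smooth_eq _ _ _ (fun u => u 0 j - (u 0 k - p 0 k) * ('e_k : 'rV[R]_2) 0 j)).
    by move=> u; rewrite !mxE.
  apply: smoothB; first exact: smooth_coord.
  apply: smoothM; last exact: smooth_cst.
  by apply: smoothB; [exact: smooth_coord|exact: smooth_cst].
have cu0 : u0 u @[u --> p] --> p by rewrite -[X in _ --> X]u0p; exact: cvg_smooth_row.
have n1 : \forall u \near p, forall s, `|s| <= r ->
    H (u0 u + s *: 'e_k) = 0 -> g (u0 u) = s by exact: (cu0 _ gu).
have n2 : \forall u \near p, forall j, `|(u : 'rV[R]_2) 0 j - p 0 j| < Num.min r rho.
  have : nbhs p (ball p (Num.min r rho)) by apply: nbhsx_ballx; rewrite lt_min r0.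
  apply: filterS => u; rewrite -ball_normE /= distrC => hu j.
  by apply: le_lt_trans hu; have := le_row_norm (u - p) j; rewrite !mxE.
apply: filterS2 n1 n2 => u hu hn up /= Hu.
have uE : u0 u + (u 0 k - p 0 k) *: 'e_k = u by rewrite /u0 subrK.
have gE : g (u0 u) = u 0 k - p 0 k.
  apply: hu; last by rewrite uE.
  by have := hn k; rewrite lt_min => /andP[/ltW].
have u0E : u0 u = p + (u 0 i - p 0 i) *: 'e_i.
  apply/rowP => j; rewrite !mxE eqxx /=.
  case: (ikP j) => ->; first by rewrite (negPf ik) eqxx mulr0 mulr1 subr0 addrCA subrr addr0.
  by rewrite eqxx eq_sym (negPf ik) mulr1 mulr0 addr0 opprB addrCA subrr addr0.
have FE : F (u0 u) = (-1) ^+ b * L u by rewrite /F gE uE.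
rewrite -FE u0E; apply: Fpos; last by have := hn i; rewrite lt_min => /andP[].
apply: contra up => /eqP s0.
have := gE; rewrite u0E s0 scale0r addr0; have [_ -> _] := dg => k0.
by rewrite -uE -k0 scale0r addr0 u0E s0 scale0r addr0.
Qed.

Section Configuration.
Context {R : realType}.
Variables (L H K D : 'rV[R]_2 -> R) (p : 'rV[R]_2).
Hypotheses (sL : smooth p L) (sH : smooth p H) (sD : smooth p D).
Hypothesis D0 : 0 < D p.
Hypothesis LE : {near p, L =1 fun q => H q ^+ 2 + 4 * (D q * K q)}.

(** On [K = 0], [L = H^2] is positive away from [p]. If [L < 0] on [H = 0], the sides are opposite.
    If [L > 0] there, the sides agree, and [K] separates: it is negative on [L = 0], where
    [4 D K = - H^2], and positive on [H = 0], where [4 D K = L]. *)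
Lemma relative_position : L p = 0 -> H p = 0 -> jac 0 1 L H p = 0 ->
  jac 0 1 (jac 0 1 L H) H p != 0 ->
  opposite_sides L K H p \/ same_side L K H p /\ between K L H p.
Proof.
move=> L0 H0 J0 W0; have [b side] := fold_side sL sH L0 H0 J0 W0.
have nz : \forall u \near p, u != p -> H u = 0 -> L u != 0.
  by apply: filterS side => u hu up /(hu up); apply: contraTneq => ->; rewrite mulr0 ltxx.
have LK : on_side false L K p.
  apply: filterS2 LE nz => u E hu up Ku; rewrite expr0 mul1r.
  have {}Ku : K u = 0 by [].
  rewrite E Ku !mulr0 addr0 lt_neqAle sqr_ge0 andbT eq_sym sqrf_eq0.
  by apply/eqP => Hu; have := hu up Hu; rewrite E Ku Hu !mulr0 addr0 expr0n eqxx.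
case: b side => side; [left|right]; first by exists false.
split; [by exists false|exists true; split].
- have nD := smooth_near_gt0 sD D0.
  apply: filterS3 LE nz nD => u E hu Du up Lu; rewrite expr1 mulN1r.
  have {}Lu : L u = 0 by [].
  have Hu : H u != 0 by apply/eqP => Hu; have := hu up Hu; rewrite Lu eqxx.
  have H2 : 0 < H u ^+ 2 by rewrite lt_neqAle sqr_ge0 andbT eq_sym sqrf_eq0.
  have : 0 < 4 * D u * - K u.
    by rewrite mulrN -mulrA -[X in - X](addKr (H u ^+ 2)) -E Lu addr0 opprK.
  by rewrite pmulr_rgt0// mulr_gt0.
- have nD := smooth_near_gt0 sD D0.
  apply: filterS3 LE side nD => u E hu Du up Hu; rewrite expr0 mul1r.
  have := hu up Hu; rewrite expr0 mul1r E (_ : H u = 0)// expr0n add0r mulrA.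
  by rewrite pmulr_rgt0// mulr_gt0.
Qed.

End Configuration.

(** The model is [F s t = s^2 - t]. For small [t > 0], [F] is negative at 0 and positive at [eta]
    and [- eta], which gives two zeros; a third one would give, by Rolle, two zeros of the
    increasing function [G]. For negative time, [F] exceeds its nonnegative value at time 0. *)
Lemma fold_family {R : realType} (F G : R -> R -> R) (rho : R) : 0 < rho ->
  (forall s t : R, `|s| < rho -> `|t| < rho -> is_derive s 1 (fun s => F s t) (G s t)) ->
  (forall s1 s2 t, `|s1| < rho -> `|s2| < rho -> `|t| < rho -> s1 < s2 -> G s1 t < G s2 t) ->
  F 0 0 = 0 -> G 0 0 = 0 ->
  (forall s t, `|s| < rho -> 0 < t < rho -> F s t < F s 0 < F s (- t)) ->
  (forall s, `|s| < rho -> F s t @[t --> (0 : R)] --> F s 0) ->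
  (forall eta, 0 < eta < rho -> exists2 tau, 0 < tau & forall t, 0 < t < tau ->
    exists s1 s2, [/\ - eta < s1 < 0, 0 < s2 < eta, F s1 t = 0 /\ G s1 t != 0,
      F s2 t = 0 /\ G s2 t != 0 &
      forall s, `|s| < rho -> F s t = 0 -> s = s1 \/ s = s2]) /\
  (forall s t, `|s| < rho -> 0 < t < rho -> F s (- t) != 0).
Proof.
move=> rho0 dF Gmono F00 G00 Ft Fc.
have mvt s1 s2 t : `|s1| < rho -> `|s2| < rho -> `|t| < rho -> s1 < s2 ->
    exists2 c, s1 < c < s2 & F s2 t - F s1 t = G c t * (s2 - s1).
  rewrite !ltr_norml => /andP[a1 a2] /andP[b1 b2] ht s12.
  have I s : s \in `[s1, s2] -> `|s| < rho.
    by rewrite in_itv /= ltr_norml => /andP[c1 c2]; rewrite (lt_le_trans a1)// (le_lt_trans c2).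
  have Io s : s \in `]s1, s2[ -> `|s| < rho by move=> /subset_itv_oo_cc; exact: I.
  have ht' : `|t| < rho by rewrite ltr_norml.
  have [|c cI E] := MVT s12 (fun s sI => dF s t (Io s sI) ht').
    apply: derivable_within_continuous => s /I sI.
    exact: (ex_derive (is_derive := dF s t sI ht')).
  by exists c.
have n0 : `|0 : R| < rho by rewrite normr0.
have rolle s1 s2 t : `|s1| < rho -> `|s2| < rho -> `|t| < rho -> s1 < s2 ->
    F s1 t = 0 -> F s2 t = 0 -> exists2 c, s1 < c < s2 & G c t = 0.
  move=> h1 h2 ht s12 f1 f2; have [c cI] := mvt _ _ _ h1 h2 ht s12.
  rewrite f1 f2 subrr => /esym/eqP; rewrite mulf_eq0 subr_eq0 (gt_eqF s12) orbF.
  by move=> /eqP; exists c.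
have inside s1 s2 c : `|s1| < rho -> `|s2| < rho -> s1 < c < s2 -> `|c| < rho.
  rewrite !ltr_norml => /andP[a1 a2] /andP[b1 b2] /andP[c1 c2].
  by rewrite (lt_trans a1)// (lt_trans c2).
have F0 s : `|s| < rho -> s != 0 -> 0 < F s 0.
  move=> hs; rewrite neq_lt => /orP[s0|s0].
    have [c cI] := mvt _ _ _ hs n0 n0 s0; rewrite F00 !sub0r.
    have hc := inside _ _ _ hs n0 cI; case/andP: cI => _ c0.
    have := Gmono _ _ _ hc n0 n0 c0; rewrite G00 => Gc E.
    by rewrite -[F s 0]opprK E mulrN opprK nmulr_rgt0.
  have [c cI] := mvt _ _ _ n0 hs n0 s0; rewrite F00 !subr0 => ->.
  have hc := inside _ _ _ n0 hs cI; case/andP: cI => c0 _.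
  by have := Gmono _ _ _ n0 hc n0 c0; rewrite G00 => Gc; rewrite mulr_gt0.
split; last first.
  move=> s t hs ht; have /andP[_ lt2] := Ft s t hs ht; rewrite gt_eqF//.
  apply: le_lt_trans lt2; have [->|s0] := eqVneq s 0; first by rewrite F00.
  exact/ltW/F0.
move=> eta /andP[eta0 etarho].
have he : `|eta| < rho by rewrite gtr0_norm.
have hme : `|- eta| < rho by rewrite normrN.
have near_pos s : `|s| < rho -> s != 0 -> \forall t \near (0:R), 0 < F s t.
  move=> hs s0; have /cvgrPdist_lt/(_ _ (F0 s hs s0)) := Fc s hs.
  by apply: filterS => t; rewrite ltr_norml => /andP[_]; rewrite ltrBlDl ltrDr.
have ne : eta != 0 by rewrite gt_eqF.
have nme : - eta != 0 by rewrite oppr_eq0.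
have /nbhs_ballP[tau tau0 Htau] : \forall t \near (0 : R), 0 < F eta t /\ 0 < F (- eta) t.
  exact: filterI (near_pos _ he ne) (near_pos _ hme nme).
exists (Num.min tau rho); first by rewrite lt_min tau0.
move=> t /andP[t0]; rewrite lt_min => /andP[ttau trho].
have ht : `|t| < rho by rewrite gtr0_norm.
have [Fe Fme] : 0 < F eta t /\ 0 < F (- eta) t.
  by apply: Htau; rewrite -ball_normE /= sub0r normrN gtr0_norm.
have Fneg : F 0 t < 0.
  by have /andP[+ _] := Ft 0 t n0 (introT andP (conj t0 trho)); rewrite F00.
have ctn a b : a <= b -> `|a| < rho -> `|b| < rho -> {within `[a, b], continuous (fun s => F s t)}.
  rewrite !ltr_norml => ab /andP[a1 a2] /andP[b1 b2].
  apply: derivable_within_continuous => s; rewrite in_itv /= => /andP[c1 c2].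
  have hs : `|s| < rho by rewrite ltr_norml (lt_le_trans a1)// (le_lt_trans c2).
  exact: (ex_derive (is_derive := dF s t hs ht)).
have [s1 s1I Fs1] : exists2 s1, - eta < s1 < 0 & F s1 t = 0.
  have le : - eta <= 0 by rewrite oppr_le0 ltW.
  have [|s sI Fs] := IVT (v := 0) le (ctn _ _ le hme n0).
    by rewrite ge_min le_max (ltW Fneg) (ltW Fme) orbT.
  exists s => //; move: sI; rewrite in_itv /= => /andP[c1 c2].
  rewrite !lt_neqAle c1 c2 !andbT; apply/andP; split.
    by apply: contraTneq Fme => ->; rewrite Fs ltxx.
  by apply: contraTneq Fneg => E; move: Fs; rewrite E => ->; rewrite ltxx.
have [s2 s2I Fs2] : exists2 s2, 0 < s2 < eta & F s2 t = 0.
  have le : 0 <= eta by rewrite ltW.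
  have [|s sI Fs] := IVT (v := 0) le (ctn _ _ le n0 he).
    by rewrite ge_min le_max (ltW Fneg) (ltW Fe) orbT.
  exists s => //; move: sI; rewrite in_itv /= => /andP[c1 c2].
  rewrite !lt_neqAle c1 c2 !andbT; apply/andP; split.
    by apply: contraTneq Fneg => E; move: Fs; rewrite -E => ->; rewrite ltxx.
  by apply: contraTneq Fe => <-; rewrite Fs ltxx.
have hs1 := inside _ _ _ hme n0 s1I; have hs2 := inside _ _ _ n0 he s2I.
have s12 : s1 < s2 by case/andP: s1I => _ /lt_trans; apply; case/andP: s2I.
have no_third a b c : `|a| < rho -> `|b| < rho -> `|c| < rho -> a < b -> b < c ->
    F a t = 0 -> F b t = 0 -> F c t = 0 -> False.
  move=> ha hb hc ab bc fa fb fc.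
  have [x xI Gx] := rolle _ _ _ ha hb ht ab fa fb.
  have [y yI Gy] := rolle _ _ _ hb hc ht bc fb fc.
  have hx := inside _ _ _ ha hb xI; have hy := inside _ _ _ hb hc yI.
  case/andP: xI => _ xb; case/andP: yI => yb _.
  by have := Gmono _ _ _ hx hy ht (lt_trans xb yb); rewrite Gx Gy ltxx.
(* The zero [d] of [G] lies strictly between the zeros of [F]; as [G] increases, it is nonzero at
   both. *)
have [d dI Gd] := rolle _ _ _ hs1 hs2 ht s12 Fs1 Fs2.
have hd := inside _ _ _ hs1 hs2 dI; case/andP: dI => d1 d2.
exists s1, s2; split=> //.
- by split=> //; have := Gmono _ _ _ hs1 hd ht d1; rewrite Gd => /ltr0_neq0.
- by split=> //; have := Gmono _ _ _ hd hs2 ht d2; rewrite Gd => /lt0r_neq0.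
move=> s hs Fs; case: (ltgtP s s1) => [l1| l1|->]; [|case: (ltgtP s s2) => [l2|l2|->]|].
- by case: (no_third s s1 s2).
- by case: (no_third s1 s s2).
- by case: (no_third s1 s2 s).
- by right.
- by left.
Qed.

(** * The fold bifurcation *)

Lemma signr_neg_ex {R : realType} (x : R) : x != 0 -> exists b : bool, (-1) ^+ b * x < 0.
Proof.
rewrite neq_lt => /orP[x0|x0]; [exists false|exists true].
  by rewrite expr0 mul1r.
by rewrite expr1 mulN1r oppr_lt0.
Qed.

Lemma norm_signr {R : realType} (b : bool) (x : R) : `|(-1) ^+ b * x| = `|x|.
Proof. by case: b; rewrite ?expr1 ?expr0 ?mulN1r ?mul1r ?normrN. Qed.

Section Bifurcation.
Context {R : realType} {n : nat}.
Variables (L H : 'rV[R]_n -> R) (p : 'rV[R]_n) (i k m : 'I_n).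
Hypotheses (ik : i != k) (mi : m != i) (mk : m != k).
Hypothesis ikm : forall j, [\/ j = i, j = k | j = m].
Hypotheses (sL : smooth p L) (sH : smooth p H) (L0 : L p = 0) (H0 : H p = 0).
Hypotheses (hk : der k H p != 0) (J0 : jac i k L H p = 0).
Hypotheses (W0 : jac i k (jac i k L H) H p != 0) (T0 : jac m k L H p != 0).

Let q (s t : R) : 'rV[R]_n := p + t *: 'e_m + s *: 'e_i.

Let q_close s t : `|q s t - p| <= `|s| + `|t|.
Proof.
rewrite /q [p + _]addrC addrAC addrK addrC (le_trans (ler_normD _ _))// addrC.
by rewrite addrC lerD// norm_scale_delta.
Qed.

Let qD s t x : q s t + x *: 'e_i = q (s + x) t.
Proof. by rewrite /q -addrA -scalerDl. Qed.

Let qDm s t x : q s t + x *: 'e_m = q s (t + x).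
Proof. by rewrite /q addrAC -(addrA p) -scalerDl. Qed.

Let q_cvg (sg s : R) : q s (sg * t) @[t --> (0 : R)] --> q s 0.
Proof.
apply: (@cvg_row R n _ (nbhs (0:R)) (nbhs_filter (0:R))) => j.
have E t : q s t 0 j = p 0 j + t * ('e_m : 'rV[R]_n) 0 j + s * ('e_i : 'rV[R]_n) 0 j.
  by rewrite !mxE.
have : p 0 j + (sg * t) * ('e_m : 'rV[R]_n) 0 j + s * ('e_i : 'rV[R]_n) 0 j @[t --> (0 : R)] -->
  p 0 j + (sg * 0) * ('e_m : 'rV[R]_n) 0 j + s * ('e_i : 'rV[R]_n) 0 j.
  apply: cvgD; last exact: cvg_cst.
  apply: cvgD; first exact: cvg_cst.
  apply: cvgM; last exact: cvg_cst.
  by apply: cvgM; [exact: cvg_cst|exact: cvg_id].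
rewrite mulr0 -E (_ : (fun t => _) = (fun t => q s (sg * t) 0 j))//.
by apply/funext => t; rewrite E.
Qed.

(* Project along ['e_k] onto [H = 0]: at fixed [z 0 m], the function [L] becomes a
   strictly convex (or concave) function of [z 0 i], and it is strictly monotone
   in [z 0 m]. *)
Lemma fold_bifurcation : exists (b : bool) (rho : R), [/\ 0 < rho,
  (forall eps, 0 < eps -> exists2 tau, 0 < tau & forall t, 0 < t < tau ->
    exists z1 z2, [/\ z1 != z2,
      forall z, z = z1 \/ z = z2 -> [/\ `|z - p| < eps,
        z 0 m = p 0 m + (-1) ^+ b * t, L z = 0, H z = 0 & jac i k L H z != 0] &
      forall z, `|z - p| < rho -> z 0 m = p 0 m + (-1) ^+ b * t ->
        L z = 0 -> H z = 0 -> z = z1 \/ z = z2]) &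
  forall t z, 0 < t < rho -> `|z - p| < rho -> z 0 m = p 0 m - (-1) ^+ b * t ->
    L z = 0 -> H z = 0 -> False].
Proof.
have [g dg [r r0 gu]] := implicit_displacement sH H0 hk.
have sLP := smooth_comp_proj dg sL.
(* [a] is the sign of [W]; it makes [F] convex along ['e_i]. *)
have [a0 Wa] := signr_neg_ex W0; set a := (-1) ^+ (~~ a0) : R.
have {}Wa : 0 < a * jac i k (jac i k L H) H p.
  by rewrite /a signrN mulNr oppr_gt0.
have a_neq0 : a != 0 by rewrite /a signr_eq0.
pose F z := a * L (z + g z *: 'e_k).
have sF : smooth p F by exact: smoothZ.
have dF j : \forall z \near p, der j F z = a * der j (fun z => L (z + g z *: 'e_k)) z.
  by apply: (near_smooth sLP) => z sz; rewrite derZ.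
have ddF : 0 < der i (der i F) p.
  rewrite (near_eq_der i (dF i)) derZ; last exact: smooth_der.
  rewrite (der2_proj dg)// mulrA divr_gt0//.
  by rewrite lt_neqAle sqr_ge0 andbT eq_sym sqrf_eq0.
have dmF : der m F p != 0.
  by rewrite (nbhs_singleton (dF m)) (der_proj_center dg)// !mulf_neq0// invr_eq0.
(* [sg] is the direction of time in which [F] decreases, the one where the two zeros appear. *)
have [b bm] := signr_neg_ex dmF; set sg := (-1) ^+ b : R in bm.
have nsg (t : R) : `|sg * t| = `|t| by exact: norm_signr.
have [sg0 g0 Hg] := dg.
have /nbhs_ballP[e e0' He] : \forall z \near p,
   [/\ smooth z F, 0 < der i (der i F) z, sg * der m F z < 0,
     der i F z = a * (jac i k L H (z + g z *: 'e_k) / der k H (z + g z *: 'e_k)) &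
     H (z + g z *: 'e_k) = 0 /\ forall s, `|s| <= r -> H (z + s *: 'e_k) = 0 -> g z = s].
  have n1 := smooth_near sF.
  have n2 := smooth_near_gt0 (smooth_der i (smooth_der i sF)) ddF.
  have bm' : 0 < - (sg * der m F p) by rewrite oppr_gt0.
  have n3 := smooth_near_gt0 (smoothN (smoothZ sg (smooth_der m sF))) bm'.
  have n12 : \forall z \near p, smooth z F /\ 0 < der i (der i F) z by exact: filterI n1 n2.
  have n4 : \forall z \near p, der i F z = a * (jac i k L H (z + g z *: 'e_k) / der k H (z + g z *: 'e_k)).
    by apply: filterS2 (dF i) (der_proj dg i sL) => z -> ->.
  have n5 : \forall z \near p, H (z + g z *: 'e_k) = 0 /\
      forall s, `|s| <= r -> H (z + s *: 'e_k) = 0 -> g z = s.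
    by apply: filterS2 Hg gu => z [].
  have n45 : \forall z \near p, der i F z = a * (jac i k L H (z + g z *: 'e_k) / der k H (z + g z *: 'e_k)) /\
    (H (z + g z *: 'e_k) = 0 /\ forall s, `|s| <= r -> H (z + s *: 'e_k) = 0 -> g z = s).
    exact: filterI n4 n5.
  apply: filterS3 n12 n3 n45 => z [h1 h2] h3 [h4 h5].
  by split=> //; rewrite -oppr_gt0.
have e0 : 0 < e := e0'.
(* The bounds [3 rho] in [s] and [2 rho] in [t] of [qB] add up to [5 rho <= e]; [rho <= r] puts the
   displacements along ['e_k] in the range where the root is unique. *)
pose rho := Num.min (e / 5%:R) r.
have rho0 : 0 < rho by rewrite lt_min r0 divr_gt0.
have rhoe : rho * 5%:R <= e.
  by rewrite -ler_pdivlMr// ge_min lexx.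
have rhor : rho <= r by rewrite ge_min lexx orbT.
have qB s t : `|s| <= rho *+ 3 -> `|t| < rho *+ 2 -> ball p e (q s t).
  move=> hs ht; rewrite -ball_normE /= distrC (le_lt_trans (q_close s t))//.
  apply: lt_le_trans (ler_ltD hs ht) _; apply: le_trans rhoe.
  by rewrite -mulrnDr mulr_natr.
have lt3 (s : R) : `|s| < rho -> `|s| <= rho *+ 3.
  move=> /ltW hs; rewrite (le_trans hs)//.
  by rewrite mulrS lerDl mulrn_wge0// ltW.
have lt2 (s : R) : `|s| < rho -> `|s| < rho *+ 2.
  by move=> hs; rewrite (lt_le_trans hs)// mulr2n lerDl ltW.
have qB' s t : `|s| < rho -> `|t| < rho -> ball p e (q s t).
  by move=> /lt3 hs /lt2; exact: qB.
have hmon s1 s2 t : `|s1| < rho -> `|s2| < rho -> `|t| < rho -> s1 < s2 ->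
    der i F (q s1 t) < der i F (q s2 t).
  move=> h1 h2 ht s12.
  have B x : `|x| <= `|s2 - s1| -> ball p e (q s1 t + x *: 'e_i).
    move=> hx; rewrite qD; apply: qB; last exact: lt2.
    rewrite (le_trans (ler_normD _ _))// mulrS lerD ?(ltW h1)//.
    by rewrite (le_trans hx)// (le_trans (ler_normB _ _))// mulr2n lerD// ltW.
  have [|th th01 E] := @line_mvt _ _ (der i F) (q s1 t) 'e_i (s2 - s1).
    by move=> x /B/He[sx _ _ _ _]; apply: smooth_derivable; exact: smooth_der.
  have [_ pos _ _ _] := He _ (B _ (norm_frac_le th01 _)).
  move: E; rewrite qD [s1 + _]addrC subrK -/(pd i (der i F) _) -derE => E.
  by rewrite -subr_gt0 E mulr_gt0// subr_gt0.
have ht s x : `|s| < rho -> `|x| < rho -> exists2 c, 0 < c &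
    F (q s (sg * x)) - F (q s 0) = - (x * c).
  move=> hs hx.
  have B y : `|y| <= `|sg * x| -> ball p e (q s 0 + y *: 'e_m).
    by rewrite nsg => hy; rewrite qDm add0r; apply: qB'; rewrite ?(le_lt_trans hy).
  have [|th th01 E] := @line_mvt _ _ F (q s 0) 'e_m (sg * x).
    by move=> y /B/He[sx _ _ _ _]; exact: smooth_derivable.
  have [_ _ neg _ _] := He _ (B _ (norm_frac_le th01 _)).
  move: E neg; rewrite !qDm !add0r -/(pd m F _) -derE => -> neg.
  exists (- (sg * der m F (q s (th * (sg * x))))); first by rewrite oppr_gt0.
  by rewrite -mulrA mulrCA mulrN opprK.
pose Phi s t := F (q s (sg * t)); pose G s t := der i F (q s (sg * t)).
have q00 : q 0 (sg * 0) = p by rewrite /q mulr0 !scale0r !addr0.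
have [||||||bif nobif] := @fold_family R Phi G rho rho0.
- move=> s t hs ht'; rewrite /Phi /G derE; apply: is_derive_line.
  by apply: smooth_derivable; have [] := He _ (qB' s (sg * t) hs _); rewrite ?nsg.
- by move=> s1 s2 t h1 h2 ht' s12; apply: hmon; rewrite ?nsg.
- by rewrite /Phi q00 /F (proj_center dg) L0 mulr0.
- by rewrite /G q00 (nbhs_singleton (dF i)) (der_proj_center dg)// J0 mul0r mulr0.
- move=> s t hs /andP[t0 trho].
  have h1 : `|t| < rho by rewrite gtr0_norm.
  have [c c0 E] := ht s t hs h1; have h2 : `|- t| < rho by rewrite normrN.
  have [c' c0' E'] := ht s (- t) hs h2; rewrite /Phi mulr0; apply/andP; split.
    by rewrite -subr_lt0 E oppr_lt0 mulr_gt0.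
  by rewrite -subr_gt0 E' mulNr opprK mulr_gt0.
- move=> s hs; rewrite /Phi mulr0.
  have n0 : `|0 : R| < rho by rewrite normr0.
  have [sq _ _ _ _] := He _ (qB' s 0 hs n0).
  exact: (cvg_comp _ _ (@q_cvg sg s) (smooth_cvg sq)).
pose P z := z + g z *: 'e_k.
have P_m s t : P (q s t) 0 m = p 0 m + t.
  rewrite /P /q !mxE !eqxx /= (negPf mi) (negPf mk) mulr1 !mulr0 !addr0//.
have im : i != m by rewrite eq_sym.
have km : k != m by rewrite eq_sym.
have ki : k != i by rewrite eq_sym.
have P_i s t : P (q s t) 0 i = p 0 i + s.
  by rewrite /P /q !mxE !eqxx /= (negPf im) (negPf ik) mulr1 !mulr0 !addr0.
(* Every point of [H = 0] near [p] is the projection of the point of the plane spanned by ['e_i] and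
   ['e_m] with the same coordinates [i] and [m]. *)
have inv z t : `|z - p| < rho -> `|t| < rho -> z 0 m = p 0 m + sg * t -> H z = 0 ->
    `|z 0 i - p 0 i| < rho /\ P (q (z 0 i - p 0 i) (sg * t)) = z.
  move=> hz htr zm Hz.
  have hj j : `|z 0 j - p 0 j| < rho.
    by apply: le_lt_trans hz; have := le_row_norm (z - p) j; rewrite !mxE.
  have zE : q (z 0 i - p 0 i) (sg * t) + (z 0 k - p 0 k) *: 'e_k = z.
    apply/rowP => j; rewrite /q !mxE eqxx /=.
    case: (ikm j) => ->.
    - by rewrite eqxx (negPf im) (negPf ik) mulr1 !mulr0 !addr0 addrCA subrr addr0.
    - by rewrite eqxx (negPf km) (negPf ki) mulr1 !mulr0 !addr0 addrCA subrr addr0.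
    - by rewrite eqxx (negPf mi) (negPf mk) mulr1 !mulr0 !addr0 zm.
  split=> //; have [|_ _ _ _ [_ gu']] := He (q (z 0 i - p 0 i) (sg * t)).
    by apply: qB'; rewrite ?nsg.
  by rewrite /P (gu' (z 0 k - p 0 k)) ?zE// ltW// (lt_le_trans (hj k)).
exists b, rho; split=> //; last first.
  move=> t z /andP[t0 trho] hz zm Lz Hz.
  have htr : `|- t| < rho by rewrite normrN gtr0_norm.
  have [|hs PE] := inv z (- t) hz htr _ Hz; first by rewrite mulrN.
  have := nobif _ t hs (introT andP (conj t0 trho)).
  by rewrite /Phi /F -/(P _) PE Lz mulr0 eqxx.
move=> eps eps0.
have : \forall z \near p, `|p - P z| < eps by have /cvgrPdist_lt := cvg_proj dg; apply.
move=> /nbhs_ballP[e1 e10' Pe1]; have e10 : 0 < e1 := e10'.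
(* With [s] and [t] both below [eta], [q s (sg * t)] is within [e1] of [p], so that its projection
   is within [eps]. *)
pose eta := Num.min (e1 / 2) (rho / 2).
have eta0 : 0 < eta by rewrite lt_min !divr_gt0.
have etarho : eta < rho by rewrite gt_min; apply/orP; right; lra.
have etae1 : eta + eta <= e1.
  have : eta <= e1 / 2 by rewrite ge_min lexx.
  lra.
have [tau tau0 Htau] := bif eta (introT andP (conj eta0 etarho)).
exists (Num.min tau eta); first by rewrite lt_min tau0.
move=> t /andP[t0]; rewrite lt_min => /andP[ttau teta].
have htr : `|t| < rho by rewrite gtr0_norm// (lt_trans teta).
have [s1 [s2 [/andP[s1a s1b] /andP[s2a s2b] [F1 G1] [F2 G2] uniq]]] := Htau t (introT andP (conj t0 ttau)).
have good s : `|s| < eta -> Phi s t = 0 -> G s t != 0 ->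
    [/\ `|P (q s (sg * t)) - p| < eps, P (q s (sg * t)) 0 m = p 0 m + sg * t,
        L (P (q s (sg * t))) = 0, H (P (q s (sg * t))) = 0 &
        jac i k L H (P (q s (sg * t))) != 0].
  move=> hs Fs Gs.
  have [|_ _ _ GE [HE _]] := He (q s (sg * t)).
    by apply: qB'; rewrite ?nsg// (lt_trans hs).
  split=> //.
  - rewrite distrC; apply: Pe1; rewrite -ball_normE /= distrC.
    rewrite (le_lt_trans (q_close _ _))// nsg; apply: lt_le_trans etae1.
    by rewrite ltrD// gtr0_norm.
  - by move/eqP: Fs; rewrite /Phi /F mulf_eq0 (negPf a_neq0) /= => /eqP.
  - by move: Gs; rewrite /G GE; apply: contra => /eqP; rewrite -/(P _) => ->; rewrite mul0r mulr0.
exists (P (q s1 (sg * t))), (P (q s2 (sg * t))); split.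
- apply/eqP => E; have := P_i s1 (sg * t); rewrite E P_i => /addrI s12.
  by have := lt_trans s1b s2a; rewrite s12 ltxx.
- move=> z [] ->; apply: good => //; rewrite ltr_norml.
    by rewrite s1a (lt_trans s1b).
  by rewrite s2b andbT (lt_trans _ s2a)// oppr_lt0.
- move=> z hz zm Lz Hz; have [hs PE] := inv z t hz htr zm Hz.
  have Fz : Phi (z 0 i - p 0 i) t = 0 by rewrite /Phi /F -/(P _) PE Lz mulr0.
  by case: (uniq _ hs Fz) => <-; rewrite PE; [left|right].
Qed.

End Bifurcation.

(** * Invariants of surfaces *)

Section Forms.
Context {R : realType} {n : nat}.
Variables (a b : 'I_n) (Y : 'I_3 -> 'rV[R]_n -> R).

(* The forms of the surface traced by [Y] in the directions [a] and [b]; a third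
   direction, when there is one, is the time of a deformation. *)
Definition met (c d : 'I_n) : 'rV[R]_n -> R := fun u =>
  der c (Y 0) u * der d (Y 0) u + der c (Y 1) u * der d (Y 1) u
  - der c (Y 2) u * der d (Y 2) u.

Definition sff (c d : 'I_n) : 'rV[R]_n -> R := fun u =>
  (der a (Y 1) u * der b (Y 2) u - der a (Y 2) u * der b (Y 1) u) * der d (der c (Y 0)) u
  + (der a (Y 2) u * der b (Y 0) u - der a (Y 0) u * der b (Y 2) u) * der d (der c (Y 1)) u
  + (der a (Y 0) u * der b (Y 1) u - der a (Y 1) u * der b (Y 0) u) * der d (der c (Y 2)) u.

Definition fH : 'rV[R]_n -> R := fun u =>
  sff a a u * met b b u - 2 * (sff a b u * met a b u) + sff b b u * met a a u.

Definition fK : 'rV[R]_n -> R := fun u =>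
  sff a a u * sff b b u - sff a b u * sff a b u.

Definition fD : 'rV[R]_n -> R := fun u =>
  met a b u * met a b u - met a a u * met b b u.

(** Written through the discriminant identity; [invariantsE] checks that it agrees with [LPL]. *)
Definition fL : 'rV[R]_n -> R := fun u =>
  fH u * fH u + 4 * (fD u * fK u).

Variable p : 'rV[R]_n.
Hypothesis sY : forall j, smooth p (Y j).

Lemma smooth_met c d : smooth p (met c d).
Proof.
by apply: smoothB; [apply: smoothD|]; apply: smoothM; exact: smooth_der.
Qed.

Lemma smooth_sff c d : smooth p (sff c d).
Proof.
by apply: smoothD; [apply: smoothD|]; (apply: smoothM;
  [apply: smoothB; apply: smoothM; exact: smooth_der
  |apply: smooth_der; exact: smooth_der]).
Qed.

Lemma smooth_fH : smooth p fH.
Proof.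
have sM c d e f : smooth p (fun u => sff c d u * met e f u).
  by apply: smoothM; [exact: smooth_sff|exact: smooth_met].
apply: smoothD (sM _ _ _ _); apply: smoothB (sM _ _ _ _) _; exact: smoothZ.
Qed.

Lemma smooth_fK : smooth p fK.
Proof. by apply: smoothB; apply: smoothM; exact: smooth_sff. Qed.

Lemma smooth_fD : smooth p fD.
Proof. by apply: smoothB; apply: smoothM; exact: smooth_met. Qed.

Lemma smooth_fL : smooth p fL.
Proof.
apply: smoothD; first by apply: smoothM; exact: smooth_fH.
apply: smoothZ; apply: smoothM; [exact: smooth_fD|exact: smooth_fK].
Qed.

End Forms.

Definition coords {R : realType} {n : nat} (x : 'rV[R]_n -> 'rV[R]_3) (j : 'I_3) :=
  fun u => x u 0 j.

Section FormsOfSurface.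
Context {R : realType}.
Variables (x : 'rV[R]_2 -> 'rV[R]_3).

Lemma mcross_entries (u v : 'rV[R]_3) :
  (mcross u v 0 0 = u 0 1 * v 0 2 - u 0 2 * v 0 1) *
  (mcross u v 0 1 = u 0 2 * v 0 0 - u 0 0 * v 0 2) *
  (mcross u v 0 2 = - (u 0 0 * v 0 1 - u 0 1 * v 0 0)).
Proof. by rewrite /mcross !mxE. Qed.

Lemma mink_eq (A B : 'rV[R]_3) (f g : 'I_3 -> R) :
  (forall k, A 0 k = f k) -> (forall k, B 0 k = g k) ->
  mink A B = f 0 * g 0 + f 1 * g 1 - f 2 * g 2.
Proof. by move=> fE gE; rewrite /mink !fE !gE. Qed.

Lemma mink_cross_eq (A B C : 'rV[R]_3) (f g h : 'I_3 -> R) :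
  (forall k, A 0 k = f k) -> (forall k, B 0 k = g k) -> (forall k, C 0 k = h k) ->
  mink (mcross A B) C = (f 1 * g 2 - f 2 * g 1) * h 0 + (f 2 * g 0 - f 0 * g 2) * h 1
    + (f 0 * g 1 - f 1 * g 0) * h 2.
Proof. by move=> fE gE hE; rewrite /mink !mcross_entries !fE !gE !hE; ring. Qed.

Lemma metE u : smooth_at u x -> [/\ coefE x u = met (coords x) 0 0 u,
  coefF x u = met (coords x) 0 1 u & coefG x u = met (coords x) 1 1 u].
Proof.
move=> sx; have d1 i k : pd i x u 0 k = der i (coords x k) u by exact: pd_row.
split.
- exact: (mink_eq (d1 0) (d1 0)).
- exact: (mink_eq (d1 0) (d1 1)).
- exact: (mink_eq (d1 1) (d1 1)).
Qed.

Lemma sffE u : smooth_at u x -> [/\ lbar x u = sff 0 1 (coords x) 0 0 u,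
  mbar x u = sff 0 1 (coords x) 0 1 u & nbar x u = sff 0 1 (coords x) 1 1 u].
Proof.
move=> sx; have d1 i k : pd i x u 0 k = der i (coords x k) u by exact: pd_row.
have dd i j k : pd j (pd i x) u 0 k = der j (der i (coords x k)) u.
  have H : pds [:: j; i] x u 0 k = ders [:: j; i] (coords x k) u by exact: pds_row.
  exact: H.
split.
- exact: (mink_cross_eq (d1 0) (d1 1) (dd 0 0)).
- exact: (mink_cross_eq (d1 0) (d1 1) (dd 0 1)).
- exact: (mink_cross_eq (d1 0) (d1 1) (dd 1 1)).
Qed.

Lemma invariantsE u : smooth_at u x -> [/\ delta x u = fD 0 1 (coords x) u,
  PC x u = fK 0 1 (coords x) u, MCNC x u = fH 0 1 (coords x) u &
  LPL x u = fL 0 1 (coords x) u].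
Proof.
move=> sx; have [eE eF eG] := metE sx; have [el em en] := sffE sx.
split; rewrite /delta /PC /MCNC /LPL ?eE ?eF ?eG ?el ?em ?en /fL /fH /fD /fK; ring.
Qed.

Lemma near_invariantsE u : smooth_at u x -> [/\ {near u, delta x =1 fD 0 1 (coords x)},
  {near u, PC x =1 fK 0 1 (coords x)}, {near u, MCNC x =1 fH 0 1 (coords x)} &
  {near u, LPL x =1 fL 0 1 (coords x)}].
Proof.
by move=> /smooth_near_row sx; split; apply: filterS sx => v /invariantsE[].
Qed.

Lemma smooth_invariants u : smooth_at u x -> [/\ smooth u (delta x), smooth u (PC x),
  smooth u (MCNC x) & smooth u (LPL x)].
Proof.
move=> sx; have [eD eK eH eL] := near_invariantsE sx.
have sY : forall j, smooth u (coords x j) by exact/smooth_rowP.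
have sym (f g : 'rV[R]_2 -> R) : {near u, f =1 g} -> {near u, g =1 f}.
  by apply: filterS => v.
split.
- exact: smooth_ext (sym _ _ eD) (smooth_fD 0 1 sY).
- exact: smooth_ext (sym _ _ eK) (smooth_fK 0 1 sY).
- exact: smooth_ext (sym _ _ eH) (smooth_fH 0 1 sY).
- exact: smooth_ext (sym _ _ eL) (smooth_fL 0 1 sY).
Qed.

Lemma near_discriminant u : smooth_at u x ->
  {near u, LPL x =1 fun q => MCNC x q ^+ 2 + 4 * (delta x q * PC x q)}.
Proof.
move=> /smooth_near_row; apply: filterS => v /invariantsE[-> -> -> ->].
by rewrite expr2.
Qed.

End FormsOfSurface.

Section JacobianCalculus.
Context {R : realType}.
Implicit Types (f g : 'rV[R]_2 -> R) (p : 'rV[R]_2).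

Definition tangent_at f g p := [/\ f p = 0, g p = 0 & jac 0 1 f g p = 0].

(* When [f] has a critical point at [p] on the curve [g = 0], this is
   [(der k g p)^2] times the second derivative of [f] there, the curve being
   parametrized by the coordinate other than [k]. *)
Definition fold_at f g p := jac 0 1 (jac 0 1 f g) g p.

Lemma near_eq_tangent f f' g g' p : {near p, f =1 f'} -> {near p, g =1 g'} ->
  (tangent_at f g p -> tangent_at f' g' p) /\ fold_at f g p = fold_at f' g' p.
Proof.
move=> ff gg; split.
  move=> [f0 g0 j0]; split; rewrite -?(nbhs_singleton ff) -?(nbhs_singleton gg)//.
  by rewrite -j0 /jac !(near_eq_der _ ff) !(near_eq_der _ gg).
have nj : {near p, jac 0 1 f g =1 jac 0 1 f' g'}.
  by apply: filterS2 (near_join ff) (near_join gg) => z fz gz;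
    rewrite /jac !(near_eq_der _ fz) !(near_eq_der _ gz).
by rewrite /fold_at {1 3}/jac !(near_eq_der _ nj) !(near_eq_der _ gg).
Qed.

Lemma jacMM f g (al be : 'rV[R]_2 -> R) z :
  smooth z f -> smooth z g -> smooth z al -> smooth z be ->
  jac 0 1 (fun q => al q * f q) (fun q => be q * g q) z =
  al z * be z * jac 0 1 f g z + al z * g z * jac 0 1 f be z +
  f z * be z * jac 0 1 al g z + f z * g z * jac 0 1 al be z.
Proof. by move=> sf sg sa sb; rewrite /jac !derM//; ring. Qed.

Lemma jacDl f f' g z : smooth z f -> smooth z f' ->
  jac 0 1 (fun q => f q + f' q) g z = jac 0 1 f g z + jac 0 1 f' g z.
Proof. by move=> sf sf'; rewrite /jac !derD//; ring. Qed.

(** The Jacobian of the products is [c1 {f, g} + c2 g + c3 f] with [c1 = al be]. At a tangency the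
    last two terms have zero Jacobian with [be g], because [f], [g] and {f, g} vanish. *)
Lemma fold_scale f g (al be : 'rV[R]_2 -> R) p :
  smooth p f -> smooth p g -> smooth p al -> smooth p be -> tangent_at f g p ->
  tangent_at (fun q => al q * f q) (fun q => be q * g q) p /\
  fold_at (fun q => al q * f q) (fun q => be q * g q) p =
  al p * be p ^+ 2 * fold_at f g p.
Proof.
move=> sf sg sa sb [f0 g0 j0]; split.
  by split; rewrite ?f0 ?g0 ?mulr0// jacMM// j0 f0 g0 !(mulr0, mul0r) !addr0.
pose c1 q := al q * be q; pose c2 q := al q * jac 0 1 f be q.
pose c3 q := be q * jac 0 1 al g q + g q * jac 0 1 al be q.
have s1 : smooth p c1 by exact: smoothM.
have s2 : smooth p c2 by apply: smoothM => //; exact: smooth_jac.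
have s3 : smooth p c3 by apply: smoothD; apply: smoothM => //; exact: smooth_jac.
have sj := smooth_jac 0 1 sf sg.
have E : {near p, jac 0 1 (fun q => al q * f q) (fun q => be q * g q) =1
   fun q => (c1 q * jac 0 1 f g q + c2 q * g q) + c3 q * f q}.
  have n1 : \forall q \near p, smooth q f /\ smooth q g.
    exact: filterI (smooth_near sf) (smooth_near sg).
  apply: filterS3 n1 (smooth_near sa) (smooth_near sb) => q [? ?] ? ?.
  by rewrite jacMM// /c1 /c2 /c3; ring.
rewrite /fold_at (near_eq_jac 0 1 _ E) jacDl; last first.
- exact: smoothM.
- by apply: smoothD; exact: smoothM.
rewrite jacDl; [|exact: smoothM|exact: smoothM].
have jgg : jac 0 1 g g p = 0 by rewrite /jac mulrC subrr.
rewrite !jacMM// j0 f0 g0 jgg /c1 !(mul0r, mulr0, addr0).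
by rewrite expr2 !mulrA.
Qed.

End JacobianCalculus.

Section Reparametrization.
Context {R : realType}.
Variable phi : 'rV[R]_2 -> 'rV[R]_2.

Definition jacdet : 'rV[R]_2 -> R := fun u =>
  jac 0 1 (fun q => phi q 0 0) (fun q => phi q 0 1) u.

Section Pointwise.
Variable u : 'rV[R]_2.
Hypothesis sphi : forall j, smooth u (fun q => phi q 0 j).

Lemma smooth_jacdet : smooth u jacdet.
Proof. exact: smooth_jac. Qed.

Lemma der_comp2 f c : smooth (phi u) f -> der c (fun q => f (phi q)) u =
  der c (fun q => phi q 0 0) u * der 0 f (phi u) +
  der c (fun q => phi q 0 1) u * der 1 f (phi u).
Proof. by move=> sf; rewrite der_comp// sum2. Qed.

Lemma jac_comp f g : smooth (phi u) f -> smooth (phi u) g ->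
  jac 0 1 (fun q => f (phi q)) (fun q => g (phi q)) u =
  jacdet u * jac 0 1 f g (phi u).
Proof. by move=> sf sg; rewrite /jacdet /jac !der_comp2//; ring. Qed.

End Pointwise.

Variable p : 'rV[R]_2.
Hypothesis sphi : forall j, smooth p (fun q => phi q 0 j).

Lemma near_smooth_at_image f : smooth (phi p) f ->
  \forall q \near p, (forall j, smooth q (fun q => phi q 0 j)) /\ smooth (phi q) f.
Proof.
move=> sf; apply: filterI (near_smooth_row sphi) _.
exact: (cvg_smooth_row sphi (smooth_near sf)).
Qed.

Lemma der_der_comp2 f c d : smooth (phi p) f ->
  der d (der c (fun q => f (phi q))) p =
  der d (der c (fun q => phi q 0 0)) p * der 0 f (phi p) +
  der d (der c (fun q => phi q 0 1)) p * der 1 f (phi p) +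
  der c (fun q => phi q 0 0) p *
   (der d (fun q => phi q 0 0) p * der 0 (der 0 f) (phi p) +
    der d (fun q => phi q 0 1) p * der 1 (der 0 f) (phi p)) +
  der c (fun q => phi q 0 1) p *
   (der d (fun q => phi q 0 0) p * der 1 (der 0 f) (phi p) +
    der d (fun q => phi q 0 1) p * der 1 (der 1 f) (phi p)).
Proof.
move=> sf.
have E : {near p, der c (fun q => f (phi q)) =1 fun q =>
  der c (fun q => phi q 0 0) q * der 0 f (phi q) +
  der c (fun q => phi q 0 1) q * der 1 f (phi q)}.
  by apply: filterS (near_smooth_at_image sf) => q [sq fq]; rewrite der_comp2.
have sc i j : smooth p (fun q => der i (fun q => phi q 0 j) q * der j f (phi q)).
  apply: smoothM; first exact: smooth_der.
  by apply: smooth_comp => //; exact: smooth_der.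
rewrite (near_eq_der d E) derD; [|exact: sc|exact: sc].
have sfp i : smooth (phi p) (der i f) by exact: smooth_der.
have sfc i : smooth p (fun q => der i f (phi q)) by exact: smooth_comp.
have sdp i : smooth p (der c (fun q => phi q 0 i)) by exact: smooth_der.
rewrite !derM// !der_comp2// (derC 1 0 sf); ring.
Qed.

(** Each of the two Jacobians contributes a factor [jacdet]; the derivatives of the inner factor
    multiply {f, g}, which is 0. *)
Lemma fold_comp f g : smooth (phi p) f -> smooth (phi p) g ->
  tangent_at f g (phi p) ->
  tangent_at (fun q => f (phi q)) (fun q => g (phi q)) p /\
  fold_at (fun q => f (phi q)) (fun q => g (phi q)) p =
  jacdet p ^+ 2 * fold_at f g (phi p).
Proof.
move=> sf sg [f0 g0 j0]; split; first by split=> //; rewrite jac_comp// j0 mulr0.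
have sj := smooth_jac 0 1 sf sg.
have E : {near p, jac 0 1 (fun q => f (phi q)) (fun q => g (phi q)) =1
    fun q => jacdet q * jac 0 1 f g (phi q)}.
  apply: filterS2 (near_smooth_at_image sf) (near_smooth_at_image sg).
  by move=> q [? ?] [_ ?]; rewrite jac_comp.
rewrite /fold_at (near_eq_jac 0 1 _ E).
have sJ := smooth_jacdet sphi.
have sjc : smooth p (fun q => jac 0 1 f g (phi q)) by exact: smooth_comp.
rewrite {1}/jac !(derM _ sJ sjc) j0 !mulr0 !add0r.
rewrite (_ : _ - _ = jacdet p * jac 0 1 (fun q => jac 0 1 f g (phi q)) (fun q => g (phi q)) p).
  by rewrite jac_comp// mulrA -expr2.
by rewrite [in RHS]/jac; ring.
Qed.

End Reparametrization.

(** * Reparametrization *)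

Lemma ord3P (j : 'I_3) : [\/ j = 0, j = 1 | j = 2].
Proof.
case: j => [[|[|[|//]]]] ?; [apply: Or31|apply: Or32|apply: Or33];
  exact/val_inj.
Qed.

Section FormsGerms.
Context {R : realType} {n : nat}.
Variables (a b : 'I_n) (X Y : 'I_3 -> 'rV[R]_n -> R) (p : 'rV[R]_n).
Hypothesis XY : forall j, {near p, X j =1 Y j}.

Lemma near_eq_forms : \forall u \near p,
  [/\ forall c d, met X c d u = met Y c d u & forall c d, sff a b X c d u = sff a b Y c d u].
Proof.
have n0 := near_join (XY 0); have n1 := near_join (XY 1); have n2 := near_join (XY 2).
apply: filterS3 n0 n1 n2 => u e0 e1 e2.
have d1 j c : der c (X j) u = der c (Y j) u.
  by case: (ord3P j) => ->; apply: near_eq_der.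
have d2 j c d : der d (der c (X j)) u = der d (der c (Y j)) u.
  have H (f g : 'rV[R]_n -> R) : {near u, f =1 g} -> der d (der c f) u = der d (der c g) u.
    by move=> fg; exact: (near_eq_ders_at [:: d; c] fg).
  by case: (ord3P j) => ->; exact: H.
by split=> c d; rewrite /met /sff !d1 ?d2.
Qed.

Lemma near_eq_invariants :
  [/\ {near p, fD a b X =1 fD a b Y}, {near p, fH a b X =1 fH a b Y} &
      {near p, fL a b X =1 fL a b Y}].
Proof.
by split; apply: filterS near_eq_forms => u [em es];
  rewrite /fL /fD /fK /fH !em ?es.
Qed.

End FormsGerms.

Section FormsComposition.
Context {R : realType}.
Variables (Y : 'I_3 -> 'rV[R]_2 -> R) (phi : 'rV[R]_2 -> 'rV[R]_2) (u : 'rV[R]_2).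
Hypothesis sphi : forall j, smooth u (fun q => phi q 0 j).
Hypothesis sY : forall j, smooth (phi u) (Y j).

Let X j := fun q => Y j (phi q).
Let p c := der c (fun q => phi q 0 0) u.
Let r c := der c (fun q => phi q 0 1) u.

Let d1 j c : der c (X j) u =
  p c * der 0 (Y j) (phi u) + r c * der 1 (Y j) (phi u).
Proof. exact: der_comp2. Qed.

Let d2 j c d : der d (der c (X j)) u =
  der d (der c (fun q => phi q 0 0)) u * der 0 (Y j) (phi u) +
  der d (der c (fun q => phi q 0 1)) u * der 1 (Y j) (phi u) +
  p c * (p d * der 0 (der 0 (Y j)) (phi u) + r d * der 1 (der 0 (Y j)) (phi u)) +
  r c * (p d * der 1 (der 0 (Y j)) (phi u) + r d * der 1 (der 1 (Y j)) (phi u)).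
Proof. exact: der_der_comp2. Qed.

Lemma met_comp c d : met X c d u = p c * p d * met Y 0 0 (phi u) +
  (p c * r d + r c * p d) * met Y 0 1 (phi u) + r c * r d * met Y 1 1 (phi u).
Proof. rewrite /met !d1; ring. Qed.

(** The second derivatives of [phi] multiply tangent vectors, which the normal annihilates; the
    normal itself is multiplied by [jacdet]. *)
Lemma sff_comp c d : sff 0 1 X c d u = jacdet phi u *
  (p c * p d * sff 0 1 Y 0 0 (phi u) +
  (p c * r d + r c * p d) * sff 0 1 Y 0 1 (phi u) + r c * r d * sff 0 1 Y 1 1 (phi u)).
Proof.
rewrite /sff !d2 !d1 (_ : jacdet phi u = p 0 * r 1 - p 1 * r 0)//.
move: (p 0) (p 1) (r 0) (r 1) (p c) (p d) (r c) (r d) => p0 p1 r0 r1 pc pd' rc rd.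
move: (der d _ u) (der d _ u) => f g.
move: (der 0 (Y 0) _) (der 0 (Y 1) _) (der 0 (Y 2) _) => a0 a1 a2.
move: (der 1 (Y 0) _) (der 1 (Y 1) _) (der 1 (Y 2) _) => b0 b1 b2.
ring.
Qed.

(** Weights: the determinant of a form contributes 2, as does the pairing in [fH], and each factor
    [sff] adds 1. So [fD], [fH], [fK] have weights 2, 3, 4, and both terms of [fL] have weight 6. *)
Lemma invariants_comp : [/\ fD 0 1 X u = jacdet phi u ^+ 2 * fD 0 1 Y (phi u),
  fH 0 1 X u = jacdet phi u ^+ 3 * fH 0 1 Y (phi u) &
  fL 0 1 X u = jacdet phi u ^+ 6 * fL 0 1 Y (phi u)].
Proof.
have JE : jacdet phi u = p 0 * r 1 - p 1 * r 0 by [].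
have DE : fD 0 1 X u = jacdet phi u ^+ 2 * fD 0 1 Y (phi u).
  by rewrite /fD !met_comp JE; ring.
have HE : fH 0 1 X u = jacdet phi u ^+ 3 * fH 0 1 Y (phi u).
  by rewrite /fH !met_comp !sff_comp; move: JE => ->; ring.
have KE : fK 0 1 X u = jacdet phi u ^+ 4 * fK 0 1 Y (phi u).
  by rewrite /fK !sff_comp JE; ring.
by split=> //; rewrite /fL DE HE KE; ring.
Qed.

End FormsComposition.

Section ReparamInvariance.
Context {R : realType}.
Variables (x y : 'rV[R]_2 -> 'rV[R]_3) (phi : 'rV[R]_2 -> 'rV[R]_2).
Hypotheses (sx : smooth_at 0 x) (sy : smooth_at 0 y) (dphi : diffeo_germ phi).
Hypothesis xy : \forall u \near (0 : 'rV[R]_2), x u = y (phi u).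

Let phi0 : phi 0 = 0. Proof. by case: dphi. Qed.

Let sphi j : smooth 0 (fun q => phi q 0 j).
Proof. by case: dphi => /smooth_rowP. Qed.

Lemma diffeo_jacdet : jacdet phi 0 != 0.
Proof.
have [_ _ [psi [spsi psi0 inv _]]] := dphi.
have spsi' k : smooth (phi 0) (fun q => psi q 0 k).
  by rewrite phi0; move: k; apply/smooth_rowP.
have E c k : der c (fun q => phi q 0 0) 0 * der 0 (fun q => psi q 0 k) 0 +
    der c (fun q => phi q 0 1) 0 * der 1 (fun q => psi q 0 k) 0 = (c == k)%:R.
  have n1 : {near (0 : 'rV[R]_2), (fun q => psi (phi q) 0 k) =1 fun q => q 0 k}.
    by apply: filterS inv => q ->.
  have := near_eq_der c n1; rewrite der_coord.
  by rewrite (der_comp2 sphi c (spsi' k)) phi0.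
apply/eqP => J0.
have : jacdet phi 0 * jac 0 1 (fun q => psi q 0 0) (fun q => psi q 0 1) 0 = 1 :> R.
  rewrite /jacdet /jac.
  transitivity ((der 0 (fun q => phi q 0 0) 0 * der 0 (fun q => psi q 0 0) 0 +
    der 0 (fun q => phi q 0 1) 0 * der 1 (fun q => psi q 0 0) 0) *
    (der 1 (fun q => phi q 0 0) 0 * der 0 (fun q => psi q 0 1) 0 +
    der 1 (fun q => phi q 0 1) 0 * der 1 (fun q => psi q 0 1) 0) -
    (der 0 (fun q => phi q 0 0) 0 * der 0 (fun q => psi q 0 1) 0 +
    der 0 (fun q => phi q 0 1) 0 * der 1 (fun q => psi q 0 1) 0) *
    (der 1 (fun q => phi q 0 0) 0 * der 0 (fun q => psi q 0 0) 0 +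
    der 1 (fun q => phi q 0 1) 0 * der 1 (fun q => psi q 0 0) 0)); first by ring.
  by rewrite !E /= mulr0 subr0 mulr1.
by rewrite J0 mul0r => /esym/eqP; rewrite oner_eq0.
Qed.

Let sY j : smooth (phi 0) (coords y j).
Proof. by rewrite phi0; move: j; apply/smooth_rowP. Qed.

Let nearE : [/\ {near (0 : 'rV[R]_2), delta x =1 fun u => jacdet phi u ^+ 2 * fD 0 1 (coords y) (phi u)},
  {near (0 : 'rV[R]_2), MCNC x =1 fun u => jacdet phi u ^+ 3 * fH 0 1 (coords y) (phi u)} &
  {near (0 : 'rV[R]_2), LPL x =1 fun u => jacdet phi u ^+ 6 * fL 0 1 (coords y) (phi u)}].
Proof.
have [e1 _ e2 e3] := near_invariantsE sx.
have XY j : {near (0 : 'rV[R]_2), coords x j =1 fun q => coords y j (phi q)}.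
  by apply: filterS xy => u; rewrite /coords => ->.
have [f1 f2 f3] := near_eq_invariants 0 1 XY.
have nY : \forall u \near (0 : 'rV[R]_2), (forall j, smooth u (fun q => phi q 0 j)) /\
    forall j, smooth (phi u) (coords y j).
  apply: filterI (near_smooth_row sphi) _.
  apply: (@filter_forall _ _ (fun j q => smooth (phi q) (coords y j)) (nbhs (0 : 'rV[R]_2))).
  by move=> j; apply: filterS (near_smooth_at_image sphi (sY j)) => u [].
split.
- by apply: filterS3 e1 f1 nY => u -> -> [h1 h2]; have [] := invariants_comp h1 h2.
- by apply: filterS3 e2 f2 nY => u -> -> [h1 h2]; have [] := invariants_comp h1 h2.
- by apply: filterS3 e3 f3 nY => u -> -> [h1 h2]; have [] := invariants_comp h1 h2.
Qed.

Let Ly : {near (0 : 'rV[R]_2), LPL y =1 fL 0 1 (coords y)}.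
Proof. by have [] := near_invariantsE sy. Qed.

Let Hy : {near (0 : 'rV[R]_2), MCNC y =1 fH 0 1 (coords y)}.
Proof. by have [] := near_invariantsE sy. Qed.

Lemma reparam_delta : 0 < delta y 0 -> 0 < delta x 0.
Proof.
have [/nbhs_singleton -> _ _] := nearE; have [/nbhs_singleton -> _ _ _] := near_invariantsE sy.
rewrite phi0 pmulr_rgt0// lt_neqAle sqr_ge0 andbT eq_sym sqrf_eq0.
exact: diffeo_jacdet.
Qed.

Lemma reparam_tangent : tangent_at (LPL y) (MCNC y) 0 ->
  tangent_at (LPL x) (MCNC x) 0 /\
  exists2 c, c != 0 & fold_at (LPL x) (MCNC x) 0 = c * fold_at (LPL y) (MCNC y) 0.
Proof.
move=> ty; have [ty' Ey] := near_eq_tangent Ly Hy.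
have sL := smooth_fL 0 1 sY; have sH := smooth_fH 0 1 sY.
have [|tc Ec] := fold_comp sphi sL sH; first by rewrite phi0; exact: ty'.
have sJ := smooth_jacdet sphi.
have [ts Es] := fold_scale (smooth_comp sphi sL) (smooth_comp sphi sH)
  (smoothX 6 sJ) (smoothX 3 sJ) tc.
have [_ nH nL] := nearE.
have sym (f g : 'rV[R]_2 -> R) : {near (0 : 'rV[R]_2), f =1 g} -> {near (0 : 'rV[R]_2), g =1 f}.
  by apply: filterS => v.
have [tx Ex] := near_eq_tangent (sym _ _ nL) (sym _ _ nH).
split; first exact: tx.
exists (jacdet phi 0 ^+ 6 * (jacdet phi 0 ^+ 3) ^+ 2 * jacdet phi 0 ^+ 2).
  by rewrite !mulf_neq0 ?expf_neq0// diffeo_jacdet.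
apply: etrans (esym Ex) _; apply: etrans Es _; rewrite -[RHS]mulrA.
by congr (_ * _); apply: etrans Ec _; rewrite phi0; congr (_ * _); exact: esym Ey.
Qed.

Lemma reparam_regular : LPL y 0 = 0 -> (exists i, der i (LPL y) 0 != 0) ->
  LPL x 0 = 0 /\ exists i, der i (LPL x) 0 != 0.
Proof.
move=> y0 [i hi]; have [_ _ nL] := nearE.
have sL := smooth_fL 0 1 sY; have sLc := smooth_comp sphi sL.
have J0 := diffeo_jacdet; have fy0 : fL 0 1 (coords y) 0 = 0.
  by rewrite -(nbhs_singleton Ly).
split; first by rewrite (nbhs_singleton nL) phi0 fy0 mulr0.
have dE c : der c (LPL x) 0 = jacdet phi 0 ^+ 6 *
   (der c (fun q => phi q 0 0) 0 * der 0 (LPL y) 0 +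
    der c (fun q => phi q 0 1) 0 * der 1 (LPL y) 0).
  rewrite (near_eq_der c nL) (derM _ (smoothX 6 (smooth_jacdet sphi)) sLc).
  by rewrite phi0 fy0 mulr0 add0r (der_comp2 sphi c sL) phi0 !(near_eq_der _ Ly).
case: (eqVneq (der 0 (LPL x) 0) 0) => [h0|]; last by exists 0.
case: (eqVneq (der 1 (LPL x) 0) 0) => [h1|]; last by exists 1.
exfalso; have J6 : jacdet phi 0 ^+ 6 != 0 by rewrite expf_neq0.
have {}h0 := etrans (etrans (esym (dE 0)) h0) (esym (mulr0 (jacdet phi 0 ^+ 6))).
have {}h1 := etrans (etrans (esym (dE 1)) h1) (esym (mulr0 (jacdet phi 0 ^+ 6))).
move: (mulfI J6 h0) (mulfI J6 h1) => {}h0 {}h1.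
have Z c : der c (LPL y) 0 = 0.
  apply: (mulfI J0); rewrite mulr0 /jacdet /jac.
  case: (ord2P c) => ->; [move: (h0) (h1) => H0 H1|move: (h0) (h1) => H0 H1].
    transitivity (der 1 (fun q => phi q 0 1) 0 * (der 0 (fun q => phi q 0 0) 0 * der 0 (LPL y) 0 +
    der 0 (fun q => phi q 0 1) 0 * der 1 (LPL y) 0) - der 0 (fun q => phi q 0 1) 0 *
     (der 1 (fun q => phi q 0 0) 0 * der 0 (LPL y) 0 +
    der 1 (fun q => phi q 0 1) 0 * der 1 (LPL y) 0)); first by ring.
    by rewrite H0 H1 !mulr0 subr0.
  transitivity (der 0 (fun q => phi q 0 0) 0 * (der 1 (fun q => phi q 0 0) 0 * der 0 (LPL y) 0 +
    der 1 (fun q => phi q 0 1) 0 * der 1 (LPL y) 0) - der 1 (fun q => phi q 0 0) 0 *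
     (der 0 (fun q => phi q 0 0) 0 * der 0 (LPL y) 0 +
    der 0 (fun q => phi q 0 1) 0 * der 1 (LPL y) 0)); first by ring.
  by rewrite H0 H1 !mulr0 subr0.
by rewrite Z eqxx in hi.
Qed.

End ReparamInvariance.

(** * Jets *)

Section InitialJets.
Context {R : realType} {I : eqType} {V : normedModType R} {S : choiceType}.
Variable J : S -> {ptws I -> V}.

Lemma jets_continuous (i : I) :
  continuous (fun w : initial_topology J => (J w : I -> V) i : V).
Proof.
move=> w; have cJ := @initial_continuous S _ J w.
exact: continuous_comp cJ (@proj_continuous I (fun=> V) i (J w)).
Qed.

Lemma jets_cvg (X : Type) (F : set_system X) (FF : Filter F) (g : X -> S) (w : S) :
  (forall i, (J (g x) : I -> V) i @[x --> F] --> (J w : I -> V) i) ->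
  g x @[x --> F] --> (w : initial_topology J).
Proof.
move=> H A [_ [[B Bop <-] Bw BA]].
have Hc : (J (g x)) @[x --> F] --> (J w : {ptws I -> V}).
  apply/cvg_sup => i U [_ [[W oW <-] Ww WU]].
  rewrite /= in Ww; apply: (filterS WU).
  by apply: H; exact: open_nbhs_nbhs.
have FB : F ((J \o g) @^-1` B) by apply: Hc; exact: open_nbhs_nbhs.
have FA : F (g @^-1` A) by apply: filterS FB => x Bx; apply: BA.
exact: FA.
Qed.

End InitialJets.

Section JetCalculus.
Context {R : realType} {n : nat}.
Implicit Types (f g : 'rV[R]_n -> R) (p : 'rV[R]_n).

Lemma dersD p s f g : smooth p f -> smooth p g ->
  ders s (fun q => f q + g q) p = ders s f p + ders s g p.
Proof.
elim/last_ind: s f g => // s i IH f g sf sg; rewrite !ders_rcons.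
rewrite -IH; [|exact: smooth_der..].
by apply: near_eq_ders_at; apply: (near_smooth2 sf sg) => q; exact: derD.
Qed.

Lemma dersZ p s (a : R) f : smooth p f -> ders s (fun q => a * f q) p = a * ders s f p.
Proof.
elim/last_ind: s f => // s i IH f sf; rewrite !ders_rcons -IH; last exact: smooth_der.
by apply: near_eq_ders_at; apply: (near_smooth sf) => q; exact: derZ.
Qed.

Lemma dersN p s f : smooth p f -> ders s (fun q => - f q) p = - ders s f p.
Proof.
move=> sf; rewrite -mulN1r -dersZ//; congr (ders s _ p).
by apply/funext => q; rewrite mulN1r.
Qed.

Lemma dersB p s f g : smooth p f -> smooth p g ->
  ders s (fun q => f q - g q) p = ders s f p - ders s g p.
Proof. by move=> sf sg; rewrite dersD ?dersN//; exact: smoothN. Qed.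

Lemma dersM_rcons p s i f g : smooth p f -> smooth p g ->
  ders (rcons s i) (fun q => f q * g q) p =
  ders s (fun q => der i f q * g q) p + ders s (fun q => f q * der i g q) p.
Proof.
move=> sf sg; rewrite ders_rcons -dersD.
- by apply: near_eq_ders_at; apply: (near_smooth2 sf sg) => q; exact: derM.
- by apply: smoothM => //; exact: smooth_der.
- by apply: smoothM => //; exact: smooth_der.
Qed.

Lemma smooth_sum_lin (al : 'I_n -> R) p : smooth p (fun u : 'rV[R]_n => \sum_j al j * u 0 j).
Proof.
apply: (@smooth_sum _ _ 'I_n (index_enum 'I_n) (fun j u => al j * u 0 j)) => j.
by apply: smoothZ; exact: smooth_coord.
Qed.

(* Divided powers of linear forms: a derivation only lowers the exponent. *)
Definition dpow k (al : 'I_n -> R) : 'rV[R]_n -> R :=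
  fun u => k`!%:R^-1 * (\sum_j al j * u 0 j) ^+ k.

Lemma smooth_dpow k al p : smooth p (dpow k al).
Proof. by apply: smoothZ; apply: smoothX; exact: smooth_sum_lin. Qed.

Lemma der_dpow k al c : der c (dpow k.+1 al) = fun u => al c * dpow k al u.
Proof.
apply/funext => u; have sl := smooth_sum_lin al u.
have dl : der c (fun u : 'rV[R]_n => \sum_j al j * u 0 j) u = al c.
  rewrite der_sum; last by move=> j; apply: smoothZ; exact: smooth_coord.
  rewrite (bigD1 c)//= big1 => [|j jc].
    by rewrite addr0 derZ ?der_coord ?eqxx ?mulr1//; exact: smooth_coord.
  by rewrite derZ ?der_coord 1?eq_sym ?(negPf jc) ?mulr0//; exact: smooth_coord.
have dX m : der c (fun u => (\sum_j al j * u 0 j) ^+ m.+1) u =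
    m.+1%:R * (al c * (\sum_j al j * u 0 j) ^+ m).
  elim: m => [|m IH].
    rewrite expr0 mulr1 mul1r -[RHS]dl; congr (der c _ u).
  rewrite (_ : (fun u => _) = fun u : 'rV[R]_n => (\sum_j al j * u 0 j) * (\sum_j al j * u 0 j) ^+ m.+1); last first.
    by apply/funext => v; rewrite exprS.
  rewrite (derM c sl (smoothX m.+1 sl)) dl IH exprS -[in RHS]natr1; ring.
rewrite /dpow derZ; last exact: smoothX.
rewrite dX factS natrM invfM mulrACA.
have k0 : (k.+1%:R : R) != 0 by rewrite pnatr_eq0.
by rewrite mulVf// mul1r mulrCA.
Qed.

Lemma ders_dpow s k al : ders s (dpow (size s + k) al) = fun u => (\prod_(c <- s) al c) * dpow k al u.
Proof.
elim/last_ind: s k => [|s c IH] k.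
  by apply/funext => u; rewrite big_nil mul1r.
rewrite size_rcons addSn ders_rcons der_dpow; apply/funext => u.
rewrite dersZ; last exact: smooth_dpow.
by rewrite IH -cats1 big_cat big_seq1 /= mulrA [al c * _]mulrC.
Qed.

Lemma dpow_0 k al : dpow k al 0 = (k == 0%N)%:R.
Proof.
rewrite /dpow (eq_bigr (fun=> 0)); last by move=> j _; rewrite mxE mulr0.
rewrite big1_eq expr0n; case: k => [|k]; last by rewrite mulr0.
by rewrite fact0 invr1 mulr1.
Qed.

Definition flat k f := forall s, (size s < k)%N -> ders s f 0 = 0.

Lemma flat_dpow k al : flat k (dpow k al).
Proof.
move=> s sk; rewrite -(subnKC (ltnW sk)) ders_dpow dpow_0.
by rewrite subn_eq0 leqNgt sk mulr0.
Qed.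

Lemma ders_dpow_top s al : ders s (dpow (size s) al) 0 = \prod_(c <- s) al c.
Proof. by rewrite -[in dpow _ _](addn0 (size s)) ders_dpow dpow_0 mulr1. Qed.

(** Up to order [k], the only Leibniz term that can survive puts all the derivatives on [f]. *)
Lemma flatM k f g : smooth 0 f -> smooth 0 g -> flat k f ->
  forall s, (size s <= k)%N -> ders s (fun q => f q * g q) 0 = ders s f 0 * g 0.
Proof.
elim: k f g => [|k IH] f g sf sg ff s.
  by rewrite leqn0 size_eq0 => /eqP ->.
case/lastP: s => // s i; rewrite size_rcons ltnS => sk.
rewrite dersM_rcons// IH//; last 2 first.
- exact: smooth_der.
- by move=> t tk; rewrite -ders_rcons ff// size_rcons.
rewrite IH//; last 2 first.
- exact: smooth_der.
- by move=> t tk; rewrite ff// ltnS ltnW.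
by rewrite (ff s)// mul0r addr0 ders_rcons.
Qed.

(* At 0, [f'] and [f] have the same derivatives below order [r], and [e] is the
   difference of those of order [r]. *)
Definition dev r f' f (e : seq 'I_n -> R) :=
  [/\ smooth 0 f', smooth 0 f,
    forall s, (size s <= r)%N -> ders s f' 0 = ders s f 0 + e s &
    forall s, (size s < r)%N -> e s = 0].

Lemma dev_eq r f' f e e' : (forall s, (size s <= r)%N -> e s = e' s) ->
  dev r f' f e -> dev r f' f e'.
Proof.
move=> ee [h1 h2 h3 h4]; split=> // s sr; first by rewrite h3// ee.
by rewrite -ee ?h4// ltnW.
Qed.

Lemma devD r f' f e g' g d : dev r f' f e -> dev r g' g d ->
  dev r (fun q => f' q + g' q) (fun q => f q + g q) (fun s => e s + d s).
Proof.
move=> [h1 h2 h3 h4] [k1 k2 k3 k4]; split; [exact: smoothD|exact: smoothD| |].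
  by move=> s sr; rewrite !dersD// h3// k3// addrACA.
by move=> s sr; rewrite h4// k4// addr0.
Qed.

Lemma devZ r a f' f e : dev r f' f e ->
  dev r (fun q => a * f' q) (fun q => a * f q) (fun s => a * e s).
Proof.
move=> [h1 h2 h3 h4]; split; [exact: smoothZ|exact: smoothZ| |].
  by move=> s sr; rewrite !dersZ// h3// mulrDr.
by move=> s sr; rewrite h4// mulr0.
Qed.

Lemma devB r f' f e g' g d : dev r f' f e -> dev r g' g d ->
  dev r (fun q => f' q - g' q) (fun q => f q - g q) (fun s => e s - d s).
Proof.
move=> [h1 h2 h3 h4] [k1 k2 k3 k4]; split; [exact: smoothB|exact: smoothB| |].
  by move=> s sr; rewrite !dersB// h3// k3// opprD addrACA.
by move=> s sr; rewrite h4// k4// subr0.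
Qed.

(** With [F] and [G] the differences, [f' g' = f g + F g' + G f]; [F] and [G] are flat, so [flatM]
    applies, and [g'] agrees with [g] at 0 since [r > 0]. *)
Lemma devM r f' f e g' g d : (0 < r)%N -> dev r f' f e -> dev r g' g d ->
  dev r (fun q => f' q * g' q) (fun q => f q * g q) (fun s => e s * g 0 + f 0 * d s).
Proof.
move=> r0 [h1 h2 h3 h4] [k1 k2 k3 k4]; split; [exact: smoothM|exact: smoothM| |]; last first.
  by move=> s sr; rewrite h4// k4// mul0r mulr0 addr0.
move=> s sr; pose F q := f' q - f q; pose G q := g' q - g q.
have sF : smooth 0 F by exact: smoothB.
have sG : smooth 0 G by exact: smoothB.
have Fe t : (size t <= r)%N -> ders t F 0 = e t.
  by move=> tr; rewrite dersB// h3// addrAC subrr add0r.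
have Gd t : (size t <= r)%N -> ders t G 0 = d t.
  by move=> tr; rewrite dersB// k3// addrAC subrr add0r.
have fF : flat r F by move=> t tr; rewrite Fe ?h4// ltnW.
have fG : flat r G by move=> t tr; rewrite Gd ?k4// ltnW.
have -> : (fun q => f' q * g' q) = (fun q => (f q * g q + F q * g' q) + G q * f q).
  by apply/funext => q; rewrite /F /G; ring.
rewrite dersD; [|apply: smoothD; exact: smoothM|exact: smoothM].
rewrite dersD; [|exact: smoothM|exact: smoothM].
rewrite (flatM sF k1 fF)// (flatM sG h2 fG)// Fe// Gd//.
have -> : g' 0 = g 0 by have := k3 [::] (leq0n r); rewrite /= k4// addr0.
by rewrite -addrA [f 0 * _]mulrC.
Qed.

End JetCalculus.

(** * Continuous dependence of the invariants on the jets *)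

Section JetContinuity.
Context {R : realType} {n : nat} {T : topologicalType}.
Implicit Types F G : T -> 'rV[R]_n -> R.

(** Asking for all derivatives at 0 makes the notion stable under products and derivations; it then
    passes from the coordinates of a surface to its invariants and their Jacobians. *)
Definition jetc F := (forall x, smooth 0 (F x)) /\
  forall s x, ders s (F y) 0 @[y --> x] --> ders s (F x) 0.

Lemma jetcD F G : jetc F -> jetc G -> jetc (fun x q => F x q + G x q).
Proof.
move=> [sF cF] [sG cG]; split=> [x|s x]; first exact: smoothD.
rewrite (_ : (fun y => _) = (fun y => ders s (F y) 0 + ders s (G y) 0)).
  by rewrite (dersD s (sF x) (sG x)); apply: cvgD; [exact: cF|exact: cG].
by apply/funext => y; exact: dersD.
Qed.

Lemma jetcN F : jetc F -> jetc (fun x q => - F x q).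
Proof.
move=> [sF cF]; split=> [x|s x]; first exact: smoothN.
rewrite (_ : (fun y => _) = (fun y => - ders s (F y) 0)).
  by rewrite (dersN s (sF x)); exact: cvgN (cF s x).
by apply/funext => y; exact: dersN.
Qed.

Lemma jetcB F G : jetc F -> jetc G -> jetc (fun x q => F x q - G x q).
Proof. by move=> cF cG; apply: jetcD => //; exact: jetcN. Qed.

Lemma jetc_der i F : jetc F -> jetc (fun x => der i (F x)).
Proof.
move=> [sF cF]; split=> [x|s x]; first exact: smooth_der.
by rewrite -ders_rcons; under eq_fun do rewrite -ders_rcons; exact: cF.
Qed.

Lemma jetcM F G : jetc F -> jetc G -> jetc (fun x q => F x q * G x q).
Proof.
move=> cF cG; split=> [x|s]; first by apply: smoothM; [case: cF|case: cG].
elim/last_ind: s F G cF cG => [|s i IH] F G cF cG x.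
  by apply: cvgM; [exact: (cF.2 [::])|exact: (cG.2 [::])].
rewrite (_ : (fun y => _) = (fun y => ders s (fun q => der i (F y) q * G y q) 0 +
   ders s (fun q => F y q * der i (G y) q) 0)).
  rewrite dersM_rcons; [|exact: cF.1|exact: cG.1].
  by apply: cvgD; apply: IH => //; exact: jetc_der.
by apply/funext => y; rewrite dersM_rcons; [|exact: cF.1|exact: cG.1].
Qed.

Lemma jetc_cst f : smooth 0 f -> jetc (fun=> f).
Proof. by move=> sf; split=> [//|s x]; exact: cvg_cst. Qed.

Lemma jetcZ (a : R) F : jetc F -> jetc (fun x q => a * F x q).
Proof. by move=> cF; apply: (jetcM (jetc_cst (smooth_cst 0 a))). Qed.

Variables (a b : 'I_n) (Y : T -> 'I_3 -> 'rV[R]_n -> R).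
Hypothesis cY : forall j, jetc (fun x => Y x j).

Lemma jetc_met c d : jetc (fun x => met (Y x) c d).
Proof.
by apply: jetcB; [apply: jetcD|]; apply: jetcM; exact: (jetc_der _ (cY _)).
Qed.

Lemma jetc_sff c d : jetc (fun x => sff a b (Y x) c d).
Proof.
have cd j e : jetc (fun x => der e (Y x j)) by exact: (jetc_der _ (cY j)).
have cdd j : jetc (fun x => der d (der c (Y x j))) by exact: jetc_der (cd _ _).
have cN i j : jetc (fun x q => der a (Y x i) q * der b (Y x j) q - der a (Y x j) q * der b (Y x i) q).
  by apply: jetcB; exact: jetcM.
by apply: jetcD; [apply: jetcD|]; apply: jetcM => //; exact: cN.
Qed.

Lemma jetc_fH : jetc (fun x => fH a b (Y x)).
Proof.
have cM c d e f : jetc (fun x q => sff a b (Y x) c d q * met (Y x) e f q).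
  by apply: jetcM; [exact: jetc_sff|exact: jetc_met].
by apply: jetcD (cM _ _ _ _); apply: jetcB (cM _ _ _ _) _; apply: jetcZ; exact: cM.
Qed.

Lemma jetc_fD : jetc (fun x => fD a b (Y x)).
Proof. by apply: jetcB; apply: jetcM; exact: jetc_met. Qed.

Lemma jetc_fL : jetc (fun x => fL a b (Y x)).
Proof.
apply: jetcD; first by apply: jetcM; exact: jetc_fH.
apply: jetcZ; apply: jetcM; first exact: jetc_fD.
by apply: jetcB; apply: jetcM; exact: jetc_sff.
Qed.

End JetContinuity.

(** * Perturbations *)

Section Perturbation.
Context {R : realType} {n : nat}.
Variables (a b : 'I_n) (Y : 'I_3 -> 'rV[R]_n -> R) (N : 'I_3 -> R).
Variables (P : 'rV[R]_n -> R) (r : nat).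
Hypotheses (sY : forall j, smooth 0 (Y j)) (sP : smooth 0 P).
Hypotheses (r0 : (0 < r)%N) (fP : flat r.+2 P).

Definition perturb (j : 'I_3) : 'rV[R]_n -> R := fun u => Y j u + N j * P u.

Definition hess c d s : R := ders s (der d (der c P)) 0.

(* The determinant of (Y_a, Y_b, N) at 0, subscripts denoting derivatives *)
Definition normal_part : R :=
  (der a (Y 1) 0 * der b (Y 2) 0 - der a (Y 2) 0 * der b (Y 1) 0) * N 0
  + (der a (Y 2) 0 * der b (Y 0) 0 - der a (Y 0) 0 * der b (Y 2) 0) * N 1
  + (der a (Y 0) 0 * der b (Y 1) 0 - der a (Y 1) 0 * der b (Y 0) 0) * N 2.

Lemma smooth_perturb j : smooth 0 (perturb j).
Proof. by apply: smoothD => //; exact: smoothZ. Qed.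

(** [P] starts at order [r + 2]: up to order [r], first derivatives of the surface are unchanged at
    0 and second ones change at order [r] only. Hence the metric is not perturbed, and [sff], [fH],
    [fK] respond linearly to the Hessian of [P]. *)
Let dev_der c j : dev r (der c (perturb j)) (der c (Y j)) (fun=> 0).
Proof.
split; [exact/smooth_der/smooth_perturb|exact: smooth_der| |by []].
move=> s sr; rewrite addr0 -!ders_rcons dersD//; last exact: smoothZ.
by rewrite dersZ// fP ?mulr0 ?addr0// size_rcons.
Qed.

Let dev_der2 c d j :
  dev r (der d (der c (perturb j))) (der d (der c (Y j))) (fun s => N j * hess c d s).
Proof.
have [sp sy] : smooth 0 (perturb j) /\ smooth 0 (Y j) by split=> //; exact: smooth_perturb.
split; [exact/smooth_der/smooth_der|exact/smooth_der/smooth_der| |].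
  move=> s sr; rewrite /hess -!ders_rcons dersD//; last exact: smoothZ.
  by rewrite dersZ.
by move=> s sr; rewrite /hess -!ders_rcons fP ?mulr0// !size_rcons !ltnS.
Qed.

Lemma dev_met c d : dev r (met perturb c d) (met Y c d) (fun=> 0).
Proof.
apply: dev_eq (devB (devD (devM r0 (dev_der c 0) (dev_der d 0))
  (devM r0 (dev_der c 1) (dev_der d 1))) (devM r0 (dev_der c 2) (dev_der d 2))).
by move=> s _; rewrite !(mulr0, mul0r, addr0, subr0).
Qed.

Lemma dev_sff c d :
  dev r (sff a b perturb c d) (sff a b Y c d) (fun s => normal_part * hess c d s).
Proof.
have dN i j := devB (devM r0 (dev_der a i) (dev_der b j)) (devM r0 (dev_der a j) (dev_der b i)).
apply: dev_eq (devD (devD (devM r0 (dN 1 2) (dev_der2 c d 0))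
  (devM r0 (dN 2 0) (dev_der2 c d 1))) (devM r0 (dN 0 1) (dev_der2 c d 2))).
by move=> s _; rewrite /normal_part; ring.
Qed.

Lemma dev_fD : dev r (fD a b perturb) (fD a b Y) (fun=> 0).
Proof.
apply: dev_eq (devB (devM r0 (dev_met a b) (dev_met a b)) (devM r0 (dev_met a a) (dev_met b b))).
by move=> s _; rewrite !(mulr0, mul0r, addr0, subr0).
Qed.

Definition dH s := normal_part *
  (hess a a s * met Y b b 0 - 2 * (hess a b s * met Y a b 0) + hess b b s * met Y a a 0).

Definition dK s := normal_part *
  (hess a a s * sff a b Y b b 0 + sff a b Y a a 0 * hess b b s
   - 2 * (sff a b Y a b 0 * hess a b s)).

Lemma dev_fH : dev r (fH a b perturb) (fH a b Y) dH.
Proof.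
apply: dev_eq (devD (devB (devM r0 (dev_sff a a) (dev_met b b))
  (devZ 2 (devM r0 (dev_sff a b) (dev_met a b)))) (devM r0 (dev_sff b b) (dev_met a a))).
by move=> s _; rewrite /dH; ring.
Qed.

Lemma dev_fK : dev r (fK a b perturb) (fK a b Y) dK.
Proof.
apply: dev_eq (devB (devM r0 (dev_sff a a) (dev_sff b b)) (devM r0 (dev_sff a b) (dev_sff a b))).
by move=> s _; rewrite /dK; ring.
Qed.

Lemma dev_fL : dev r (fL a b perturb) (fL a b Y)
  (fun s => 2 * (fH a b Y 0 * dH s) + 4 * (fD a b Y 0 * dK s)).
Proof.
apply: dev_eq (devD (devM r0 dev_fH dev_fH) (devZ 4 (devM r0 dev_fD dev_fK))).
by move=> s _; ring.
Qed.

End Perturbation.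

Section PowerSums.
Context {R : realType} {n : nat}.
Implicit Types (ws : seq (R * ('I_n -> R))).

Definition powsum k ws : 'rV[R]_n -> R :=
  fun u => \sum_(w <- ws) w.1 * dpow k w.2 u.

Lemma smooth_powsum k ws p : smooth p (powsum k ws).
Proof. by apply: smooth_sum => w; apply: smoothZ; exact: smooth_dpow. Qed.

Lemma ders_powsum s k ws p :
  ders s (powsum k ws) p = \sum_(w <- ws) w.1 * ders s (dpow k w.2) p.
Proof.
elim: ws => [|w ws IH].
  rewrite big_nil (_ : powsum k [::] = fun=> 0); last first.
    by apply/funext => u; rewrite /powsum big_nil.
  apply: etrans (mul0r (ders s (fun=> 0) p)); rewrite -dersZ; last exact: smooth_cst.
  by congr (ders s _ p); apply/funext => u; rewrite mul0r.
rewrite big_cons -IH -dersZ; last exact: smooth_dpow.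
rewrite -dersD; [|exact/smoothZ/smooth_dpow|exact: smooth_powsum].
by congr (ders s _ p); apply/funext => u; rewrite /powsum big_cons.
Qed.

Lemma flat_powsum k ws : flat k (powsum k ws).
Proof. by move=> s sk; rewrite ders_powsum big1// => w _; rewrite flat_dpow ?mulr0. Qed.

Lemma ders_powsum_top s ws :
  ders s (powsum (size s) ws) 0 = \sum_(w <- ws) w.1 * \prod_(c <- s) w.2 c.
Proof. by rewrite ders_powsum; apply: eq_bigr => w _; rewrite ders_dpow_top. Qed.

Lemma cvg_powsum k (I : Type) (r : seq I) (w : R -> I -> R) (al : I -> 'I_n -> R) s :
  (forall i, w e i @[e --> (0 : R)] --> (0 : R)) ->
  ders s (powsum k [seq (w e i, al i) | i <- r]) 0 @[e --> (0 : R)] --> (0 : R).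
Proof.
move=> w0; rewrite (_ : (fun e => _) = fun e => \sum_(i <- r) w e i * ders s (dpow k (al i)) 0).
  rewrite [X in _ --> X](_ : 0 = \sum_(i <- r) 0 * ders s (dpow k (al i)) 0).
    apply: cvg_sumr => i; apply: cvgM; [exact: w0|exact: cvg_cst].
  by rewrite big1// => i _; rewrite mul0r.
by apply/funext => e; rewrite ders_powsum big_map.
Qed.

End PowerSums.

Section Bump.
Context {R : realType}.
Implicit Types (x : 'rV[R]_2 -> 'rV[R]_3) (P : 'rV[R]_2 -> R) (N : 'I_3 -> R).

Definition bump x N P : 'rV[R]_2 -> 'rV[R]_3 :=
  fun u => \row_(j < 3) perturb (coords x) N P j u.

Lemma coords_bump x N P : coords (bump x N P) = perturb (coords x) N P.
Proof. by apply/funext => j; apply/funext => u; rewrite /coords mxE. Qed.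

Lemma smooth_bump x N P : smooth_at 0 x -> smooth 0 P -> smooth_at 0 (bump x N P).
Proof.
move=> /smooth_rowP sx sP; apply/smooth_rowP => j.
rewrite -[X in smooth 0 X]/(coords (bump x N P) j) coords_bump.
exact: (smooth_perturb (Y := coords x)).
Qed.

Lemma pds_bump x N P s j : smooth_at 0 x -> smooth 0 P ->
  pds s (bump x N P) 0 0 j = pds s x 0 0 j + N j * ders s P 0.
Proof.
move=> sx sP; rewrite pds_row; last exact: smooth_bump.
rewrite pds_row// -[X in ders s X 0]/(coords (bump x N P) j) coords_bump.
have sxj : smooth 0 (coords x j) by move/smooth_rowP: sx; apply.
rewrite dersD//; last exact: smoothZ.
by rewrite dersZ.
Qed.

Lemma bump_immersion x N P : immersion_germ x -> smooth 0 P -> flat 2 P ->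
  immersion_germ (bump x N P).
Proof.
move=> [sx rx] sP fP; split; first exact: smooth_bump.
rewrite (_ : \matrix_(_, _) _ = \matrix_(i < 2, j < 3) pd i x 0 0 j)//.
apply/matrixP => i j; rewrite !mxE.
by have := pds_bump N [:: i] j sx sP; rewrite fP// mulr0 addr0.
Qed.

(** A perturbation flat to order 2 keeps the tangent plane at 0, hence the immersion; convergence of
    germs is convergence of each derivative at 0. *)
Lemma bump_path (x : local_param R) N (P : R -> 'rV[R]_2 -> R) :
  (forall e, smooth 0 (P e)) -> (forall e, flat 2 (P e)) ->
  (forall s, ders s (P e) 0 @[e --> (0 : R)] --> (0 : R)) ->
  exists y : R -> local_param R,
    (forall e, param_fun (y e) = bump (param_fun x) N (P e)) /\
    y e @[e --> (0 : R)] --> x.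
Proof.
move=> sP fP cP; have ix : immersion_germ (param_fun x) := set_valP x.
pose y e : set_type (@immersion_germ R) :=
  SigSub (mem_set (bump_immersion N ix (sP e) (fP e))).
exists y; split=> //.
apply: (@jets_cvg R _ _ _ (fun x : set_type (@immersion_germ R) => jet (set_val x))).
move=> s; apply: (@cvg_row R 3 _ (nbhs (0 : R)) (nbhs_filter (0 : R))) => j.
rewrite (_ : (fun e => _) = fun e => pds s (param_fun x) 0 0 j + N j * ders s (P e) 0).
  rewrite [X in _ --> X](_ : _ = pds s (param_fun x) 0 0 j + N j * 0).
    by apply: cvgD; [exact: cvg_cst|apply: cvgM; [exact: cvg_cst|exact: cP]].
  by rewrite mulr0 addr0.
apply/funext => e; apply: etrans (pds_bump N s j _ (sP e)) _ => //.
exact: (proj1 ix).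
Qed.

End Bump.

(** * Removing degeneracies *)

Section BinaryForms.
Context {R : realType}.
Implicit Types E F G l m n x y w : R.

(** The form adjugate to that of coefficients [E F G], polarized. A Hessian that is the square of a
    linear form changes [fH] by the value of [bil E F G] on this form and [fK] by that of
    [bil l m n], up to the factor [normal_part]. *)
Definition bil E F G x0 x1 y0 y1 : R := G * (x0 * y0) - F * (x0 * y1 + x1 * y0) + E * (x1 * y1).

(* [x] spans the kernel of the degenerate form (l, m, n); by [H = 0] it is
   isotropic for (E, F, G). *)
Lemma adapted_frame E F G l m n : 0 < F * F - E * G ->
  l * G - 2 * (m * F) + n * E = 0 -> l * n - m * m = 0 -> l != 0 \/ n != 0 ->
  exists x0 x1 y0 y1, [/\ x0 * y1 - x1 * y0 != 0, bil E F G x0 x1 x0 x1 = 0,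
    bil l m n x0 x1 x0 x1 = 0, bil E F G x0 x1 y0 y1 != 0 & bil l m n x0 x1 y0 y1 = 0].
Proof.
move=> d0 H0 K0 ln; case: (eqVneq l 0) ln => [l0 [/eqP//|n0]|l0 _].
  have m0 : m = 0 by apply/eqP; rewrite -sqrf_eq0 expr2 -oppr_eq0 -K0 l0 mul0r add0r.
  have E0 : E = 0.
    by apply/eqP; move/eqP: H0; rewrite l0 m0 !mul0r mulr0 subr0 add0r mulf_eq0 (negPf n0).
  exists 0, 1, 1, 0; rewrite /bil l0 m0 E0; split; try by ring.
    by rewrite mul0r mulr1 sub0r oppr_eq0 oner_eq0.
  apply: contraTneq d0 => F0.
  have -> : F = 0 by rewrite -[RHS]oppr0 -[in RHS]F0; ring.
  by rewrite E0 !mul0r subr0 ltxx.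
(* A row of the rank-one matrix with rows (l, m) and (m, n) lies in the kernel of its adjugate; when
   [l = 0], the row (m, n) gave the vector (0, 1). *)
exists l, m, 0, 1; rewrite /bil; split; [by rewrite mulr1 mulr0 subr0| | | |].
- transitivity (l * (l * G - 2 * (m * F) + n * E) - E * (l * n - m * m)); first by ring.
  by rewrite H0 K0 !mulr0 subr0.
- transitivity (l * (l * n - m * m)); first by ring.
  by rewrite K0 mulr0.
- apply: contraTneq d0 => f0.
  have : (F * F - E * G) * l ^+ 2 = 0.
    transitivity ((G * (l * 0) - F * (l * 1 + m * 0) + E * (m * 1)) ^+ 2
      - E * l * (l * G - 2 * (m * F) + n * E) + E ^+ 2 * (l * n - m * m)); first by ring.
    by rewrite f0 H0 K0 !mulr0 expr0n/= subr0 addr0.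
  by move/eqP; rewrite mulf_eq0 sqrf_eq0 (negPf l0) orbF => /eqP ->; rewrite ltxx.
- ring.
Qed.

(** Otherwise the product of the two nonzero forms would be a nonzero binary cubic vanishing in the
    four directions (1, 0), (0, 1), (1, 1), (1, -1), while it has at most three zero directions. *)
Lemma quadratic_nonzero E F G w0 w1 : [\/ E != 0, F != 0 | G != 0] -> w0 != 0 \/ w1 != 0 ->
  exists x0 x1, bil E F G x0 x1 x0 x1 != 0 /\ x0 * w0 + x1 * w1 != 0.
Proof.
move=> EFG w01; have [//|no] := pselect (exists x0 x1, bil E F G x0 x1 x0 x1 != 0 /\ x0 * w0 + x1 * w1 != 0).
exfalso; have Z x0 x1 : bil E F G x0 x1 x0 x1 * (x0 * w0 + x1 * w1) = 0.
  apply/eqP; rewrite mulf_eq0; apply/orP.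
  case: (eqVneq (bil E F G x0 x1 x0 x1) 0) => [|a]; first by left.
  case: (eqVneq (x0 * w0 + x1 * w1) 0) => [|b]; first by right.
  by exfalso; apply: no; exists x0, x1.
have [z1 z2 z3 z4] := And4 (Z 1 0) (Z 0 1) (Z 1 1) (Z 1 (-1)).
have {}z1 : G * w0 = 0 by rewrite -z1 /bil; ring.
have {}z2 : E * w1 = 0 by rewrite -z2 /bil; ring.
have {}z3 : (G - 2 * F + E) * (w0 + w1) = 0 by rewrite -z3 /bil; ring.
have {}z4 : (G + 2 * F + E) * (w0 - w1) = 0 by rewrite -z4 /bil; ring.
have two : (2 : R) != 0 by rewrite pnatr_eq0.
have cancel (a b : R) : a * b = 0 -> b != 0 -> a = 0.
  by move/eqP; rewrite mulf_eq0 => /orP[/eqP//|/eqP ->]; rewrite eqxx.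
suff [e0 f0 g0] : [/\ E = 0, F = 0 & G = 0] by case: EFG; rewrite ?e0 ?f0 ?g0 eqxx.
case: (eqVneq w0 0) => [w00|w00].
  have w10 : w1 != 0 by case: w01 => //; rewrite w00 eqxx.
  have e0 := cancel _ _ z2 w10; rewrite w00 e0 addr0 add0r sub0r addr0 in z3 z4.
  have g1 := cancel _ _ z3 w10; have g2 := cancel _ _ z4; rewrite oppr_eq0 in g2.
  have {}g2 := g2 w10; split=> //; lra.
have g0 := cancel _ _ z1 w00; rewrite g0 !add0r in z3 z4.
case: (eqVneq w1 0) => [w10|w10].
  rewrite w10 addr0 subr0 in z3 z4.
  have g1 := cancel _ _ z3 w00; have g2 := cancel _ _ z4 w00; split=> //; lra.
have e0 := cancel _ _ z2 w10; rewrite e0 !addr0 in z3 z4; split=> //.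
case: (eqVneq (w0 + w1) 0) => [s0|s0]; last first.
  by have := cancel _ _ z3 s0; lra.
have s1 : w0 - w1 != 0.
  apply: contra w00 => /eqP s1; apply/eqP; lra.
by have := cancel _ _ z4 s1; lra.
Qed.

End BinaryForms.

Section PowerSumPerturbation.
Context {R : realType} {n : nat}.
Variables (a b : 'I_n) (Y : 'I_3 -> 'rV[R]_n -> R) (N : 'I_3 -> R).
Implicit Types (ws : seq (R * ('I_n -> R))).

Lemma hess_powsum ws c d s : hess (powsum (size s + 2) ws) c d s =
  \sum_(w <- ws) w.1 * ((\prod_(i <- s) w.2 i) * (w.2 c * w.2 d)).
Proof.
rewrite /hess -[LHS]/(ders s (ders [:: d; c] (powsum (size s + 2) ws)) 0).
rewrite /ders -foldr_cat (_ : (size s + 2 = size (s ++ [:: d; c]))%N); last by rewrite size_cat.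
rewrite [LHS]ders_powsum_top; apply: eq_bigr => w _.
by rewrite big_cat/= !big_cons big_nil mulr1 [w.2 d * _]mulrC.
Qed.

Lemma dH_powsum ws s : dH a b Y N (powsum (size s + 2) ws) s = normal_part a b Y N *
  \sum_(w <- ws) w.1 * ((\prod_(i <- s) w.2 i) *
    bil (met Y a a 0) (met Y a b 0) (met Y b b 0) (w.2 a) (w.2 b) (w.2 a) (w.2 b)).
Proof.
rewrite /dH !hess_powsum; congr (_ * _); rewrite !mulr_suml mulr_sumr -sumrB -big_split/=.
by apply: eq_bigr => w _; rewrite /bil; ring.
Qed.

Lemma dK_powsum ws s : dK a b Y N (powsum (size s + 2) ws) s = normal_part a b Y N *
  \sum_(w <- ws) w.1 * ((\prod_(i <- s) w.2 i) *
    bil (sff a b Y a a 0) (sff a b Y a b 0) (sff a b Y b b 0) (w.2 a) (w.2 b) (w.2 a) (w.2 b)).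
Proof.
rewrite /dK !hess_powsum; congr (_ * _).
rewrite mulr_suml !mulr_sumr -big_split -sumrB /=.
by apply: eq_bigr => w _; rewrite /bil; ring.
Qed.

End PowerSumPerturbation.

Section Degenerate.
Context {R : realType}.
Implicit Types (Y : 'I_3 -> 'rV[R]_2 -> R).

Definition degenerate Y := [/\ 0 < fD 0 1 Y 0, exists i, der i (fL 0 1 Y) 0 != 0 &
  tangent_at (fL 0 1 Y) (fH 0 1 Y) 0].

Variable Y : 'I_3 -> 'rV[R]_2 -> R.
Hypotheses (sY : forall j, smooth 0 (Y j)) (dY : degenerate Y).

(** If [l = n = 0], then [K = 0] gives [m = 0], so dK = 0 and dL = 4 D dK = 0, against regularity.
    If no vector were transversal, every [sff] would be 0, being [normal_part] of a vector of second
    derivatives. *)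
Lemma degenerate_facts : [/\ fK 0 1 Y 0 = 0, sff 0 1 Y 0 0 0 != 0 \/ sff 0 1 Y 1 1 0 != 0 &
  exists N, normal_part 0 1 Y N != 0].
Proof.
have [D0 [i Li] [L0 H0 _]] := dY.
have K0 : fK 0 1 Y 0 = 0.
  move/eqP: L0; rewrite /fL H0 mulr0 add0r mulf_eq0 pnatr_eq0 /= mulf_eq0 (gt_eqF D0).
  by move/eqP.
have sS c d : smooth 0 (sff 0 1 Y c d) by exact: smooth_sff.
have ln : sff 0 1 Y 0 0 0 != 0 \/ sff 0 1 Y 1 1 0 != 0.
  case: (eqVneq (sff 0 1 Y 0 0 0) 0) => [l0|]; last by left.
  case: (eqVneq (sff 0 1 Y 1 1 0) 0) => [n0|]; last by right.
  exfalso; have m0 : sff 0 1 Y 0 1 0 = 0.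
    by apply/eqP; rewrite -sqrf_eq0 expr2 -oppr_eq0 -[X in _ == X]K0 /fK l0 mul0r add0r.
  have LE : {near (0 : 'rV[R]_2), fL 0 1 Y =1 fun q => fH 0 1 Y q ^+ 2 + 4 * (fD 0 1 Y q * fK 0 1 Y q)}.
    by near=> q; rewrite expr2.
  have := der_discriminant (smooth_fH 0 1 sY) (smooth_fK 0 1 sY) (smooth_fD 0 1 sY) LE i H0 K0.
  have -> : der i (fK 0 1 Y) 0 = 0.
    rewrite derB; [|exact: smoothM|exact: smoothM].
    by rewrite !derM// l0 m0 n0 !(mulr0, mul0r) !addr0 subrr.
  by rewrite mulr0 => /eqP; rewrite (negPf Li).
split=> //; have [//|no] := pselect (exists N, normal_part 0 1 Y N != 0); exfalso.
have Z N : normal_part 0 1 Y N = 0.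
  by apply/eqP; apply: contrapT => h; apply: no; exists N; apply/negP.
have S c d : sff 0 1 Y c d 0 = 0 by rewrite -(Z (fun j => der d (der c (Y j)) 0)).
by case: ln; rewrite S eqxx.
Unshelve. all: by end_near.
Qed.

Let vec2 (u v : R) : 'I_2 -> R := fun i => if i == 0 then u else v.

Let E := met Y 0 0 0. Let F := met Y 0 1 0. Let G := met Y 1 1 0.
Let l := sff 0 1 Y 0 0 0. Let m := sff 0 1 Y 0 1 0. Let n := sff 0 1 Y 1 1 0.

(* Let xi and eta be the linear forms with coefficients x and y given by
   [adapted_frame].  The cubic p2 xi^2 eta + p3 xi eta^2, polarized into cubes,
   changes dH by nu ((4 f p2 + 2 g p3) xi + 4 f p3 eta) and dL by
   8 D nu h p3 xi; the pair (p2, p3) is chosen to keep dL and dH proportional. *)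
Lemma make_regular : (forall i, der i (fH 0 1 Y) 0 = 0) ->
  exists N (r : seq nat) (w : R -> nat -> R) (al : nat -> 'I_2 -> R),
  (forall i, w e i @[e --> (0 : R)] --> (0 : R)) /\
  forall e, e != 0 ->
    let Y' := perturb Y N (powsum 3 [seq (w e i, al i) | i <- r]) in
    degenerate Y' /\ exists i, der i (fH 0 1 Y') 0 != 0.
Proof.
move=> dH0; have [D0 dL [L0 H0 _]] := dY; have [K0 ln [N nu0]] := degenerate_facts.
have [x0 [x1 [y0 [y1 [xy Q1x Q2x Q1xy Q2xy]]]]] := adapted_frame D0 H0 K0 ln.
set f := bil _ _ _ _ _ _ _ in Q1xy.
pose g := bil E F G y0 y1 y0 y1; pose h := bil l m n y0 y1 y0 y1.
set nu := normal_part 0 1 Y N in nu0.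
pose L0' := der 0 (fL 0 1 Y) 0; pose L1' := der 1 (fL 0 1 Y) 0; pose D := fD 0 1 Y 0.
pose W := x0 * y1 - x1 * y0.
(* Coordinates of dL in the basis (x, y), by Cramer's rule. *)
pose A := (L0' * y1 - L1' * y0) / W; pose B := (x0 * L1' - x1 * L0') / W.
have LA0 : L0' = A * x0 + B * y0 by rewrite /A /B /W; field.
have LA1 : L1' = A * x1 + B * y1 by rewrite /A /B /W; field.
(* Proportionality requires [B (4 f p2 + 2 g p3) = 4 f p3 (A + 8 D nu h p3)]. If [B != 0], take
   [p3 = e] and solve for [p2]; if [B = 0], take [p3 = 0], so that dL and dH are both multiples of
   xi. *)
pose p3 e : R := if B == 0 then 0 else e.
pose p2 e : R := if B == 0 then e else ((A + 8 * D * nu * h * e) / B - g / (2 * f)) * e.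
have c3 : p3 e @[e --> (0 : R)] --> (0 : R).
  by rewrite /p3; case: (B == 0); [exact: cvg_cst|exact: cvg_id].
have c2 : p2 e @[e --> (0 : R)] --> (0 : R).
  rewrite /p2; case: (B == 0); first exact: cvg_id.
  rewrite [X in _ --> X](_ : 0 = ((A + 8 * D * nu * h * 0) / B - g / (2 * f)) * 0); last by rewrite mulr0.
  apply: cvgM; last exact: cvg_id; apply: cvgB; last exact: cvg_cst.
  apply: cvgM; last exact: cvg_cst; apply: cvgD; first exact: cvg_cst.
  by apply: cvgM; [exact: cvg_cst|exact: cvg_id].
(* Polarization: [(xi + eta)^3 + (xi - eta)^3 - 2 xi^3 = 6 xi eta^2] and [(xi + eta)^3 - (xi -
   eta)^3 - 2 eta^3 = 6 xi^2 eta]; the 6 is absorbed by the divided powers. *)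
pose w e i := nth 0 [:: p3 e + p2 e; p3 e - p2 e; - 2 * p3 e; - 2 * p2 e] i.
pose al i := nth (vec2 0 0) [:: vec2 (x0 + y0) (x1 + y1); vec2 (x0 - y0) (x1 - y1);
   vec2 x0 x1; vec2 y0 y1] i.
exists N, (iota 0 4), w, al; split.
  case=> [|[|[|[|i]]]]; rewrite /w /=.
  - by have := cvgD c3 c2; rewrite addr0; apply.
  - by have := cvgB c3 c2; rewrite subr0; apply.
  - by have := cvgM (cvg_cst (- 2 : R)) c3; rewrite mulr0; apply.
  - by have := cvgM (cvg_cst (- 2 : R)) c2; rewrite mulr0; apply.
  - by rewrite nth_nil; exact: cvg_cst.
move=> e e0 Y'; pose P := powsum 3 [seq (w e i, al i) | i <- iota 0 4].
have sP : smooth 0 P by exact: smooth_powsum.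
have fP : flat 3 P by exact: flat_powsum.
have [sH sH' dHs dHz] := dev_fH 0 1 N sY sP (ltnSn 0) fP.
have [sL sL' dLs dLz] := dev_fL 0 1 N sY sP (ltnSn 0) fP.
have [_ _ dDs _] := dev_fD 0 1 N sY sP (ltnSn 0) fP.
have S A' B' C' i : bil A' B' C' x0 x1 x0 x1 = 0 ->
    \sum_(v <- [seq (w e j, al j) | j <- iota 0 4]) v.1 *
      ((\prod_(c <- [:: i]) v.2 c) * bil A' B' C' (v.2 0) (v.2 1) (v.2 0) (v.2 1)) =
    (4 * bil A' B' C' x0 x1 y0 y1 * p2 e + 2 * bil A' B' C' y0 y1 y0 y1 * p3 e) * vec2 x0 x1 i +
    4 * bil A' B' C' x0 x1 y0 y1 * p3 e * vec2 y0 y1 i.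
  move=> Qx; rewrite !big_map !big_cons !big_nil !mulr1 /w /al /=.
  have -> v0 v1 : (vec2 v0 v1 0 = v0) by [].
  have -> v0 v1 : (vec2 v0 v1 1 = v1) by [].
  have vD : vec2 (x0 + y0) (x1 + y1) i = vec2 x0 x1 i + vec2 y0 y1 i by rewrite /vec2; case: ifP.
  have vB : vec2 (x0 - y0) (x1 - y1) i = vec2 x0 x1 i - vec2 y0 y1 i by rewrite /vec2; case: ifP.
  have -> : bil A' B' C' (x0 + y0) (x1 + y1) (x0 + y0) (x1 + y1) = bil A' B' C' x0 x1 x0 x1
     + 2 * bil A' B' C' x0 x1 y0 y1 + bil A' B' C' y0 y1 y0 y1 by rewrite /bil; ring.
  have -> : bil A' B' C' (x0 - y0) (x1 - y1) (x0 - y0) (x1 - y1) = bil A' B' C' x0 x1 x0 x1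
     - 2 * bil A' B' C' x0 x1 y0 y1 + bil A' B' C' y0 y1 y0 y1 by rewrite /bil; ring.
  by rewrite Qx vD vB; ring.
have dHi i : dH 0 1 Y N P [:: i] = nu * ((4 * f * p2 e + 2 * g * p3 e) * vec2 x0 x1 i +
    4 * f * p3 e * vec2 y0 y1 i).
  rewrite [LHS](dH_powsum 0 1 Y N [seq (w e i, al i) | i <- iota 0 4] [:: i]).
  by congr (_ * _); exact: S.
have dKi i : dK 0 1 Y N P [:: i] = nu * (2 * h * p3 e * vec2 x0 x1 i).
  rewrite [LHS](dK_powsum 0 1 Y N [seq (w e i, al i) | i <- iota 0 4] [:: i]).
  congr (_ * _); apply: etrans (S _ _ _ _ Q2x) _.
  by rewrite Q2xy !mulr0 !mul0r add0r addr0.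
have H'i i : der i (fH 0 1 Y') 0 = nu * ((4 * f * p2 e + 2 * g * p3 e) * vec2 x0 x1 i +
    4 * f * p3 e * vec2 y0 y1 i).
  by rewrite -dHi; have := dHs [:: i] (leqnn 1); rewrite /= dH0 add0r.
have L'i i : der i (fL 0 1 Y') 0 = der i (fL 0 1 Y) 0 + 8 * D * nu * h * p3 e * vec2 x0 x1 i.
  have := dLs [:: i] (leqnn 1); rewrite /= => ->; rewrite H0 dKi -/D; ring.
have L'0 : der 0 (fL 0 1 Y') 0 = (A + 8 * D * nu * h * p3 e) * x0 + B * y0.
  by rewrite L'i -/L0' LA0 /vec2 /=; ring.
have L'1 : der 1 (fL 0 1 Y') 0 = (A + 8 * D * nu * h * p3 e) * x1 + B * y1.
  by rewrite L'i -/L1' LA1 /vec2 /=; ring.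
have H'0 : der 0 (fH 0 1 Y') 0 = nu * ((4 * f * p2 e + 2 * g * p3 e) * x0 + 4 * f * p3 e * y0).
  by rewrite H'i.
have H'1 : der 1 (fH 0 1 Y') 0 = nu * ((4 * f * p2 e + 2 * g * p3 e) * x1 + 4 * f * p3 e * y1).
  by rewrite H'i.
have indep (s t : R) : s * x0 + t * y0 = 0 -> s * x1 + t * y1 = 0 -> s = 0 /\ t = 0.
  move=> h0 h1; split; apply/eqP.
    suff : s * W == 0 by rewrite mulf_eq0 (negPf xy) orbF.
    apply/eqP; transitivity (y1 * (s * x0 + t * y0) - y0 * (s * x1 + t * y1)); first by rewrite /W; ring.
    by rewrite h0 h1 !mulr0 subr0.
  suff : t * W == 0 by rewrite mulf_eq0 (negPf xy) orbF.
  apply/eqP; transitivity (x0 * (s * x1 + t * y1) - x1 * (s * x0 + t * y0)); first by rewrite /W; ring.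
  by rewrite h0 h1 !mulr0 subr0.
have exi (q : 'rV[R]_2 -> R) (s t : R) : der 0 q 0 = s * x0 + t * y0 -> der 1 q 0 = s * x1 + t * y1 ->
    s != 0 \/ t != 0 -> exists i, der i q 0 != 0.
  move=> q0 q1 st; case: (eqVneq (der 0 q 0) 0) => [z0|]; last by exists 0.
  case: (eqVneq (der 1 q 0) 0) => [z1|]; last by exists 1.
  by have [] := indep s t; rewrite -?q0 -?q1// => s0 t0; case: st; rewrite ?s0 ?t0 eqxx.
split; last first.
  apply: (exi _ (nu * (4 * f * p2 e + 2 * g * p3 e)) (nu * (4 * f * p3 e))).
  - by rewrite H'0; ring.
  - by rewrite H'1; ring.
  rewrite /p2 /p3; case: ifP => _; [left|right]; rewrite ?mulr0 ?addr0 !mulf_neq0// pnatr_eq0//.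
split.
- by have := dDs [::] (leq0n 1); rewrite /= addr0 => ->.
- apply: (exi _ _ _ L'0 L'1).
  rewrite /p3; case: (eqVneq B 0) => [B0|B0]; [left|by right].
  rewrite mulr0 addr0; apply/eqP => A0; case: dL => i; case: (ord2P i) => ->.
    by rewrite -/L0' LA0 A0 B0 !mul0r addr0 eqxx.
  by rewrite -/L1' LA1 A0 B0 !mul0r addr0 eqxx.
- split.
  + by have := dLs [::] (leq0n 1); rewrite /= dLz// addr0 => ->.
  + by have := dHs [::] (leq0n 1); rewrite /= dHz// addr0 => ->.
  rewrite /jac L'0 L'1 H'0 H'1 /p2 /p3; case: (eqVneq B 0) => [->|B0]; first by ring.
  by field; rewrite B0 Q1xy.
Qed.

(** If the quadratic form were zero, [4 D (l, m, n) = lam (E, F, G)]; comparing discriminants,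
    [lam^2 D = - (4 D)^2 K = 0], so [lam = 0] and [l = n = 0], against [degenerate_facts]. Then
    [quadratic_nonzero] applies. *)
Lemma split_form lam w0 w1 : w0 != 0 \/ w1 != 0 -> exists x0 x1,
  4 * fD 0 1 Y 0 * bil l m n x0 x1 x0 x1 - lam * bil E F G x0 x1 x0 x1 != 0 /\
  x0 * w0 + x1 * w1 != 0.
Proof.
move=> w01; have [D0 _ _] := dY; have [K0 ln _] := degenerate_facts.
pose D := fD 0 1 Y 0.
have [||x0 [x1 [Q0 w0']]] := @quadratic_nonzero R (4 * D * l - lam * E) (4 * D * m - lam * F)
    (4 * D * n - lam * G) w0 w1; last 2 first.
- exact: w01.
- exists x0, x1; split=> //; rewrite -/D.
  rewrite (_ : _ - _ = bil (4 * D * l - lam * E) (4 * D * m - lam * F) (4 * D * n - lam * G) x0 x1 x0 x1)//.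
  by rewrite /bil; ring.
case: (eqVneq (4 * D * l - lam * E) 0) => [e1|e1]; last exact: Or31.
case: (eqVneq (4 * D * m - lam * F) 0) => [e2|e2]; last exact: Or32.
case: (eqVneq (4 * D * n - lam * G) 0) => [e3|e3]; last exact: Or33.
exfalso; have D40 : 4 * D != 0 by rewrite mulf_neq0 ?pnatr_eq0// gt_eqF.
have lam0 : lam = 0.
  have : lam ^+ 2 * D = 0.
    transitivity ((lam * F) * (lam * F) - (lam * E) * (lam * G)); first by rewrite /D /fD -/E -/F -/G; ring.
    rewrite -(subr0_eq e1) -(subr0_eq e2) -(subr0_eq e3).
    transitivity (- (4 * D) ^+ 2 * fK 0 1 Y 0); first by rewrite /fK -/l -/m -/n; ring.
    by rewrite K0 mulr0.
  by move/eqP; rewrite mulf_eq0 (gt_eqF D0) orbF sqrf_eq0 => /eqP.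
have z t u : 4 * D * t - lam * u = 0 -> t = 0.
  by rewrite lam0 mul0r subr0 => /eqP; rewrite mulf_eq0 (negPf D40) => /eqP.
by have [l0 n0] := conj (z _ _ e1) (z _ _ e3); case: ln => /negP[]; apply/eqP.
Qed.

Lemma fold_atE (L H : 'rV[R]_2 -> R) p : smooth p L -> smooth p H ->
  fold_at L H p =
  (ders [:: 0; 0] L p * der 1 H p + der 0 L p * ders [:: 0; 1] H p
   - (ders [:: 0; 1] L p * der 0 H p + der 1 L p * ders [:: 0; 0] H p)) * der 1 H p -
  (ders [:: 1; 0] L p * der 1 H p + der 0 L p * ders [:: 1; 1] H p
   - (ders [:: 1; 1] L p * der 0 H p + der 1 L p * ders [:: 1; 0] H p)) * der 0 H p.
Proof.
move=> sL sH; have sd i : smooth p (der i L) /\ smooth p (der i H) by split; exact: smooth_der.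
have [[sL0 sH0] [sL1 sH1]] := conj (sd 0) (sd 1).
have jE c : der c (jac 0 1 L H) p = ders [:: c; 0] L p * der 1 H p + der 0 L p * ders [:: c; 1] H p
   - (ders [:: c; 1] L p * der 0 H p + der 1 L p * ders [:: c; 0] H p).
  by rewrite derB ?derM//; exact: smoothM.
by rewrite /fold_at {1}/jac !jE.
Qed.

(* With dL = lam dH, the quartic e al^4 / 24 changes the fold by
   nu e (al . w)^2 (4 D Q2 - lam Q1) (al), where w = (H_1, - H_0). *)
Lemma make_fold : (exists i, der i (fH 0 1 Y) 0 != 0) -> fold_at (fL 0 1 Y) (fH 0 1 Y) 0 = 0 ->
  exists N (al : 'I_2 -> R), forall e, e != 0 ->
    let Y' := perturb Y N (powsum 4 [:: (e, al)]) in
    degenerate Y' /\ fold_at (fL 0 1 Y') (fH 0 1 Y') 0 != 0.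
Proof.
move=> dHk W0; have [D0 dL [L0 H0 J0]] := dY; have [K0 ln [N nu0]] := degenerate_facts.
set nu := normal_part 0 1 Y N in nu0.
have [lam La] : exists lam, forall i, der i (fL 0 1 Y) 0 = lam * der i (fH 0 1 Y) 0.
  move: J0; rewrite /jac; case: dHk => i; case: (ord2P i) => -> hi J0.
    exists (der 0 (fL 0 1 Y) 0 / der 0 (fH 0 1 Y) 0) => j; case: (ord2P j) => ->.
      by rewrite divfK.
    apply: (mulIf hi); rewrite mulrAC divfK//; exact/esym/subr0_eq.
  exists (der 1 (fL 0 1 Y) 0 / der 1 (fH 0 1 Y) 0) => j; case: (ord2P j) => ->.
    by apply: (mulIf hi); rewrite mulrAC divfK//; exact: subr0_eq.
  by rewrite divfK.
pose D := fD 0 1 Y 0; pose h0 := der 0 (fH 0 1 Y) 0; pose h1 := der 1 (fH 0 1 Y) 0.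
have [|x0 [x1 [Q0 w0]]] := @split_form lam h1 (- h0).
  by case: dHk => i; case: (ord2P i) => -> hi; [right; rewrite oppr_eq0|left].
exists N, (vec2 x0 x1) => e e0 Y'.
pose P := powsum 4 [:: (e, vec2 x0 x1)].
have sP : smooth 0 P by exact: smooth_powsum.
have fP : flat 4 P by exact: flat_powsum.
have [sH sH' dHs dHz] := dev_fH 0 1 N sY sP (ltn0Sn 1) fP.
have [sL sL' dLs dLz] := dev_fL 0 1 N sY sP (ltn0Sn 1) fP.
have [_ _ dDs _] := dev_fD 0 1 N sY sP (ltn0Sn 1) fP.
have Hi s : (size s < 2)%N -> ders s (fH 0 1 Y') 0 = ders s (fH 0 1 Y) 0.
  by move=> s2; rewrite (dHs s (ltnW s2)) (dHz s s2) addr0.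
have Li s : (size s < 2)%N -> ders s (fL 0 1 Y') 0 = ders s (fL 0 1 Y) 0.
  by move=> s2; rewrite (dLs s (ltnW s2)) (dLz s s2) addr0.
pose v := vec2 x0 x1; pose q1 := bil E F G x0 x1 x0 x1; pose q2 := bil l m n x0 x1 x0 x1.
have H'ij i j : ders [:: i; j] (fH 0 1 Y') 0 = ders [:: i; j] (fH 0 1 Y) 0 + nu * (e * (v i * v j * q1)).
  rewrite (dHs [:: i; j] (leqnn 2)) [dH _ _ _ _ _ _](dH_powsum 0 1 Y N [:: (e, v)] [:: i; j]).
  by rewrite big_seq1 !big_cons big_nil mulr1.
have K'ij i j : dK 0 1 Y N P [:: i; j] = nu * (e * (v i * v j * q2)).
  by rewrite [LHS](dK_powsum 0 1 Y N [:: (e, v)] [:: i; j]) big_seq1 !big_cons big_nil mulr1.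
have L'ij i j : ders [:: i; j] (fL 0 1 Y') 0 = ders [:: i; j] (fL 0 1 Y) 0 + 4 * D * (nu * (e * (v i * v j * q2))).
  by rewrite (dLs [:: i; j] (leqnn 2)) H0 K'ij -/D; ring.
split; first split.
- by have := dDs [::] (leq0n 2); rewrite /= addr0 => ->.
- by case: dL => i hi; exists i; rewrite [der i _ 0](Li [:: i]).
- split; [by rewrite [LHS](Li [::])|by rewrite [LHS](Hi [::])|].
  move: J0; rewrite /jac.
  have H1 i : der i (fH 0 1 Y') 0 = der i (fH 0 1 Y) 0 by exact: (Hi [:: i]).
  have L1 i : der i (fL 0 1 Y') 0 = der i (fL 0 1 Y) 0 by exact: (Li [:: i]).
  by rewrite !H1 !L1.
have H1 i : der i (fH 0 1 Y') 0 = der i (fH 0 1 Y) 0 by exact: (Hi [:: i]).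
have L1 i : der i (fL 0 1 Y') 0 = der i (fL 0 1 Y) 0 by exact: (Li [:: i]).
have -> : fold_at (fL 0 1 Y') (fH 0 1 Y') 0 = fold_at (fL 0 1 Y) (fH 0 1 Y) 0 +
   nu * e * ((x0 * h1 + x1 * - h0) ^+ 2 * (4 * D * bil l m n x0 x1 x0 x1 - lam * bil E F G x0 x1 x0 x1)).
  rewrite (fold_atE sL sH) (fold_atE sL' sH') !H'ij !L'ij !H1 !L1 !La -/h0 -/h1.
  have -> : v 0 = x0 by []. have -> : v 1 = x1 by [].
  rewrite /q1 /q2 /bil; ring.
by rewrite W0 add0r !mulf_neq0 ?expf_neq0.
Qed.

End Degenerate.

(** * Germs of surfaces *)

Section FoldPoints.
Context {R : realType}.
Implicit Types (x : 'rV[R]_2 -> 'rV[R]_3).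

Definition fold_point x := [/\ 0 < delta x 0, exists i, der i (LPL x) 0 != 0 &
  tangent_at (LPL x) (MCNC x) 0].

Lemma near_sym (f g : 'rV[R]_2 -> R) (p : 'rV[R]_2) : {near p, f =1 g} -> {near p, g =1 f}.
Proof. by apply: filterS => u. Qed.

Lemma degenerateE x : smooth_at 0 x -> (fold_point x <-> degenerate (coords x)) /\
  fold_at (LPL x) (MCNC x) 0 = fold_at (fL 0 1 (coords x)) (fH 0 1 (coords x)) 0.
Proof.
move=> sx; have [eD _ eH eL] := near_invariantsE sx.
have [t1 t2] := near_eq_tangent eL eH.
have [t3 _] := near_eq_tangent (near_sym eL) (near_sym eH).
split; last exact: t2.
split=> -[D0 [i hi] ht]; (split; [|exists i|]).
- by rewrite -(nbhs_singleton eD).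
- by rewrite -(near_eq_der i eL).
- exact: t1.
- by rewrite (nbhs_singleton eD).
- by rewrite (near_eq_der i eL).
- exact: t3.
Qed.

Lemma G1_paramE x : smooth_at 0 x -> G1_param x <-> fold_point x.
Proof.
move=> sx; have [sD sK sH sL] := smooth_invariants sx; have LE := near_discriminant sx.
split=> [[D0 /regularE[L0 rL] c]|[D0 rL [L0 H0 J0]]].
  have [H0 J0] := contact_gt2_tangent sL sH sK sD LE c.
  by split.
split=> //; first exact/regularE.
exact: contact_gt2_of_tangent sL sH sK sD D0 LE L0 rL H0 J0.
Qed.

End FoldPoints.

Section SurfaceGerms.
Context {R : realType}.
Implicit Types (x y : local_param R) (M : surface_germ R).

Let inv x := fold_point (param_fun x).
Let W x := fold_at (LPL (param_fun x)) (MCNC (param_fun x)) 0.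
Let tang x := tangent_at (LPL (param_fun x)) (MCNC (param_fun x)) 0.

Lemma param_smooth x : smooth_at 0 (param_fun x).
Proof. exact: (proj1 (set_valP (x : set_type (@immersion_germ R)))). Qed.

Lemma reparam_sym x y : reparam x y -> reparam y x.
Proof.
move=> [phi [sphi phi0 [psi [spsi psi0 psiphi phipsi]]] xy].
exists psi; first by split=> //; exists phi; split.
have cpsi : psi u @[u --> (0 : 'rV[R]_2)] --> (0 : 'rV[R]_2).
  rewrite -[X in _ --> X]psi0; apply: cvg_smooth_row; exact/smooth_rowP.
have nx : \forall u \near (0 : 'rV[R]_2), param_fun x (psi u) = param_fun y (phi (psi u)).
  exact: (cpsi _ xy).
by apply: filterS2 nx phipsi => u -> ->.
Qed.

(** As [reparam] is symmetric, invariance in one direction is an equivalence, and this passes to the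
    generated relation. *)
Lemma same_surface_ind (Q : local_param R -> Prop) :
  (forall x y, reparam x y -> Q y -> Q x) ->
  forall x y, surface_of x = surface_of y -> Q y -> Q x.
Proof.
move=> H x y /eqmodP/asboolP xy; suff : Q x <-> Q y by case.
elim: xy => {x y} [x y xy|x|x y _ [h1 h2]|x y z _ [h1 h2] _ [h3 h4]] //.
- by split; [apply/H/reparam_sym|exact: H].
- by split; auto.
Qed.

Lemma fold_point_same x y : surface_of x = surface_of y -> inv y -> inv x.
Proof.
apply: (@same_surface_ind inv) => {}x {}y [phi dphi xy] [D0 rL [L0 H0 J0]].
have [sx sy] := conj (param_smooth x) (param_smooth y).
have [L0' rL'] := reparam_regular sx sy dphi xy L0 rL.
have [|t _] := reparam_tangent sx sy dphi xy; first by split.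
by split; [exact: reparam_delta sx sy dphi xy D0|exact: rL'|exact: t].
Qed.

(** The vanishing of [W] is joined to the tangency because the transformation rule of [W] holds at
    tangencies only. With no positivity or regularity condition, this set is closed and saturated,
    so its complement comes from an open set of the quotient. *)
Definition flat_tangency x := tang x /\ W x = 0.

Lemma flat_tangency_same x y : surface_of x = surface_of y -> flat_tangency y -> flat_tangency x.
Proof.
apply: (@same_surface_ind flat_tangency) => {}x {}y [phi dphi xy] [t w].
have [sx sy] := conj (param_smooth x) (param_smooth y).
have [t' [c c0 wE]] := reparam_tangent sx sy dphi xy t.
by split; [exact: t'|exact: etrans wE (etrans (congr1 _ w) (mulr0 c))].
Qed.

Lemma jetc_coords j : jetc (fun x : local_param R => coords (param_fun x) j).
Proof.
split=> [x|s x]; first by have /smooth_rowP := param_smooth x; apply.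
rewrite (_ : (fun y : local_param R => _) = fun y : local_param R => pds s (param_fun y) 0 0 j); last first.
  by apply/funext => y; rewrite pds_row//; exact: param_smooth.
rewrite -(pds_row s j (param_smooth x)).
have cJ := @jets_continuous R _ _ _ (fun x : set_type (@immersion_germ R) => jet (set_val x)) s x.
exact: (cvg_comp _ _ cJ (@coord_continuous R 1 3 0 j _)).
Qed.

Lemma open_flat_tangency : open (~` flat_tangency : set (local_param R)).
Proof.
pose Y (x : local_param R) := coords (param_fun x).
have cL : jetc (fun x => fL 0 1 (Y x)) by apply: jetc_fL => j; exact: jetc_coords.
have cH : jetc (fun x => fH 0 1 (Y x)) by apply: jetc_fH => j; exact: jetc_coords.
have cJ (F G : local_param R -> 'rV[R]_2 -> R) : jetc F -> jetc G -> jetc (fun x => jac 0 1 (F x) (G x)).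
  by move=> cF cG; apply: jetcB; apply: jetcM; exact: jetc_der.
have cj := cJ _ _ cL cH; have cw := cJ _ _ cj cH.
have E x : flat_tangency x <-> [/\ fL 0 1 (Y x) 0 = 0, fH 0 1 (Y x) 0 = 0,
    jac 0 1 (fL 0 1 (Y x)) (fH 0 1 (Y x)) 0 = 0 & fold_at (fL 0 1 (Y x)) (fH 0 1 (Y x)) 0 = 0].
  have [eD _ eH eL] := near_invariantsE (param_smooth x).
  have [t1 t2] := near_eq_tangent eL eH.
  have [t3 _] := near_eq_tangent (near_sym eL) (near_sym eH).
  rewrite /flat_tangency /W t2; split=> [[/t1[]]//|[h1 h2 h3 h4]].
  by split=> //; exact: t3.
have near_c (F : local_param R -> 'rV[R]_2 -> R) (x : local_param R) :
    jetc F -> F x 0 != 0 -> \forall y \near x, F y 0 != 0.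
  move=> [_ /(_ [::] x) cF] F0.
  exact: (@cvgr_neq0 R R^o _ (nbhs x) (nbhs_filter x) (fun y => F y 0) (F x 0)).
rewrite openE => x bad; rewrite /interior.
case: (eqVneq (fL 0 1 (Y x) 0) 0) => [h1|h1]; last first.
  by apply: filterS (near_c _ _ cL h1) => y hy /E[e]; rewrite e eqxx in hy.
case: (eqVneq (fH 0 1 (Y x) 0) 0) => [h2|h2]; last first.
  by apply: filterS (near_c _ _ cH h2) => y hy /E[_ e]; rewrite e eqxx in hy.
case: (eqVneq (jac 0 1 (fL 0 1 (Y x)) (fH 0 1 (Y x)) 0) 0) => [h3|h3]; last first.
  by apply: filterS (near_c _ _ cj h3) => y hy /E[_ _ e]; rewrite e eqxx in hy.
case: (eqVneq (fold_at (fL 0 1 (Y x)) (fH 0 1 (Y x)) 0) 0) => [h4|h4]; last first.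
  by apply: filterS (near_c _ _ cw h4) => y hy /E[_ _ _ e]; rewrite /fold_at in e; rewrite e eqxx in hy.
by exfalso; apply: bad; exact/E.
Qed.

(** Density is obtained along paths of parametrizations. Applied to the closure of the good set, it
    allows successive approximations: first to make dH nonzero, then [W]. *)
Lemma closed_path (C : set (surface_germ R)) (y : R -> local_param R) x : closed C ->
  y e @[e --> (0 : R)] --> x -> (forall e, e != 0 -> C (surface_of (y e))) -> C (surface_of x).
Proof.
move=> cC yx Cy; have sy : surface_of (y e) @[e --> (0 : R)^'] --> surface_of x.
  have cpi : continuous (@surface_of R) by exact: pi_continuous.
  have yx' : y e @[e --> (0 : R)^'] --> x by exact: cvg_within_filter yx.
  exact: cvg_comp yx' (cpi x).
have nC : \forall e \near (0 : R)^', C (surface_of (y e)).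
  by apply: filterS (nbhs_dnbhs_neq (0 : R)) => e; exact: Cy.
exact: (@closed_cvg _ _ _ (@Proper_dnbhs_numFieldType R 0) (fun e => surface_of (y e)) _ cC nC _ sy).
Qed.

(** Topologically, the set of the theorem enters only through its description by [W]. *)
Variable A : set (surface_germ R).
Hypothesis AE : forall M, A M <-> G1 M /\ forall x, surface_of x = M -> W x != 0.

Lemma A_of x : inv x -> W x != 0 -> A (surface_of x).
Proof.
move=> ix wx; apply/AE; split; first by exists x => //; apply/G1_paramE => //; exact: param_smooth.
move=> y yx; apply: contra wx => /eqP wy.
have iy : inv y := fold_point_same yx ix.
by apply/eqP; apply: (proj2 (flat_tangency_same (esym yx) _)); split=> //; case: iy.
Qed.

Lemma param_bump x y N P : param_fun y = bump (param_fun x) N P ->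
  let Y' := perturb (coords (param_fun x)) N P in
  [/\ degenerate Y' -> inv y, W y = fold_at (fL 0 1 Y') (fH 0 1 Y') 0 &
    forall i, der i (fH 0 1 Y') 0 = der i (fH 0 1 (coords (param_fun y))) 0].
Proof.
move=> yE Y'; have cE : coords (param_fun y) = Y' by rewrite yE coords_bump.
have [d1 d2] := degenerateE (param_smooth y); rewrite cE in d1 d2.
by split=> [/d1//|//|i]; rewrite cE.
Qed.

Lemma dense_regular x : inv x -> (exists i, der i (fH 0 1 (coords (param_fun x))) 0 != 0) ->
  closure A (surface_of x).
Proof.
move=> ix hx; case: (eqVneq (W x) 0) => [w0|w0]; last exact/subset_closure/A_of.
have sx j : smooth 0 (coords (param_fun x) j) by have /smooth_rowP := param_smooth x; apply.
have [dE wE] := degenerateE (param_smooth x).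
have dx : degenerate (coords (param_fun x)) by apply/dE.
rewrite /W wE in w0.
have [N [al H]] := make_fold sx dx hx w0.
have [| | |y [yE yx]] := @bump_path R x N (fun e => powsum 4 [:: (e, al)]).
- by move=> e; exact: smooth_powsum.
- by move=> e s s2; apply: flat_powsum; exact: ltn_trans s2 _.
- move=> s; apply: (@cvg_powsum R 2 4 unit [:: tt] (fun e _ => e) (fun=> al) s) => _; exact: cvg_id.
apply: (closed_path _ yx); first exact: closed_closure.
move=> e e0; apply: subset_closure; have [h1 h2] := H e e0.
by have [k1 k2 _] := param_bump (yE e); apply: A_of; [exact: k1|rewrite k2].
Qed.

Lemma dense_fold_point x : inv x -> closure A (surface_of x).
Proof.
move=> ix; have [|no] := pselect (exists i, der i (fH 0 1 (coords (param_fun x))) 0 != 0).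
  exact: dense_regular.
have sx j : smooth 0 (coords (param_fun x) j) by have /smooth_rowP := param_smooth x; apply.
have [dE wE] := degenerateE (param_smooth x).
have dx : degenerate (coords (param_fun x)) by apply/dE.
have [|N [r [w [al [w0 H]]]]] := make_regular sx dx.
  by move=> i; apply/eqP; apply: contrapT => h; apply: no; exists i; apply/negP.
have [| | |y [yE yx]] := @bump_path R x N (fun e => powsum 3 [seq (w e i, al i) | i <- r]).
- by move=> e; exact: smooth_powsum.
- by move=> e s s2; apply: flat_powsum; exact: ltn_trans s2 _.
- by move=> s; exact: cvg_powsum.
apply: (closed_path _ yx); first exact: closed_closure.
move=> e e0; have [h1 [i h2]] := H e e0; have [k1 _ k3] := param_bump (yE e).
by apply: dense_regular; [exact: k1|exists i; rewrite -k3].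
Qed.

Lemma G1_open_dense : open_dense_in (@G1 R) A.
Proof.
split; first by move=> M /AE[].
  pose O := [set M | ~ exists2 x, surface_of x = M & flat_tangency x] : set (surface_germ R).
  exists O.
    have : open ((@surface_of R) @^-1` O); last by [].
    rewrite (_ : _ @^-1` _ = ~` flat_tangency); first exact: open_flat_tangency.
    apply/seteqP; split=> x /= h; first by move=> fx; apply: h; exists x.
    by move=> [y yx fy]; apply: h; exact: flat_tangency_same (esym yx) fy.
  apply/seteqP; split=> M.
    move=> /AE[gM wM]; split=> //= -[x xM [_ w0]].
    by have := wM x xM; rewrite w0 eqxx.
  move=> [gM oM]; apply/AE; split=> // x xM; apply/eqP => w0; apply: oM; exists x => //.
  split=> //; case: gM => y /= gy yM.
  have : inv x by apply: (@fold_point_same _ y); [rewrite xM yM|exact/G1_paramE/gy/param_smooth].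
  by case.
move=> _ [x /= gx <-]; apply: dense_fold_point.
by apply/G1_paramE => //; exact: param_smooth.
Qed.

End SurfaceGerms.

(** * Deformations *)

Section Slices.
Context {R : realType}.
Implicit Types (F : 'rV[R]_(2 + 1) -> R) (Y : 'I_3 -> 'rV[R]_(2 + 1) -> R) (u : 'rV[R]_2) (t : R).

Definition space (k : 'I_2) : 'I_(2 + 1) := lshift 1 k.
Definition time : 'I_(2 + 1) := rshift 2 ord0.
Definition event u t : 'rV[R]_(2 + 1) := row_mx u (const_mx t).

Lemma event_space u t k : event u t 0 (space k) = u 0 k.
Proof. exact: row_mxEl. Qed.

Lemma event_time u t : event u t 0 time = t.
Proof. by rewrite /event row_mxEr mxE. Qed.

Lemma spacetimeP (j : 'I_(2 + 1)) : (exists k, j = space k) \/ j = time.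
Proof.
case: (split_ordP j) => k ->; first by left; exists k.
by right; rewrite (ord1 k).
Qed.

Lemma eventK (z : 'rV[R]_(2 + 1)) : event (lsubmx z) (z 0 time) = z.
Proof.
apply/rowP => j; case: (spacetimeP j) => [[k ->]|->].
  by rewrite event_space mxE.
by rewrite event_time.
Qed.

Lemma event00 : event 0 0 = 0 :> 'rV[R]_(2 + 1).
Proof. by rewrite -[RHS]eventK mxE; congr (event _ _); apply/rowP => j; rewrite !mxE. Qed.

Lemma event_norm u t r : `|u| < r -> `|t| < r -> `|event u t| < r.
Proof.
move=> ur tr; apply: (@le_lt_trans _ _ (Num.max `|u| `|t|)); last by rewrite gt_max ur.
apply: row_norm_le; first by rewrite le_max normr_ge0.
move=> j; case: (spacetimeP j) => [[k ->]|->].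
  by rewrite event_space le_max le_row_norm.
by rewrite event_time le_max lexx orbT.
Qed.

Lemma der_at_time k F t : der k (at_time F t) = at_time (der (space k) F) t.
Proof.
rewrite !derE; apply/funext => u; rewrite /pd /at_time /derive.
have E (h : R) : row_mx (h *: 'e_k + u) (const_mx t) = h *: 'e_(space k) + event u t :> 'rV[R]_(2 + 1).
  apply/rowP => j; case: (spacetimeP j) => [[l ->]|->].
    by rewrite [LHS]event_space [RHS]mxE event_space !mxE !eqxx.
  by rewrite [LHS]event_time [RHS]mxE event_time !mxE eq_rlshift andbF mulr0 add0r.
by under eq_fun do rewrite /= E.
Qed.

Lemma smooth_at_time F u t : smooth (event u t) F -> smooth u (at_time F t).
Proof.
apply: (@smooth_comp R 2 (2 + 1) u (fun u => event u t)) => j.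
case: (spacetimeP j) => [[l ->]|->].
  rewrite (_ : (fun q => _) = fun q : 'rV[R]_2 => q 0 l); first exact: smooth_coord.
  by apply/funext => q; rewrite event_space.
rewrite (_ : (fun q => _) = fun=> t); first exact: smooth_cst.
by apply/funext => q; rewrite event_time.
Qed.

Lemma met_at_time Y t c d u : met (fun j => at_time (Y j) t) c d u = met Y (space c) (space d) (event u t).
Proof. by rewrite /met !der_at_time. Qed.

Lemma sff_at_time Y t a b c d u : sff a b (fun j => at_time (Y j) t) c d u =
  sff (space a) (space b) Y (space c) (space d) (event u t).
Proof. by rewrite /sff !der_at_time. Qed.

Lemma forms_at_time Y t a b : let Yt j := at_time (Y j) t in
  [/\ fD a b Yt = at_time (fD (space a) (space b) Y) t,
      fH a b Yt = at_time (fH (space a) (space b) Y) t &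
      fL a b Yt = at_time (fL (space a) (space b) Y) t].
Proof.
move=> Yt; have mE c d u := met_at_time Y t c d u.
have sE c d u := sff_at_time Y t a b c d u.
by split; apply/funext => u; rewrite /at_time /fL /fH /fD /fK !mE ?sE.
Qed.

Lemma jac_at_time i k (F G : 'rV[R]_(2 + 1) -> R) t :
  jac i k (at_time F t) (at_time G t) = at_time (jac (space i) (space k) F G) t.
Proof. by apply/funext => u; rewrite /jac !der_at_time. Qed.

End Slices.

Section GraphDeformation.
Context {R : realType}.
Variables (i : 'I_3) (q : 'rV[R]_2) (f : 'rV[R]_2 -> R).
Implicit Types (h : 'rV[R]_(2 + 1) -> R) (t : R).

(** All the graphs of the family as one map on space and time; changing the deformation is then a
    vertical perturbation of this map, covered by the same lemmas as for surfaces. *)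
Definition track h (j : 'I_3) : 'rV[R]_(2 + 1) -> R := fun z =>
  if unlift i j is Some k then q 0 k + z 0 (space k) else f (lsubmx z) + h z.

Definition deformed h t := graph i q (fun u => f u + at_time h t u).

Lemma coords_deformed h t : coords (deformed h t) = fun j => at_time (track h j) t.
Proof.
apply/funext => j; apply/funext => u; rewrite /coords /deformed /graph !mxE /at_time /track.
case: (unlift i j) => [k|]; last by rewrite row_mxKl.
by rewrite mxE event_space.
Qed.

Hypothesis sf : smooth 0 f.

Lemma lsubmx_smooth (z : 'rV[R]_(2 + 1)) (k : 'I_2) : smooth z (fun z : 'rV[R]_(2 + 1) => lsubmx z 0 k).
Proof.
rewrite (_ : (fun z => _) = fun z : 'rV[R]_(2 + 1) => z 0 (space k)); first exact: smooth_coord.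
by apply/funext => w; rewrite mxE.
Qed.

Lemma smooth_height : smooth 0 (fun z : 'rV[R]_(2 + 1) => f (lsubmx z)).
Proof.
apply: (@smooth_comp R (2 + 1) 2 0 lsubmx); first exact: lsubmx_smooth.
by rewrite (_ : lsubmx 0 = 0)//; apply/rowP => k; rewrite !mxE.
Qed.

Lemma smooth_track h j : smooth 0 h -> smooth 0 (track h j).
Proof.
move=> sh; rewrite /track; case: (unlift i j) => [k|].
  by apply: smoothD; [exact: smooth_cst|exact: smooth_coord].
by apply: smoothD; [exact: smooth_height|].
Qed.

Definition vertical (j : 'I_3) : R := (j == i)%:R.

Lemma perturb_track h P : perturb (track h) vertical P = track (fun z => h z + P z).
Proof.
apply/funext => j; apply/funext => z; rewrite /perturb /track /vertical.
case: unliftP => [k ->|->]; first by rewrite eq_sym (negPf (neq_lift i k)) mul0r addr0.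
by rewrite eqxx mul1r addrA.
Qed.

Lemma der_track h c k : smooth 0 h -> der (space c) (track h (lift i k)) 0 = (c == k)%:R.
Proof.
move=> sh; rewrite /track liftK derD; [|exact: smooth_cst|exact: smooth_coord].
rewrite der_cst add0r der_coord; congr ((_ : bool)%:R).
Qed.

(** A graph is transversal to its vertical direction: the determinant is 1 or - 1, according to the
    position of the omitted coordinate. *)
Lemma normal_part_track h : smooth 0 h ->
  normal_part (space 0) (space 1) (track h) vertical != 0.
Proof.
move=> sh; have d (j : 'I_3) (k : 'I_2) : val j = val (lift i k) ->
    forall c, der (space c) (track h j) 0 = (c == k)%:R.
  by move=> /val_inj -> c; exact: der_track.
rewrite /normal_part /vertical; case: (ord3P i) (d) => -> {}d.
- rewrite !(d 1 0 erefl) !(d 2 1 erefl) /=.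
  by rewrite !(mulr0, mul0r, addr0, mulr1, subr0) oner_eq0.
- rewrite !(d 0 0 erefl) !(d 2 1 erefl) /=.
  by rewrite !(mulr0, mul0r, addr0, add0r, mulr1, subr0, sub0r) oppr_eq0 oner_eq0.
- rewrite !(d 0 0 erefl) !(d 1 1 erefl) /=.
  by rewrite !(mulr0, mul0r, addr0, add0r, mulr1, subr0) oner_eq0.
Qed.

End GraphDeformation.

Section InitialSlice.
Context {R : realType}.
Variables (F : 'rV[R]_(2 + 1) -> R) (g : 'rV[R]_2 -> R).
Hypothesis Fg : {near (0 : 'rV[R]_2), at_time F 0 =1 g}.

Lemma initial_value : F 0 = g 0.
Proof. by rewrite -(nbhs_singleton Fg) /at_time -[row_mx _ _]/(event 0 0) event00. Qed.

Lemma initial_der k : {near (0 : 'rV[R]_2), at_time (der (space k) F) 0 =1 der k g}.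
Proof.
rewrite -der_at_time; apply: filterS (near_join Fg) => u h; exact: near_eq_der.
Qed.

End InitialSlice.

Lemma initial_jac {R : realType} (F G : 'rV[R]_(2 + 1) -> R) (f g : 'rV[R]_2 -> R) a b :
  {near (0 : 'rV[R]_2), at_time F 0 =1 f} -> {near (0 : 'rV[R]_2), at_time G 0 =1 g} ->
  {near (0 : 'rV[R]_2), at_time (jac (space a) (space b) F G) 0 =1 jac a b f g}.
Proof.
move=> Ff Gg; have d k := initial_der Ff k; have e k := initial_der Gg k.
have n1 : \forall u \near (0 : 'rV[R]_2), at_time (der (space a) F) 0 u = der a f u /\
    at_time (der (space b) F) 0 u = der b f u by exact: filterI (d a) (d b).
have n2 : \forall u \near (0 : 'rV[R]_2), at_time (der (space a) G) 0 u = der a g u /\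
    at_time (der (space b) G) 0 u = der b g u by exact: filterI (e a) (e b).
apply: filterS2 n1 n2 => u [h1 h2] [h3 h4].
by rewrite /jac -h1 -h2 -h3 -h4.
Qed.

Section GraphBifurcation.
Context {R : realType}.
Variables (i : 'I_3) (q : 'rV[R]_2) (f : 'rV[R]_2 -> R).
Let G := graph i q f.
Hypotheses (sG : smooth_at 0 G) (fpG : fold_point G).
Hypothesis WG : fold_at (LPL G) (MCNC G) 0 != 0.

Lemma smooth_graph_height : smooth 0 f.
Proof.
rewrite (_ : f = coords G i); first by move/smooth_rowP: sG; apply.
by apply/funext => u; rewrite /coords mxE unlift_none.
Qed.

Let sf := smooth_graph_height.
Let Y (h : 'rV[R]_(2 + 1) -> R) := track i q f h.
Let L h := fL (space 0) (space 1) (Y h).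
Let H h := fH (space 0) (space 1) (Y h).
Let D h := fD (space 0) (space 1) (Y h).
Let K h := fK (space 0) (space 1) (Y h).
Let X := coords G.

Let sY h j : smooth 0 h -> smooth 0 (Y h j).
Proof. exact: smooth_track. Qed.

Let dX : degenerate X.
Proof. by have [e _] := degenerateE sG; apply/e. Qed.

Let WX : fold_at (fL 0 1 X) (fH 0 1 X) 0 != 0.
Proof. by have [_ <-] := degenerateE sG. Qed.

Let sX j : smooth 0 (X j). Proof. by move/smooth_rowP: sG; apply. Qed.

Section OneDeformation.
Variable h : 'rV[R]_(2 + 1) -> R.
Hypothesis h0 : \forall u \near (0 : 'rV[R]_2), at_time h 0 u = 0.

Lemma initial_track j : {near (0 : 'rV[R]_2), at_time (Y h j) 0 =1 X j}.
Proof.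
have E := coords_deformed i q f h 0.
apply: filterS h0 => u hu; rewrite -[LHS]/((fun j => at_time (Y h j) 0) j u) -E.
by rewrite /X /coords /G !mxE hu addr0.
Qed.

Lemma initial_forms : [/\ {near (0 : 'rV[R]_2), at_time (D h) 0 =1 fD 0 1 X},
  {near (0 : 'rV[R]_2), at_time (H h) 0 =1 fH 0 1 X} &
  {near (0 : 'rV[R]_2), at_time (L h) 0 =1 fL 0 1 X}].
Proof.
have [e1 e2 e3] := near_eq_invariants 0 1 initial_track.
have [g1 g2 g3] := forms_at_time (Y h) 0 0 1.
by rewrite g1 in e1; rewrite g2 in e2; rewrite g3 in e3.
Qed.

Lemma initial_quadratic_forms c d : met (Y h) (space c) (space d) 0 = met X c d 0 /\
  sff (space 0) (space 1) (Y h) (space c) (space d) 0 = sff 0 1 X c d 0.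
Proof.
have [em es] := nbhs_singleton (near_eq_forms 0 1 initial_track).
by rewrite -em -es met_at_time sff_at_time event00.
Qed.

End OneDeformation.

(* Whether the critical value of [L] on [H = 0] moves with the time *)
Definition turning k h := jac time (space k) (L h) (H h) 0.

Let jetc_deformation : jetc (@deformation_fun R).
Proof.
split=> [h|s h]; first by apply/smoothE; exact: (proj1 (set_valP (h : set_type (@deformation_germ R)))).
rewrite dersE (_ : (fun y : deformation => _) = fun y : deformation => pds s (deformation_fun y) 0); last first.
  by apply/funext => y; rewrite dersE.
exact: (@jets_continuous R _ _ _ (fun h : set_type (@deformation_germ R) => jet (set_val h)) s h).
Qed.

Let germP (h : @deformation R) : smooth 0 (deformation_fun h) /\
  \forall u \near (0 : 'rV[R]_2), at_time (deformation_fun h) 0 u = 0.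
Proof.
have [h1 h2] := set_valP (h : set_type (@deformation_germ R)).
by split=> //; exact/smoothE.
Qed.

Lemma open_turning k : open [set h : @deformation R | turning k (deformation_fun h) != 0].
Proof.
have cY j : jetc (fun h : @deformation R => Y (deformation_fun h) j).
  rewrite /Y /track; case: (unlift i j) => [l|].
    by apply: jetc_cst; apply: smoothD; [exact: smooth_cst|exact: smooth_coord].
  by apply: jetcD => //; apply: jetc_cst; exact: smooth_height.
have cL : jetc (fun h : @deformation R => L (deformation_fun h)) by exact: jetc_fL.
have cH : jetc (fun h : @deformation R => H (deformation_fun h)) by exact: jetc_fH.
have cj : jetc (fun h : @deformation R => jac time (space k) (L (deformation_fun h)) (H (deformation_fun h))).
  by apply: jetcB; apply: jetcM; exact: jetc_der.
rewrite openE => h hk; rewrite /interior.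
exact: (@cvgr_neq0 R R^o _ (nbhs h) (nbhs_filter h)
  (fun h => turning k (deformation_fun h)) (turning k (deformation_fun h)) (cj.2 [::] h) hk).
Qed.

(* The perturbation is a multiple of t l(u)^2, polarized into cubes: it vanishes
   at t = 0 and changes dL and dH in the direction of time only. *)
Lemma make_turning k (h : @deformation R) : der k (fH 0 1 X) 0 != 0 ->
  turning k (deformation_fun h) = 0 ->
  exists y : R -> @deformation R, y e @[e --> (0 : R)] --> h /\
    forall e, e != 0 -> turning k (deformation_fun (y e)) != 0.
Proof.
move=> hk t0; have [sh h0] := germP h; set h' := deformation_fun h in t0 sh h0 *.
pose lam := der k (fL 0 1 X) 0 / der k (fH 0 1 X) 0.
have [|x0 [x1 [Q0 _]]] := @split_form R X sX dX lam 1 0; first by left; exact: oner_neq0.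
pose al (s : R) : 'I_(2 + 1) -> R := fun j => if unlift time j is Some j' then
   (if j' == 0 then x0 else x1) else s.
pose be : 'I_(2 + 1) -> R := fun j => if unlift time j is Some j' then 0 else 1.
have al_time s : al s time = s by rewrite /al unlift_none.
have be_time : be time = 1 by rewrite /be unlift_none.
have sp0 : space 0 = lift time (0 : 'I_2) by exact/val_inj.
have sp1 : space 1 = lift time (1 : 'I_2) by exact/val_inj.
have al0 s : al s (space 0) = x0 by rewrite /al sp0 liftK.
have al1 s : al s (space 1) = x1 by rewrite /al sp1 liftK.
have be0 : be (space 0) = 0 by rewrite /be sp0 liftK.
have be1 : be (space 1) = 0 by rewrite /be sp1 liftK.
(* With l the linear form of coefficients [x0 x1], [(l + t)^3 - (l - t)^3 - 2 t^3 = 6 t l^2]; the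
   third form, t itself, is the default value [be] of [nth]. *)
pose wt (e : R) (j : nat) : R := nth 0 [:: e; - e; - 2 * e] j.
pose fo (j : nat) := nth be [:: al 1; al (- 1)] j.
pose P e := powsum 3 [seq (wt e j, fo j) | j <- iota 0 3].
have lin s (u : 'rV[R]_2) : \sum_j al s j * event u 0 0 j = x0 * u 0 0 + x1 * u 0 1.
  rewrite big_split_ord /= sum2 big_ord1.
  rewrite -/(space 0) -/(space 1) !event_space al0 al1.
  by rewrite (_ : rshift 2 0 = time)// event_time mulr0 addr0.
have lin' (u : 'rV[R]_2) : \sum_j be j * event u 0 0 j = 0.
  rewrite big_split_ord /= sum2 big_ord1.
  rewrite -/(space 0) -/(space 1) !event_space be0 be1.
  by rewrite (_ : rshift 2 0 = time)// event_time !mul0r mulr0 !addr0.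
have P0 e u : at_time (P e) 0 u = 0.
  rewrite /at_time -/(event u 0) /P /powsum !big_map !big_cons big_nil /wt /fo /=.
  by rewrite /dpow !lin lin' expr0n /= !mulr0 !addr0 mulNr subrr.
have sP e : smooth 0 (P e) by exact: smooth_powsum.
have fP e : flat 3 (P e) by exact: flat_powsum.
have gP e : deformation_germ (fun z => h' z + P e z).
  split; first by apply/smoothE; exact: smoothD.
  by apply: filterS h0 => u hu; rewrite /at_time -/(event u 0) [h' _]hu [P e _]P0 addr0.
pose y e : set_type (@deformation_germ R) := SigSub (mem_set (gP e)).
exists y; split.
  apply: (@jets_cvg R _ _ _ (fun x : set_type (@deformation_germ R) => jet (set_val x))) => s.
  rewrite (_ : (fun e => _) = fun e => ders s h' 0 + ders s (P e) 0).
    rewrite [X in _ --> X](_ : _ = ders s h' 0 + 0); last by rewrite addr0 dersE.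
    apply: cvgD; first exact: cvg_cst.
    apply: cvg_powsum; case=> [|[|[|j]]]; rewrite /wt /=.
    - exact: cvg_id.
    - by rewrite -[X in _ --> X]oppr0; apply: cvgN; exact: cvg_id.
    - by have := cvgM (cvg_cst (- 2 : R)) (@cvg_id _ (nbhs (0 : R))); rewrite mulr0; apply.
    - by rewrite nth_nil; exact: cvg_cst.
  by apply/funext => e; rewrite -(dersD s sh (sP e)) dersE.
move=> e e0; rewrite (_ : deformation_fun _ = fun z => h' z + P e z)//.
have sYh j : smooth 0 (Y h' j) by exact: sY.
have Y'E : Y (fun z => h' z + P e z) = perturb (Y h') (@vertical R i) (P e).
  by rewrite /Y perturb_track.
have [_ _ dHs _] := dev_fH (space 0) (space 1) (@vertical R i) sYh (sP e) (ltnSn 0) (fP e).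
have [_ _ dLs _] := dev_fL (space 0) (space 1) (@vertical R i) sYh (sP e) (ltnSn 0) (fP e).
rewrite -Y'E in dHs dLs.
pose nu := normal_part (space 0) (space 1) (Y h') (@vertical R i).
have nu0 : nu != 0 by exact: normal_part_track.
pose q1 := bil (met X 0 0 0) (met X 0 1 0) (met X 1 1 0) x0 x1 x0 x1.
pose q2 := bil (sff 0 1 X 0 0 0) (sff 0 1 X 0 1 0) (sff 0 1 X 1 1 0) x0 x1 x0 x1.
have IF c d := initial_quadratic_forms h0 c d.
have S A B C c : \sum_(v <- [seq (wt e j, fo j) | j <- iota 0 3]) v.1 *
    ((\prod_(d <- [:: c]) v.2 d) *
      bil A B C (v.2 (space 0)) (v.2 (space 1)) (v.2 (space 0)) (v.2 (space 1))) =
    e * (al 1 c - al (-1) c) * bil A B C x0 x1 x0 x1.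
  rewrite !big_map !big_cons !big_nil !mulr1 /wt /fo /= !al0 !al1 !be0 !be1.
  have -> : bil A B C 0 0 0 0 = 0 by rewrite /bil; ring.
  ring.
have dHt c : dH (space 0) (space 1) (Y h') (@vertical R i) (P e) [:: c] =
    nu * (e * (al 1 c - al (-1) c) * q1).
  apply: etrans (dH_powsum (space 0) (space 1) (Y h') (@vertical R i) [seq (wt e j, fo j) | j <- iota 0 3] [:: c]) _.
  by rewrite S !(IF _ _).1.
have dKt c : dK (space 0) (space 1) (Y h') (@vertical R i) (P e) [:: c] =
    nu * (e * (al 1 c - al (-1) c) * q2).
  apply: etrans (dK_powsum (space 0) (space 1) (Y h') (@vertical R i) [seq (wt e j, fo j) | j <- iota 0 3] [:: c]) _.
  by rewrite S !(IF _ _).2.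
have al_space : al 1 (space k) - al (-1) (space k) = 0.
  by case: (ord2P k) => ->; rewrite ?al0 ?al1 subrr.
have [nD nH nL] := initial_forms h0.
have dHc c := dHs [:: c] (leqnn 1); have dLc c := dLs [:: c] (leqnn 1).
have [D0 _ [L0 H0 _]] := dX.
have [Dh Hh Lh] := And3 (initial_value nD) (initial_value nH) (initial_value nL).
have dd F g : {near (0 : 'rV[R]_2), at_time F 0 =1 g} -> der (space k) F 0 = der k g 0.
  by move=> Fg; exact: initial_value (initial_der Fg k).
rewrite /turning /jac /=.
have -> : der (space k) (H (fun z => h' z + P e z)) 0 = der k (fH 0 1 X) 0.
  by rewrite [LHS](dHc (space k)) dHt al_space mulr0 mul0r mulr0 addr0; exact: dd.
have -> : der (space k) (L (fun z => h' z + P e z)) 0 = der k (fL 0 1 X) 0.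
  rewrite [LHS](dLc (space k)) dHt dKt al_space !(mulr0, mul0r) !addr0; exact: dd.
have -> : der time (H (fun z => h' z + P e z)) 0 = der time (H h') 0 + 2 * nu * e * q1.
  by rewrite [LHS](dHc time) dHt !al_time; congr (_ + _); ring.
have -> : der time (L (fun z => h' z + P e z)) 0 = der time (L h') 0 + 8 * fD 0 1 X 0 * nu * e * q2.
  rewrite [LHS](dLc time) dHt dKt !al_time -/(H h') -/(D h') Hh H0 Dh; congr (_ + _); ring.
move: t0; rewrite /turning /jac (dd _ _ nH) (dd _ _ nL) => t0.
(* Since [lam] is the quotient of the [k]-th derivatives of L and H, the change of the Jacobian is a
   nonzero multiple of the form that [split_form] made nonzero. *)
rewrite (_ : _ - _ = (der time (L h') 0 * der k (fH 0 1 X) 0 - der k (fL 0 1 X) 0 * der time (H h') 0)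
  + 2 * nu * e * der k (fH 0 1 X) 0 * (4 * fD 0 1 X 0 * q2 - lam * q1)).
  by rewrite t0 add0r !mulf_neq0// pnatr_eq0.
by rewrite /lam; field.
Qed.

Lemma dense_turning k : der k (fH 0 1 X) 0 != 0 ->
  [set: @deformation R] `<=` closure [set h | turning k (deformation_fun h) != 0].
Proof.
move=> hk h _; have [t0|t0] := eqVneq (turning k (deformation_fun h)) 0; last exact: subset_closure.
have [y [yh ty]] := make_turning hk t0.
have yh' : y e @[e --> (0 : R)^'] --> h by exact: cvg_within_filter yh.
set A := [set h | _]; have nC : \forall e \near (0 : R)^', closure A (y e).
  by apply: filterS (nbhs_dnbhs_neq (0 : R)) => e e0; apply: subset_closure; exact: ty.
exact: (@closed_cvg _ _ _ (@Proper_dnbhs_numFieldType R 0) y _ (@closed_closure _ A) nC _ yh').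
Qed.

Section Deformation.
Variables (h : 'rV[R]_(2 + 1) -> R) (k : 'I_2).
Hypotheses (sh : smooth 0 h) (h0 : \forall u \near (0 : 'rV[R]_2), at_time h 0 u = 0).
Hypotheses (hk : der k (fH 0 1 X) 0 != 0) (th : turning k h != 0).

Let Z t := deformed i q f h t.

Lemma slice_invariants u t : (forall j, smooth (event u t) (Y h j)) ->
  [/\ smooth_at u (Z t), delta (Z t) u = D h (event u t),
     MCNC (Z t) u = H h (event u t), LPL (Z t) u = L h (event u t) &
     jac 0 1 (LPL (Z t)) (MCNC (Z t)) u = jac (space 0) (space 1) (L h) (H h) (event u t)].
Proof.
move=> sYz; have cE : coords (Z t) = fun j => at_time (Y h j) t by exact: coords_deformed.
have sZ : smooth_at u (Z t).
  apply/smooth_rowP => j; rewrite -[X in smooth u X]/(coords (Z t) j) cE; exact: smooth_at_time.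
have [eD _ eH eL] := near_invariantsE sZ; rewrite cE in eD eH eL.
have [gD gH gL] := forms_at_time (Y h) t 0 1; rewrite gD in eD; rewrite gH in eH; rewrite gL in eL.
split=> //; [exact: nbhs_singleton eD|exact: nbhs_singleton eH|exact: nbhs_singleton eL|].
rewrite -[RHS]/(at_time (jac (space 0) (space 1) (L h) (H h)) t u) -jac_at_time.
by rewrite /jac !(near_eq_der _ eL) !(near_eq_der _ eH).
Qed.

Lemma lsubmx_norm (z : 'rV[R]_(2 + 1)) : `|lsubmx z| <= `|z|.
Proof. by apply: row_norm_le => // j; rewrite mxE; exact: le_row_norm. Qed.

Lemma graph_bifurcation : deforms_as_stated Z.
Proof.
have [nD nH nL] := initial_forms h0; have [D0 _ [L0 H0 J0]] := dX.
have [i' ik ikP] := other2 k.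
have sL : smooth 0 (L h) by apply: smooth_fL => j; exact: sY.
have sH : smooth 0 (H h) by apply: smooth_fH => j; exact: sY.
have sX' := smooth_fL 0 1 sX; have sX'' := smooth_fH 0 1 sX.
have [| | | | | | | | |b [rho [rho0 two none]]] :=
  @fold_bifurcation R _ (L h) (H h) 0 (space i') (space k) time _ _ _ _ sL sH _ _ _ _ _ th.
- by apply: contra ik => /eqP/lshift_inj ->.
- by rewrite eq_rlshift.
- by rewrite eq_rlshift.
- move=> j; case: (spacetimeP j) => [[l ->]|->]; last exact: Or33.
  by case: (ikP l) => ->; [exact: Or31|exact: Or32].
- by rewrite (initial_value nL).
- by rewrite (initial_value nH).
- by have := initial_value (initial_der nH k) => ->.
- rewrite (initial_value (initial_jac i' k nL nH)).
  by case: (jac2 (fL 0 1 X) (fH 0 1 X) 0 ik) => ->; rewrite J0 ?oppr0.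
- rewrite (initial_value (initial_jac i' k (initial_jac i' k nL nH) nH)).
  by rewrite (jac_jac2 ik sX' sX'').
have good : \forall z \near (0 : 'rV[R]_(2 + 1)), (forall j, smooth z (Y h j)) /\ 0 < D h z.
  apply: filterI.
    apply: (@filter_forall _ _ (fun j z => smooth z (Y h j)) (nbhs (0 : 'rV[R]_(2 + 1)))) => j.
    exact: smooth_near (sY j sh).
  apply: smooth_near_gt0; first by apply: smooth_fD => j; exact: sY.
  by rewrite (initial_value nD).
have /nbhs_ballP[r1 /= r10 ball_good] := good.
pose r := Num.min r1 rho; have r0 : 0 < r by rewrite lt_min r10.
have goodr u t : `|u| < r -> `|t| < r -> [/\ (forall j, smooth (event u t) (Y h j)),
    0 < D h (event u t) & `|event u t - 0| < rho].
  move=> ur tr; have := event_norm ur tr; rewrite lt_min => /andP[e1 e2].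
  have [|h1 h2] := ball_good (event u t); last by rewrite subr0.
  by rewrite -ball_normE /= sub0r normrN.
have discr u t : `|u| < r -> `|t| < r ->
    LPL (Z t) u = MCNC (Z t) u ^+ 2 + 4 * (delta (Z t) u * PC (Z t) u) /\ delta (Z t) u != 0.
  move=> ur tr; have [sz Dz _] := goodr u t ur tr.
  have [sZ dE _ _ _] := slice_invariants sz.
  by split; [exact: nbhs_singleton (near_discriminant sZ)|rewrite dE gt_eqF].
(* By the identity, with [delta] nonzero, a common zero of two of the functions is a zero of the
   third; so the three pairwise intersections coincide, and those of L and H determine them. *)
have LK u t : `|u| < r -> `|t| < r -> LPL (Z t) u = 0 -> PC (Z t) u = 0 -> MCNC (Z t) u = 0.
  move=> ur tr L0' K0; have [E _] := discr u t ur tr.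
  by apply/eqP; move/esym/eqP: E; rewrite L0' K0 !mulr0 addr0 sqrf_eq0.
have LH u t : `|u| < r -> `|t| < r -> LPL (Z t) u = 0 -> MCNC (Z t) u = 0 -> PC (Z t) u = 0.
  move=> ur tr L0' H0'; have [E d0] := discr u t ur tr.
  apply/eqP; move/esym/eqP: E; rewrite L0' H0' expr0n add0r mulf_eq0 pnatr_eq0 /=.
  by rewrite mulf_eq0 (negPf d0).
have KH u t : `|u| < r -> `|t| < r -> PC (Z t) u = 0 -> MCNC (Z t) u = 0 -> LPL (Z t) u = 0.
  by move=> ur tr K0 H0'; have [-> _] := discr u t ur tr; rewrite K0 H0' !mulr0 addr0 expr0n.
exists b, [set u | `|u| < r].
  by apply/nbhs_ballP; exists r => //= u; rewrite -ball_normE /= sub0r normrN.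
move=> U /nbhs_ballP[eps /= eps0 epsU] Ur.
(* [U] contains a ball of radius [eps], where both intersection points are made to lie; uniqueness
   holds in the larger ball of radius [rho], which does not depend on [U]. *)
have [tau tau0 two'] := two eps eps0.
have nt : \forall t \near (0 : R)^'+, 0 < t < Num.min tau r.
  have m0 : 0 < Num.min tau r by rewrite lt_min tau0.
  apply: filterS2 (nbhs_right_gt (0 : R)) (nbhs_right_lt m0) => t h1 h2.
  by rewrite h1 h2.
apply: filterS nt => t /andP[t0]; rewrite lt_min => /andP[ttau tr].
set s := (-1) ^+ b * t; have sr : `|s| < r by rewrite norm_signr// gtr0_norm.
have s'r : `|- s| < r by rewrite normrN.
have vL u v : `|u| < r -> `|v| < r -> LPL (Z v) u = L h (event u v) /\ MCNC (Z v) u = H h (event u v).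
  move=> ur vr; have [sz _ _] := goodr u v ur vr.
  by have [_ _ -> -> _] := slice_invariants sz.
split.
  have [|z1 [z2 [z12 zP zU]]] := two' t; first by rewrite t0.
  have zE z : z = z1 \/ z = z2 -> event (lsubmx z) s = z.
    by move=> /zP[_ zt _ _ _]; rewrite -[RHS]eventK zt mxE add0r.
  have zr z : z = z1 \/ z = z2 -> U (lsubmx z).
    move=> /zP[ze _ _ _ _]; apply: epsU; rewrite -ball_normE /= sub0r normrN.
    by apply: le_lt_trans (lsubmx_norm z) _; rewrite subr0 in ze.
  have pE u : [set lsubmx z1; lsubmx z2] u -> exists2 z, z = z1 \/ z = z2 & u = lsubmx z.
    by case=> ->; [exists z1; [left|]|exists z2; [right|]].
  have P u : U u /\ LPL (Z s) u = 0 /\ MCNC (Z s) u = 0 <-> [set lsubmx z1; lsubmx z2] u.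
    split=> [[Uu [Lu Hu]]|/pE[z zz ->]].
      have ur := Ur u Uu; have [vl vh] := vL u s ur sr; have [_ _ er] := goodr u s ur sr.
      have [| | |uz|uz] := zU (event u s) er; rewrite ?event_time ?mxE ?add0r -?vl -?vh//.
        by left; rewrite -uz row_mxKl.
      by right; rewrite -uz row_mxKl.
    have Uz := zr z zz; have [vl vh] := vL _ s (Ur _ Uz) sr; have [_ _ Lz Hz _] := zP z zz.
    by rewrite vl vh zE.
  exists (lsubmx z1), (lsubmx z2); split.
  - apply: contra z12 => /eqP e; rewrite -(zE z1) ?e ?zE//; by [right|left].
  - apply/seteqP; split=> u; first by move=> [[h1 h2] h3]; apply/P.
    by move=> /P[h1 [h2 h3]].
  - apply/seteqP; split=> u.
      by move=> [[h1 h2] h3]; apply/P; split=> //; split=> //; exact: LK (Ur u h1) sr h2 h3.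
    by move=> /P[h1 [h2 h3]]; split=> //; exact: LH (Ur u h1) sr h2 h3.
  - apply/seteqP; split=> u.
      by move=> [[h1 h2] h3]; apply/P; split=> //; split=> //; exact: KH (Ur u h1) sr h2 h3.
    by move=> /P[h1 [h2 h3]]; split=> //; split=> //; exact: LH (Ur u h1) sr h2 h3.
  - move=> p /pE[z zz ->]; have Uz := zr z zz; have ur := Ur _ Uz.
    have [sz Dz _] := goodr _ s ur sr; have [sZ dE HE LE jE] := slice_invariants sz.
    have [_ _ Lz Hz Jz] := zP z zz; rewrite zE// in dE HE LE jE Dz.
    have J1 : jac (space 0) (space 1) (L h) (H h) z != 0.
      move: Jz; case: (ord2P i') (ord2P k) ik => -> [] -> //= _.
      by rewrite jac_swap oppr_eq0.
    rewrite -jE in J1.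
    have [sD sK sM sLP] := smooth_invariants sZ.
    apply: (tangency_of_crossing sLP sM sK sD _ (near_discriminant sZ) _ _ _ J1).
    + by rewrite dE.
    + by rewrite LE.
    + case: (eqVneq (der 0 (LPL (Z s)) (lsubmx z)) 0) => [e0|]; last by exists 0.
      case: (eqVneq (der 1 (LPL (Z s)) (lsubmx z)) 0) => [e1|]; last by exists 1.
      by move: J1; rewrite /jac e0 e1 !mul0r subrr eqxx.
    + by rewrite HE.
have trho : 0 < t < rho by rewrite t0 (lt_le_trans tr)// ge_min lexx orbT.
have no u : U u -> LPL (Z (- s)) u = 0 -> MCNC (Z (- s)) u = 0 -> False.
  move=> Uu; have ur := Ur u Uu; have [-> ->] := vL u (- s) ur s'r.
  have [_ _ er] := goodr u (- s) ur s'r.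
  by apply: (none t _ trho er); rewrite event_time mxE sub0r.
split; apply/seteqP; split=> u //= [[h1 h2] h3]; apply: (no u h1) => //.
- exact: LK (Ur u h1) s'r h2 h3.
- exact: KH (Ur u h1) s'r h2 h3.
Qed.

End Deformation.

Theorem generic_graph_deformations : exists2 O : set (@deformation R),
  open_dense_in [set: deformation] O & forall h, O h ->
    deforms_as_stated (fun t => graph i q (fun u => f u + at_time (deformation_fun h) t u)).
Proof.
have [k hk] : exists k, der k (fH 0 1 X) 0 != 0 by exact: regular_H_of_fold WX.
exists [set h | turning k (deformation_fun h) != 0]; last first.
  by move=> h th; have [sh h0] := germP h; exact: graph_bifurcation sh h0 hk th.
split=> //; last exact: dense_turning.
by exists [set h | turning k (deformation_fun h) != 0]; [exact: open_turning|rewrite setTI].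
Qed.

End GraphBifurcation.

Lemma local_configuration {R : realType} (x : 'rV[R]_2 -> 'rV[R]_3) : smooth_at 0 x ->
  fold_point x -> fold_at (LPL x) (MCNC x) 0 != 0 -> contact_orders x /\ configuration x.
Proof.
move=> sx [D0 rL [L0 H0 J0]] W0.
have [sD sK sH sL] := smooth_invariants sx; have LE := near_discriminant sx.
split; first exact: contacts_of_fold sL sH sK sD D0 LE L0 rL H0 J0 W0.
split.
- exact: regular_K sH sK sD D0 LE L0 rL H0.
- by apply/regularE; split=> //; exact: regular_H_of_fold W0.
- exact: relative_position sL sH sD D0 LE L0 H0 J0 W0.
Qed.

Theorem theorem4p3 (R : realType) :
  open_dense_in (@G1 R)
    [set M : surface_germ R | G1 M /\
      (forall x : local_param R, surface_of x = M ->
         contact_orders (param_fun x) /\ configuration (param_fun x)) /\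
      generic_deformations M].
Proof.
(* The set of the statement is identified with the one given by [W]: forwards through the contact of
   order two and the regularity of the MCNC, backwards for every parametrization and every Monge
   form. *)
apply: G1_open_dense => M; split=> [[gM [cM _]]|[gM wM]].
  split=> // x xM; have [[_ c2] [_ /regularE[_ rH] _]] := cM x xM.
  have [_ _ sH sL] := smooth_invariants (param_smooth x).
  exact: contact2_fold sL sH c2 rH.
have fM x : surface_of x = M -> fold_point (param_fun x).
  move=> xM; case: gM => y /= gy yM; apply: (@fold_point_same _ x y); first by rewrite xM yM.
  exact: (G1_paramE (param_smooth y)).1 gy.
split=> //; split=> [x xM|i q f [y yM yE]].
  exact: local_configuration (param_smooth x) (fM x xM) (wM x xM).
have sG := param_smooth y; have fG := fM y yM; have wG := wM y yM.
rewrite yE in sG fG wG; exact: generic_graph_deformations sG fG wG.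
Qed.
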